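(* Let $F : L^2(\Omega)\to\mathbb{R}$ be bounded from below and twice continuously Fréchet differentiable, and suppose there is $C>0$ such that $|\nabla^2F(\xi)(u,w)| \le C\|u\|_{L^1(\Omega)}\|w\|_{L^1(\Omega)}$ for all $\xi,u,w\in L^2(\Omega)$. Let the iterates $(v^n)_n$ be produced by Algorithm SLIP. Then all iterates lie in $\mathcal{F}_P$, and the sequence of objective values $(J(v^n))_n$ is monotonically decreasing. Moreover, one of the following mutually exclusive outcomes holds: 1. The sequence $(v^n)_n$ is finite; its final element $v^{N}$ solves $(\mathrm{TR}(v^N,\nabla F(v^N),\Delta))$ for some $\Delta>0$, and $v^N$ is L-stationary. 2. The sequence $(v^n)_n$ is finite, and the inner loop does not terminate for the final element $v^N$, which is L-stationary. 3. The sequence $(v^n)_n$ (is infinite and) has a weak-$^*$ accumulation point in $BV(\Omega)$. Every weak-$^*$ accumulation point of $(v^n)_n$ is in $\mathcal{F}_P$, is L-stationary, and is strict. If the trust-region radii are bounded away from zero along a subsequence $(v^{n_\ell})_\ell$, that is, if $\liminf_{\ell\to\infty}\min_k \Delta^{n_\ell+1,k} > 0$, and $\bar v$ is a weak-$^*$ accumulation point of $(v^{n_\ell})_\ell$, then $\bar v$ solves $(\mathrm{TR}(\bar v,\nabla F(\bar v),\bar\Delta))$ for some $\bar\Delta>0$.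
   Context: Setting: $t_0 < t_f$ are real, $\Omega = (t_0,t_f)$, $\alpha > 0$, $\nu_1 < \cdots < \nu_M$ are integers ($M \ge 1$). $\operatorname{TV}$ is the total variation on $L^1(\Omega)$, $BV(\Omega)$ the space of functions in $L^1(\Omega)$ with finite total variation, $\mathcal{F}_P$ is the set of $v \in L^2(\Omega)$ with $v(x) \in \{\nu_1,\ldots,\nu_M\}$ for a.a. $x\in\Omega$, and $J(v) := F(v)+\alpha\operatorname{TV}(v)$. $\nabla F(v)\in L^2(\Omega)$ is the (Riesz) gradient. Trust-region problem: $(\mathrm{TR}(\tilde v,\tilde g,\Delta))$ is the problem of minimizing $(\tilde g, w - \tilde v)_{L^2(\Omega)} + \alpha\operatorname{TV}(w) - \alpha\operatorname{TV}(\tilde v)$ over $w \in \mathcal{F}_P$ with $\|w - \tilde v\|_{L^1(\Omega)} \le \Delta$. Algorithm SLIP: inputs $\Delta^0>0$, $\sigma\in(0,1)$, $v^0\in\mathcal{F}_P\cap BV(\Omega)$. For $n=1,2,\ldots$ (outer loop): set $k=0$, $\Delta^{n,0}=\Delta^0$ and run the inner loop: let $\bar v^{n,k}$ be a minimizer of $(\mathrm{TR}(v^{n-1},\nabla F(v^{n-1}),\Delta^{n,k}))$; put $\mathrm{pred} = (\nabla F(v^{n-1}),v^{n-1}-\bar v^{n,k})_{L^2(\Omega)}+\alpha\operatorname{TV}(v^{n-1})-\alpha\operatorname{TV}(\bar v^{n,k})$ and $\mathrm{ared} = F(v^{n-1})+\alpha\operatorname{TV}(v^{n-1})-F(\bar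 v^{n,k})-\alpha\operatorname{TV}(\bar v^{n,k})$. If $\mathrm{pred}\le 0$, the whole algorithm terminates with final iterate $v^{n-1}$. Otherwise, if $\mathrm{ared}<\sigma\,\mathrm{pred}$, set $\Delta^{n,k+1}=\Delta^{n,k}/2$, increase $k$ by one, and repeat the inner loop. Otherwise set $v^n=\bar v^{n,k}$ (step accepted), end the inner loop and continue with the next $n$. In $\min_k\Delta^{n,k}$, $k$ ranges over the inner iterations executed in outer iteration $n$. If the inner loop in outer iteration $n$ never ends, the final element is $v^{n-1}$. Weak-$^*$ convergence in $BV(\Omega)$ of a sequence $(w^n)_n$ to $w$ means $w^n\to w$ in $L^1(\Omega)$ and the distributional derivatives converge weakly-$^*$ as measures; strict convergence means $w^n\to w$ in $L^1(\Omega)$ and $\operatorname{TV}(w^n)\to\operatorname{TV}(w)$. A weak-$^*$ accumulation point is the limit of a weakly-$^*$ convergent subsequence; it is strict if it is the limit of a strictly convergent subsequence. L-stationarity: every $v \in \mathcal{F}_P \cap BV(\Omega)$ equals (a.e.) a function $\chi_{(t_0,t_1)} a_1 + \sum_{i=1}^{m-1}\chi_{[t_i,t_{i+1})} a_{i+1}$ with $t_0<t_1<\cdots<t_m=t_f$, $a_i\in\{\nu_1,\ldots,\nu_M\}$ and $a_i\neq a_{i+1}$ for $i=1,\ldots,m-1$. With $g=\nabla F(v)$ set, for $i=1,\ldots,m-1$, $\overline{D_i^+}(g) = \limsup_{h\downarrow 0}\frac1h\int_{t_i}^{t_i+h} g\,ds$, $\underline{D_i^+}(g) = \liminf_{h\downarrow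 0}\frac1h\int_{t_i}^{t_i+h} g\,ds$, $\overline{D_i^-}(g) = \limsup_{h\downarrow 0}\frac1h\int_{t_i-h}^{t_i} g\,ds$, $\underline{D_i^-}(g) = \liminf_{h\downarrow 0}\frac1h\int_{t_i-h}^{t_i} g\,ds$. Then $v$ is L-stationary if for all $i\in\{1,\ldots,m-1\}$: $\overline{D_i^-}(g) \ge 0 \ge \underline{D_i^+}(g)$ if $a_i < a_{i+1}$, and $\underline{D_i^-}(g) \le 0 \le \overline{D_i^+}(g)$ if $a_{i+1} < a_i$. *)

(* Defs.v *)
From HB Require Import structures.
From mathcomp Require Import all_boot all_order all_algebra.
From mathcomp Require Import all_classical all_reals all_analysis.

Set Implicit Arguments.
Unset Strict Implicit.
Unset Printing Implicit Defensive.

Import Order.TTheory GRing.Theory Num.Theory.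
Import numFieldNormedType.Exports.

Local Open Scope classical_set_scope.
Local Open Scope ring_scope.

(* Functions on the interval Omega = ]t0, tf[ are represented by functions on
   the whole line; the measure below ignores their values outside Omega, so
   that almost everywhere always means almost everywhere in Omega. *)

Section spaces.
Context {R : realType} (t0 tf : R).

Definition lebesgue_on : {measure set (measurableTypeR R) -> \bar R} :=
  mrestr (@lebesgue_measure R) (measurable_itv `]t0, tf[).

(* L2 consists of functions and not of classes; functionals on the space
   L2(Omega) are required to be compatible with almost everywhere equality in
   twice_cont_frechet. *)
Definition L2 := LfunType lebesgue_on (lee1n 2).

Definition normL1 (f : R -> R) : \bar R := 'N[lebesgue_on]_1[EFin \o f].

Definition normL2 (f : R -> R) : \bar R := 'N[lebesgue_on]_2%:E[EFin \o f].

Definition innerL2 (f g : R -> R) : R := \int[lebesgue_on]_x (f x * g x).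

(* C_c^1(Omega) *)
Definition C1c (phi : R -> R) : Prop :=
  [/\ forall x, derivable phi x 1, continuous (derive1 phi)
    & exists a b, [/\ t0 < a, b < tf &
        forall x, x \notin `[a, b] -> phi x = 0]].

(* C_0(Omega), whose elements are extended to the line by zero. *)
Definition C0 (phi : R -> R) : Prop :=
  continuous phi /\ forall x, x \notin `]t0, tf[ -> phi x = 0.

Definition TV (f : R -> R) : \bar R :=
  ereal_sup [set (\int[lebesgue_on]_x (f x * derive1 phi x))%:E | phi in
    [set phi | C1c phi /\ forall x, `|phi x| <= 1]].

Definition BV (f : R -> R) : Prop :=
  f \in Lfun lebesgue_on 1 /\ (TV f < +oo)%E.

Definition charge_integral (nu : {charge set (measurableTypeR R) -> \bar R})
    (phi : R -> R) : R :=
  let posset := cid (Hahn_decomposition nu) in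
  let negset := cid (projT2 posset) in
  \int[jordan_pos (projT2 negset)]_(x in `]t0, tf[) phi x -
  \int[jordan_neg (projT2 negset)]_(x in `]t0, tf[) phi x.

Definition distributional_derivative (f : R -> R)
    (nu : {charge set (measurableTypeR R) -> \bar R}) : Prop :=
  forall phi, C1c phi ->
    \int[lebesgue_on]_x (f x * derive1 phi x) = - charge_integral nu phi.

Definition cvgL1 (w : nat -> R -> R) (f : R -> R) : Prop :=
  normL1 (w n \- f) @[n --> \oo] --> 0%E.

Definition weakstar_cvg (w : nat -> R -> R) (f : R -> R) : Prop :=
  [/\ forall n, BV (w n), BV f, cvgL1 w f &
    exists (nu : nat -> {charge set (measurableTypeR R) -> \bar R})
           (nu_lim : {charge set (measurableTypeR R) -> \bar R}),
      [/\ forall n, distributional_derivative (w n) (nu n),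
          distributional_derivative f nu_lim &
          forall phi, C0 phi ->
            charge_integral (nu n) phi @[n --> \oo] -->
            charge_integral nu_lim phi]].

Definition strict_cvg (w : nat -> R -> R) (f : R -> R) : Prop :=
  [/\ forall n, BV (w n), BV f, cvgL1 w f & TV (w n) @[n --> \oo] --> TV f].

Definition subsequence_index (s : nat -> nat) : Prop :=
  {homo s : m n / (m < n)%N}.

Definition weakstar_accumulation (w : nat -> R -> R) (f : R -> R) : Prop :=
  exists2 s, subsequence_index s & weakstar_cvg (w \o s) f.

Definition strict_accumulation (w : nat -> R -> R) (f : R -> R) : Prop :=
  exists2 s, subsequence_index s & strict_cvg (w \o s) f.

End spaces.

Section frechet.
Context {R : realType} (t0 tf : R).
Local Notation L2 := (L2 t0 tf).
Local Notation "'N2 f" := (normL2 t0 tf f) (at level 10, f at level 8).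

(* DF v is the Frechet derivative of F at v. *)
Definition frechet_derivative (F : L2 -> R) (DF : L2 -> L2 -> R) : Prop :=
  forall v,
  [/\ scalar (DF v),
      exists C : R, forall h : L2, (`|DF v h|%:E <= C%:E * 'N2 h)%E &
      forall e : R, 0 < e -> exists2 d : R, 0 < d &
        forall h : L2, ('N2 h < d%:E)%E ->
          (`|F (v + h)%R - F v - DF v h|%:E <= e%:E * 'N2 h)%E].

(* D2F v, seen as a bounded bilinear form, is the Frechet derivative at v of
   the map DF from L2 to its dual, the latter having the operator norm. *)
Definition frechet_derivative2 (DF : L2 -> L2 -> R)
    (D2F : L2 -> L2 -> L2 -> R) : Prop :=
  forall v,
  [/\ forall w, scalar (fun u => D2F v u w),
      forall u, scalar (D2F v u),
      exists C : R, forall u w : L2,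
        (`|D2F v u w|%:E <= C%:E * 'N2 u * 'N2 w)%E &
      forall e : R, 0 < e -> exists2 d : R, 0 < d &
        forall u w : L2, ('N2 u < d%:E)%E ->
          (`|DF (v + u)%R w - DF v w - D2F v u w|%:E
             <= e%:E * 'N2 u * 'N2 w)%E].

Definition continuous_bilinear_valued (D2F : L2 -> L2 -> L2 -> R) : Prop :=
  forall v (e : R), 0 < e -> exists2 d : R, 0 < d &
    forall h u w : L2, ('N2 h < d%:E)%E ->
      (`|D2F (v + h)%R u w - D2F v u w|%:E <= e%:E * 'N2 u * 'N2 w)%E.

(* F is a twice continuously Frechet differentiable functional on L2(Omega),
   with first and second derivatives DF and D2F. *)
Definition twice_cont_frechet (F : L2 -> R) (DF : L2 -> L2 -> R)
    (D2F : L2 -> L2 -> L2 -> R) : Prop :=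
  [/\ forall u v : L2, u = v %[ae lebesgue_on t0 tf] -> F u = F v,
      frechet_derivative F DF, frechet_derivative2 DF D2F &
      continuous_bilinear_valued D2F].

Definition riesz_gradient (DF : L2 -> L2 -> R) (gradF : L2 -> L2) : Prop :=
  forall v h, DF v h = innerL2 t0 tf (gradF v) h.

End frechet.

Section problem.
Context {R : realType} (t0 tf : R) (M : nat) (nu : 'I_M -> int) (alpha : R).
Local Notation L2 := (L2 t0 tf).
Local Notation TV := (TV t0 tf).

Definition FP (v : L2) : Prop :=
  {ae lebesgue_on t0 tf, forall x, exists i, v x = (nu i)%:~R}.

Definition J (F : L2 -> R) (v : L2) : \bar R :=
  ((F v)%:E + alpha%:E * TV v)%E.

Definition TR_feasible (v : L2) (Delta : R) (w : L2) : Prop :=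
  FP w /\ (normL1 t0 tf (w - v)%R <= Delta%:E)%E.

(* TV w may be +oo for a feasible w; the value is then +oo if v is in BV. *)
Definition TR_objective (v g w : L2) : \bar R :=
  ((innerL2 t0 tf g (w - v)%R)%:E + alpha%:E * TV w - alpha%:E * TV v)%E.

Definition TR_solution (v g : L2) (Delta : R) (w : L2) : Prop :=
  TR_feasible v Delta w /\
  forall w', TR_feasible v Delta w' ->
    (TR_objective v g w <= TR_objective v g w')%E.

(* The step function with value a i on the i-th interval, 1 <= i <= m, where
   t 0 = t0, t m = tf, and t i for 0 < i < m is the i-th jump. *)
Definition step_function (m : nat) (t : nat -> R) (a : nat -> int)
    (x : R) : R :=
  \1_(`]t 0%N, t 1%N[%classic) x * (a 1%N)%:~R +
  \sum_(1 <= i < m) \1_(`[t i, t i.+1[%classic) x * (a i.+1)%:~R.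

Definition step_representation (v : L2) (m : nat) (t : nat -> R)
    (a : nat -> int) : Prop :=
  [/\ (0 < m)%N, t 0%N = t0 /\ t m = tf,
      forall i, (i < m)%N -> t i < t i.+1,
      (forall i, (1 <= i <= m)%N -> exists j, a i = nu j) /\
      (forall i, (1 <= i < m)%N -> a i != a i.+1) &
      {ae lebesgue_on t0 tf, forall x, v x = step_function m t a x}].

Definition right_mean (g : R -> R) (s h : R) : \bar R :=
  (h^-1 * \int[lebesgue_on t0 tf]_(x in `[s, s + h]) g x)%:E.

Definition left_mean (g : R -> R) (s h : R) : \bar R :=
  (h^-1 * \int[lebesgue_on t0 tf]_(x in `[s - h, s]) g x)%:E.

Definition upper_Dright (g : R -> R) (s : R) : \bar R :=
  limf_esup (right_mean g s) (0 : R)^'+.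
Definition lower_Dright (g : R -> R) (s : R) : \bar R :=
  limf_einf (right_mean g s) (0 : R)^'+.
Definition upper_Dleft (g : R -> R) (s : R) : \bar R :=
  limf_esup (left_mean g s) (0 : R)^'+.
Definition lower_Dleft (g : R -> R) (s : R) : \bar R :=
  limf_einf (left_mean g s) (0 : R)^'+.

(* The step representation of v is essentially unique (m, the t i with i <= m
   and the a i with 1 <= i <= m are determined by v), so quantifying it
   existentially is no weaker than quantifying it universally; it also makes
   v a member of BV taking only the values nu i. *)
Definition L_stationary (gradF : L2 -> L2) (v : L2) : Prop :=
  exists m t a, step_representation v m t a /\
    forall i, (1 <= i < m)%N ->
      ((a i < a i.+1)%R ->
        (lower_Dright (gradF v) (t i) <= 0)%E /\
        (0 <= upper_Dleft (gradF v) (t i))%E) /\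
      ((a i.+1 < a i)%R ->
        (lower_Dleft (gradF v) (t i) <= 0)%E /\
        (0 <= upper_Dright (gradF v) (t i))%E).

End problem.

Section slip.
Context {R : realType} (t0 tf : R) (M : nat) (nu : 'I_M -> int) (alpha : R).
Local Notation L2 := (L2 t0 tf).
Local Notation TV := (TV t0 tf).

Definition predicted_reduction (gradF : L2 -> L2) (v w : L2) : \bar R :=
  ((innerL2 t0 tf (gradF v) (v - w)%R)%:E + alpha%:E * TV v - alpha%:E * TV w)%E.

Definition actual_reduction (F : L2 -> R) (v w : L2) : \bar R :=
  ((F v)%:E + alpha%:E * TV v - (F w)%:E - alpha%:E * TV w)%E.

(* The radius Delta^{n,k}, which does not depend on n. *)
Definition radius (Delta0 : R) (k : nat) : R := Delta0 / 2 ^+ k.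

Context (F : L2 -> R) (gradF : L2 -> L2) (Delta0 sigma : R).

(* The sequence v contains the iterates v^n and w n k is the minimizer
   \bar v^{n,k} computed in the inner iteration k of the outer iteration n.
   Both are total functions, of which the algorithm computes only a part:
   executed v w n k means that the inner iteration (n, k) is executed. *)
Inductive executed (v : nat -> L2) (w : nat -> nat -> L2) :
    nat -> nat -> Prop :=
| executed_start : executed v w 1 0
| executed_reject n k :
    executed v w n k ->
    (0 < predicted_reduction gradF (v n.-1) (w n k))%E ->
    (actual_reduction F (v n.-1) (w n k) < sigma%:E * predicted_reduction gradF (v n.-1) (w n k))%E ->
    executed v w n k.+1
| executed_accept n k :
    executed v w n k ->
    (0 < predicted_reduction gradF (v n.-1) (w n k))%E ->
    (sigma%:E * predicted_reduction gradF (v n.-1) (w n k) <= actual_reduction F (v n.-1) (w n k))%E ->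
    executed v w n.+1 0.

Definition SLIP_run (v0 : L2) (v : nat -> L2) (w : nat -> nat -> L2) : Prop :=
  [/\ v 0%N = v0,
      forall n k, executed v w n k ->
        TR_solution nu alpha (v n.-1) (gradF (v n.-1)) (radius Delta0 k) (w n k)
    & forall n k, executed v w n k ->
        (0 < predicted_reduction gradF (v n.-1) (w n k))%E ->
        (sigma%:E * predicted_reduction gradF (v n.-1) (w n k)
           <= actual_reduction F (v n.-1) (w n k))%E ->
        v n = w n k].

(* The algorithm produces v^n if and only if it enters the next outer
   iteration. *)
Definition produced (v : nat -> L2) (w : nat -> nat -> L2) (n : nat) : Prop :=
  executed v w n.+1 0.

Definition final_index (v : nat -> L2) (w : nat -> nat -> L2) (N : nat) : Prop :=
  produced v w N /\ ~ produced v w N.+1.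

Definition min_radius (v : nat -> L2) (w : nat -> nat -> L2) (n : nat) : \bar R :=
  ereal_inf [set (radius Delta0 k)%:E | k in [set k | executed v w n k]].

Definition outcome1 (v : nat -> L2) (w : nat -> nat -> L2) : Prop :=
  exists N, [/\ final_index v w N,
    exists2 Delta : R, 0 < Delta &
      TR_solution nu alpha (v N) (gradF (v N)) Delta (v N) &
    L_stationary nu gradF (v N)].

Definition outcome2 (v : nat -> L2) (w : nat -> nat -> L2) : Prop :=
  exists N, [/\ final_index v w N,
    forall k, executed v w N.+1 k &
    L_stationary nu gradF (v N)].

(* A weak-* limit is a priori only a function in BV; that it is in L2 is part
   of the claim. *)
Definition outcome3 (v : nat -> L2) (w : nat -> nat -> L2) : Prop :=
  let iterates : nat -> R -> R := fun n => v n in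
  [/\ forall n, produced v w n,
    exists f, weakstar_accumulation t0 tf iterates f,
    forall f, weakstar_accumulation t0 tf iterates f ->
      (exists2 u : L2, (u : R -> R) = f &
        FP nu u /\ L_stationary nu gradF u) /\
      strict_accumulation t0 tf iterates f &
    forall s, subsequence_index s ->
      (0 < limn_einf (fun l => min_radius v w (s l).+1))%E ->
      forall f, weakstar_accumulation t0 tf (iterates \o s) f ->
        exists2 u : L2, (u : R -> R) = f &
          exists2 Delta : R, 0 < Delta &
            TR_solution nu alpha u (gradF u) Delta u].

End slip.

(* Main.v *)
Require Import Defs.
From HB Require Import structures.
From mathcomp Require Import all_boot all_order all_algebra.
From mathcomp Require Import all_classical all_reals all_analysis.
From mathcomp Require Import measurable_realfun zify ring lra.

Set Implicit Arguments.
Unset Strict Implicit.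
Unset Printing Implicit Defensive.

Import Order.TTheory GRing.Theory Num.Theory.
Import numFieldNormedType.Exports.

Local Open Scope classical_set_scope.
Local Open Scope ring_scope.

(** The argument has an analytic half and an algorithmic half.

    Analytic half.  A function with values in a finite set of integers and
    finite total variation is, almost everywhere, a step function, and its
    variation is at least the sum of its jump sizes ([FP_structure]).  The key
    is [chain_variation_le]: along any increasing chain of Lebesgue points the
    absolute increments of a function add up to at most its total variation.  Since two
    different integers are at distance at least one, chains of points with
    alternating values have bounded length, and a longest chain locates all
    the jumps ([alternating_structure]).  A step function with jumps [d i] at
    [t i] pairs with the derivative of a test function [phi] to minus the sum of
    the [d i * phi (t i)].  Hence its variation is at most the sum of the
    jump sizes, wherever the jumps are, its derivative is a finite combination
    of Dirac masses, and bounded variation gives weak-* compactness by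
    extracting limits of finitely many jump positions
    ([weakstar_compactness]).  Moving one jump between its
    neighbours creates no new value and does not increase the variation; if
    L-stationarity fails at a jump, moving that jump by a small amount decreases
    the linear part of the model at a rate proportional to the L1 distance
    ([L_stationary_of_no_descent]).

    Algorithmic half.  The bound on the second derivative makes the model exact
    up to a quadratic term in the L1 norm ([Taylor_L1]).  So a competitor in the
    trust region whose predicted reduction is at least [delta] forces the
    acceptance of a step as soon as the square of the radius is small compared
    with [delta], and the objective then drops by at least [sigma * delta]
    ([inner_loop_stops], [sufficient_decrease]).  The outcomes follow:

    - if a predicted reduction is nonpositive, the iterate solves its own
      trust-region problem, hence admits no descent by moving a jump;
    - if an inner loop never ends, the iterate admits no such descent either,
      since its decrease is linear in the radius and the error quadratic;
    - if there are infinitely many iterates, the objective values converge, so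
      every fixed drop can occur only finitely often.  An accumulation point
      [u] whose variation is strictly below that of the iterates would itself
      be a competitor producing a fixed drop, so convergence is strict.  With
      strict convergence, predicted reductions at the iterates are eventually
      almost as large as at [u]; a descent for [u] by moving a jump, or, when
      the radii stay bounded below, any better feasible point for [u], would
      again produce a fixed drop infinitely often. *)

(** * Integration over the open interval *)

Section integral_on.
Context {R : realType} (t0 tf : R).
Local Notation mu := (lebesgue_on t0 tf).
Local Notation leb := (@lebesgue_measure R).
Local Notation Om := [set` `]t0, tf[].

#[global] Instance ae_lebesgue_on_filter : Filter (almost_everywhere mu).
Proof. exact: ae_filter_ringOfSetsType. Qed.

Lemma lebesgue_on_setT_lty : (mu setT < +oo)%E.
Proof.
rewrite /lebesgue_on/= /mrestr setTI lebesgue_measure_itv/=.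
by case: ifPn => // _; rewrite -EFinB ltry.
Qed.

(** The complement of the interval is null for the restricted measure, and the
    two measures agree on subsets of the interval. *)
Lemma integral_lebesgue_on (f : R -> \bar R) (D : set R) :
  measurable D -> measurable_fun D f ->
  (\int[mu]_(x in D) f x = \int[leb]_(x in D `&` Om) f x)%E.
Proof.
move=> mD mf.
have mO : measurable (Om : set (measurableTypeR R)) by exact: measurable_itv.
transitivity (\int[mu]_(x in D) (f \_ Om) x)%E.
  apply: ae_eq_integral => //.
    have mfI : measurable_fun (D `&` Om) f.
      by apply: measurable_funS mD _ mf; exact: subIsetl.
    exact/(measurable_restrict _ mO mD).
  exists (~` Om); split; first exact: measurableC.
    by rewrite /lebesgue_on /= /mrestr setICl measure0.
  move=> x /= h xO; apply: h => _; rewrite patchE.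
  by rewrite mem_set.
rewrite -integral_mkcondr; apply: eq_measure_integral => A mA sA.
rewrite /lebesgue_on /= /mrestr setIidl// => x /sA[].
by [].
Qed.

Lemma Rintegral_lebesgue_on (f : R -> R) (D : set R) :
  measurable D -> measurable_fun D f ->
  \int[mu]_(x in D) f x = \int[leb]_(x in D `&` Om) f x.
Proof.
move=> mD mf; rewrite /Rintegral integral_lebesgue_on//.
exact/measurable_EFinP.
Qed.

Definition bounded_on_line (f : R -> R) := exists K, forall x, `|f x| <= K.

Lemma bounded_on_lineE (f : R -> R) : bounded_on_line f ->
  [bounded f x | x in setT].
Proof.
move=> [K fK]; exists K; split; first exact: num_real.
by move=> M KM x _ /=; exact: le_trans (fK x) (ltW KM).
Qed.

Lemma bounded_integrable (f : R -> R) : measurable_fun setT f ->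
  bounded_on_line f -> mu.-integrable setT (EFin \o f).
Proof.
move=> mf /bounded_on_lineE bf; apply: measurable_bounded_integrable => //.
exact: lebesgue_on_setT_lty.
Qed.

Lemma integrable_mul_bounded (f g : R -> R) :
  mu.-integrable setT (EFin \o f) -> measurable_fun setT g ->
  bounded_on_line g -> mu.-integrable setT (EFin \o (fun x => f x * g x)).
Proof.
move=> intf mg /bounded_on_lineE bg.
exact: (integrableMl measurableT intf mg bg).
Qed.

Lemma integrable_norm (f : R -> R) : mu.-integrable setT (EFin \o f) ->
  mu.-integrable setT (EFin \o (fun x => `|f x|)).
Proof. by move=> /integrable_abse. Qed.

Lemma integrable_measurable (f : R -> R) (D : set R) :
  mu.-integrable D (EFin \o f) -> measurable_fun D f.
Proof. by move=> /measurable_int /measurable_EFinP. Qed.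

Lemma ae_eq_Rintegral_on (f g : R -> R) :
  measurable_fun setT f -> measurable_fun setT g ->
  {ae mu, forall x, f x = g x} -> \int[mu]_x f x = \int[mu]_x g x.
Proof.
move=> mf mg fg; rewrite /Rintegral; congr fine; apply: ae_eq_integral => //.
- exact/measurable_EFinP.
- exact/measurable_EFinP.
- by apply: filterS fg => x -> _.
Qed.

(** Replacing [f] by [f \min g], to which it is a.e. equal, turns the a.e.
    comparison into a pointwise one. *)
Lemma le_Rintegral_ae (f g : R -> R) :
  mu.-integrable setT (EFin \o f) -> mu.-integrable setT (EFin \o g) ->
  {ae mu, forall x, f x <= g x} -> \int[mu]_x f x <= \int[mu]_x g x.
Proof.
move=> intf intg fg.
have mf := integrable_measurable intf; have mg := integrable_measurable intg.
have mm : measurable_fun setT (f \min g) by exact: measurable_minr.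
have intm : mu.-integrable setT (EFin \o (f \min g)).
  apply: (le_integrable measurableT _ _
    (integrableD measurableT (integrable_norm intf) (integrable_norm intg))).
    exact/measurable_EFinP.
  move=> x _; rewrite lee_fin [leRHS]ger0_norm ?addr_ge0//=.
  by rewrite /Order.min; case: ifP => _; rewrite ?lerDl ?lerDr.
rewrite (ae_eq_Rintegral_on mf mm).
  by apply: le_Rintegral => // x _; rewrite ge_min lexx orbT.
by apply: filterS fg => x /min_idPl /= ->.
Qed.

Lemma normL1_integral (f : R -> R) : mu.-integrable setT (EFin \o f) ->
  normL1 t0 tf f = (\int[mu]_x `|f x|)%:E.
Proof.
move=> intf; rewrite /normL1 Lnorm1 /Rintegral fineK//=.
rewrite ge0_fin_numE; last by apply: integral_ge0.
by case/integrableP : intf.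
Qed.

Lemma Rintegral_cst_on (c : R) : \int[mu]_x c = c * fine (mu setT).
Proof. by rewrite Rintegral_cst. Qed.

End integral_on.

Section test_functions.
Context {R : realType} (t0 tf : R).
Hypothesis t0tf : t0 < tf.
Local Notation mu := (lebesgue_on t0 tf).
Local Notation leb := (@lebesgue_measure R).
Local Notation Om := [set` `]t0, tf[].

Lemma C1c_continuous (phi : R -> R) : C1c t0 tf phi -> continuous phi.
Proof.
by move=> [dphi _ _] x; apply/differentiable_continuous/derivable1_diffP.
Qed.

Lemma C1c_C0 (phi : R -> R) : C1c t0 tf phi -> C0 t0 tf phi.
Proof.
move=> Cphi; split; first exact: C1c_continuous.
case: Cphi => _ _ [a [b [t0a btf z]]] x; rewrite in_itv/= => xO.
apply: z; apply: contra xO; rewrite in_itv/= => /andP[ax xb].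
by rewrite (lt_le_trans t0a)//= (le_lt_trans xb).
Qed.

Lemma continuous_bounded_itv (f : R -> R) (a b : R) : continuous f ->
  exists2 K, 0 <= K & forall x, a <= x <= b -> `|f x| <= K.
Proof.
move=> cf; have [ab|ba] := leP a b; last first.
  by exists 0 => // x /andP[ax xb]; move: (le_trans ax xb); rewrite leNgt ba.
have cnf : {within `[a, b], continuous (fun x => `|f x|)}.
  apply: continuous_subspaceT => x.
  by apply: continuous_comp; [exact: cf|exact: norm_continuous].
have [c _ cmax] := EVT_max ab cnf.
by exists `|f c| => // x xab; apply: cmax; rewrite in_itv.
Qed.

Lemma C0_bounded (phi : R -> R) : C0 t0 tf phi -> bounded_on_line phi.
Proof.
move=> [cphi z]; have [K K0 phiK] := continuous_bounded_itv t0 tf cphi.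
exists K => x; have [xO|/z ->] := boolP (x \in `]t0, tf[); last by rewrite normr0.
apply: phiK; move: xO; rewrite in_itv/= => /andP[h1 h2].
by rewrite !ltW.
Qed.

(** The derivative vanishes off the compact support, so a bound on a compact
    interval is a global one. *)
Lemma C1c_derive_bounded (phi : R -> R) : C1c t0 tf phi ->
  bounded_on_line (derive1 phi).
Proof.
move=> [dphi cphi [a [b [t0a btf z]]]].
have [K K0 phiK] := continuous_bounded_itv a b cphi.
exists K => x; have [xO|xO] := boolP (x \in `[a, b]).
  by apply: phiK; move: xO; rewrite in_itv.
suff -> : derive1 phi x = 0 by rewrite normr0.
have -> : derive1 phi x = derive1 (cst 0 : R -> R) x.
  rewrite !derive1E; apply: near_eq_derive.
  move: xO; rewrite in_itv/= negb_and -!ltNge => /orP[xa|bx].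
    near=> y; apply: z; rewrite in_itv/= negb_and -ltNge.
    by apply/orP; left; near: y; exact: lt_nbhsl.
  near=> y; apply: z; rewrite in_itv/= negb_and -!ltNge.
  by apply/orP; right; near: y; exact: lt_nbhsr.
by rewrite derive1_cst.
Unshelve. all: by end_near. Qed.

Lemma C1c_derive_measurable (phi : R -> R) : C1c t0 tf phi ->
  measurable_fun setT (derive1 phi).
Proof. by move=> [_ cphi _]; exact: continuous_measurable_fun. Qed.

Lemma integrable_mul_test (f phi : R -> R) :
  mu.-integrable setT (EFin \o f) -> C1c t0 tf phi ->
  mu.-integrable setT (EFin \o (fun x => f x * derive1 phi x)).
Proof.
move=> intf Cphi; apply: integrable_mul_bounded => //.
  exact: C1c_derive_measurable.
exact: C1c_derive_bounded.
Qed.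

(** Right continuous at [t], in agreement with the half-open intervals of
    [step_function]. *)
Definition step_at (t x : R) : R := (t <= x)%R%:R.

Lemma step_atE t : step_at t = \1_(`[t, +oo[%classic).
Proof.
apply/funext => x; rewrite /step_at indicE; congr (nat_of_bool _)%:R.
by apply/idP/idP; rewrite inE/= in_itv/= andbT.
Qed.

Lemma measurable_step_at t : measurable_fun setT (step_at t).
Proof. by rewrite step_atE; exact: measurable_indic. Qed.

Lemma step_at_bounded t : bounded_on_line (step_at t).
Proof.
by exists 1 => x; rewrite /step_at; case: (t <= x); rewrite /= ?normr1 ?normr0 ?ler01.
Qed.

Lemma integral_derive_itv (phi : R -> R) (a b : R) : a <= b ->
  C1c t0 tf phi ->
  (\int[leb]_(x in `[a, b]) (derive1 phi x)%:E = (phi b - phi a)%:E)%E.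
Proof.
move=> ab Cphi; have cphi := C1c_continuous Cphi.
case: Cphi => dphi cdphi _; move: ab; rewrite le_eqVlt => /predU1P[->|ab].
  by rewrite set_itv1 integral_set1 subrr.
rewrite EFinB; apply: continuous_FTC2 => //.
- exact: continuous_subspaceT.
- split; first by move=> x _; exact: dphi.
  + by apply: cvg_at_right_filter; exact: cphi.
  + by apply: cvg_at_left_filter; exact: cphi.
Qed.

(** The fundamental theorem of calculus on [[t, tf]], where [phi tf = 0].  The
    endpoints are allowed for [t], so that jumps may converge to the boundary. *)
Lemma integral_step_at_derive (phi : R -> R) (t : R) : t0 <= t <= tf ->
  C1c t0 tf phi -> \int[mu]_x (step_at t x * derive1 phi x) = - phi t.
Proof.
move=> /andP[t0t ttf] Cphi.
have mp : measurable_fun setT (derive1 phi) by exact: C1c_derive_measurable.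
have [_ z] := C1c_C0 Cphi.
rewrite Rintegral_lebesgue_on//; last first.
  by apply: measurable_funM => //; exact: measurable_step_at.
rewrite setTI.
have -> : \int[leb]_(x in Om) (step_at t x * derive1 phi x) =
    \int[leb]_(x in Om `&` `[t, +oo[) derive1 phi x.
  rewrite Rintegral_mkcondr; apply: eq_Rintegral => x _.
  rewrite patchE /step_at; case: ifPn; rewrite ?inE ?notin_setE/= in_itv/= andbT.
    by move=> ->; rewrite mul1r.
  by move/negP/negbTE => ->; rewrite mul0r.
have phitf : phi tf = 0 by apply: z; rewrite in_itv/= ltxx andbF.
have [ett|ntt] := eqVneq t tf.
  rewrite ett phitf oppr0 (_ : _ `&` _ = set0) ?Rintegral_set0//.
  rewrite -subset0 => x [] /=; rewrite !in_itv/= andbT => /andP[_ h].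
  by rewrite leNgt h.
have ttf' : t < tf by rewrite lt_neqAle ntt.
have mE (D : set (measurableTypeR R)) : measurable D ->
    measurable_fun D (EFin \o derive1 phi).
  by move=> mD; apply/measurable_EFinP; exact: measurable_funS mp.
rewrite /Rintegral.
have -> : (\int[leb]_(x in Om `&` `[t, +oo[) (derive1 phi x)%:E =
   \int[leb]_(x in `[t, tf]) (derive1 phi x)%:E)%E.
  rewrite -integral_itv_bndo_bndc; last by apply: mE; exact: measurable_itv.
  have [<-|nt0] := eqVneq t0 t.
    rewrite -integral_itv_obnd_cbnd; last by apply: mE; exact: measurable_itv.
    congr integral; apply/seteqP; split => x /=; rewrite !in_itv/= andbT.
      by case.
    by move=> /andP[h1 ->]; rewrite h1/= ltW.
  have t0t' : t0 < t by rewrite lt_neqAle nt0.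
  congr integral; apply/seteqP; split => x /=; rewrite !in_itv/= andbT.
    by case=> /andP[_ ->] ->.
  by move=> /andP[h1 ->]; rewrite h1 (lt_le_trans t0t').
by rewrite integral_derive_itv//= phitf sub0r.
Qed.

Lemma integral_derive0 (phi : R -> R) : C1c t0 tf phi ->
  \int[mu]_x (derive1 phi x) = 0.
Proof.
move=> Cphi; have [_ z] := C1c_C0 Cphi.
have mp : measurable_fun setT (derive1 phi) by exact: C1c_derive_measurable.
have <- : - phi t0 = 0 by rewrite z ?oppr0// in_itv/= ltxx.
rewrite -integral_step_at_derive ?lexx ?(ltW t0tf)//.
rewrite !Rintegral_lebesgue_on//; last first.
  by apply: measurable_funM => //; exact: measurable_step_at.
apply: eq_Rintegral => x; rewrite inE/= in_itv/= => -[_ /andP[h _]].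
by rewrite /step_at (ltW h) mul1r.
Qed.

End test_functions.

(** * Total variation and jump functions *)

Section total_variation.
Context {R : realType} (t0 tf : R).
Hypothesis t0tf : t0 < tf.
Local Notation mu := (lebesgue_on t0 tf).
Local Notation TV := (TV t0 tf).
Local Notation integrable f := (mu.-integrable setT (EFin \o f)).

(** The L1 distance as a real number, for arbitrary functions on the line. *)
Definition L1dist (f g : R -> R) : R := \int[mu]_x `|f x - g x|.

Lemma integrable_sub (f g : R -> R) : integrable f -> integrable g ->
  integrable (fun x => f x - g x).
Proof. by move=> intf intg; exact: (integrableB measurableT intf intg). Qed.

Lemma integrable_add (f g : R -> R) : integrable f -> integrable g ->
  integrable (fun x => f x + g x).
Proof. by move=> intf intg; exact: (integrableD measurableT intf intg). Qed.

Lemma normL1_sub (f g : R -> R) : integrable f -> integrable g ->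
  normL1 t0 tf (fun x => f x - g x) = (L1dist f g)%:E.
Proof. by move=> intf intg; rewrite normL1_integral//; exact: integrable_sub. Qed.

Lemma L1dist_ge0 f g : 0 <= L1dist f g.
Proof. by apply: Rintegral_ge0. Qed.

Lemma L1distC f g : L1dist f g = L1dist g f.
Proof. by apply: eq_Rintegral => x _; rewrite distrC. Qed.

Lemma L1dist_triangle (g f h : R -> R) :
  integrable f -> integrable g -> integrable h ->
  L1dist f h <= L1dist f g + L1dist g h.
Proof.
move=> intf intg inth.
have inn a b : integrable a -> integrable b -> integrable (fun x => `|a x - b x|).
  by move=> ia ib; apply: integrable_norm; exact: integrable_sub.
rewrite /L1dist -RintegralD//; [|exact: inn..].
apply: le_Rintegral => //; first exact: inn.
  by apply: integrable_add; exact: inn.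
by move=> x _; rewrite (le_trans _ (ler_normD _ _))// addrA subrK.
Qed.

Lemma cvgL1P (w : nat -> R -> R) (f : R -> R) :
  (forall n, integrable (w n)) -> integrable f ->
  cvgL1 t0 tf w f <->
  forall e, 0 < e -> exists N, forall n, (N <= n)%N -> L1dist (w n) f < e.
Proof.
move=> intw intf; rewrite /cvgL1.
have -> : (fun n => normL1 t0 tf (w n \- f)) = (fun n => (L1dist (w n) f)%:E).
  by apply/funext => n; rewrite -normL1_sub.
rewrite -[X in _ --> X]/(EFin 0); split.
  move=> /fine_cvgP[_] /= /cvgrPdist_lt h e e0.
  have [N _ hN] := h _ e0; exists N => n /hN /=.
  by rewrite sub0r normrN ger0_norm ?L1dist_ge0.
move=> h; apply: cvg_EFin; first by near=> n.
apply/cvgrPdist_lt => e /h[N hN]; exists N => // n /= /hN.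
by rewrite sub0r normrN ger0_norm ?L1dist_ge0.
Unshelve. all: by end_near. Qed.

Lemma TV_ge (f phi : R -> R) : C1c t0 tf phi -> (forall x, `|phi x| <= 1) ->
  ((\int[mu]_x (f x * derive1 phi x))%:E <= TV f)%E.
Proof. by move=> Cphi phi1; apply: ereal_sup_ubound; exists phi. Qed.

Lemma TV_le (f : R -> R) (K : \bar R) :
  (forall phi, C1c t0 tf phi -> (forall x, `|phi x| <= 1) ->
    ((\int[mu]_x (f x * derive1 phi x))%:E <= K)%E) -> (TV f <= K)%E.
Proof. by move=> h; apply: ge_ereal_sup => _ /= [phi [Cphi phi1] <-]; exact: h. Qed.

Lemma C1c_cst0 : C1c t0 tf (cst 0).
Proof.
split => [x||].
- exact: derivable_cst.
- rewrite (_ : derive1 _ = cst 0); first exact: cst_continuous.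
  by apply/funext => x; rewrite derive1_cst.
- exists ((t0 + tf) / 2), ((t0 + tf) / 2).
  by split=> //; [rewrite midf_lt|rewrite midf_lt].
Qed.

Lemma TV_ge0 f : (0 <= TV f)%E.
Proof.
apply: le_trans (TV_ge f C1c_cst0 _); last by move=> x; rewrite normr0.
rewrite lee_fin; apply: Rintegral_ge0 => x _.
by rewrite derive1_cst mulr0.
Qed.

Lemma TV_ae (f g : R -> R) : measurable_fun setT f -> measurable_fun setT g ->
  {ae mu, forall x, f x = g x} -> TV f = TV g.
Proof.
suff h (f' g' : R -> R) : measurable_fun setT f' -> measurable_fun setT g' ->
    {ae mu, forall x, f' x = g' x} -> (TV f' <= TV g')%E.
  move=> mf mg fg; apply/eqP; rewrite eq_le !h//.
  by apply: filterS fg => x ->.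
move=> mf mg fg; apply: TV_le => phi Cphi phi1.
apply: le_trans (TV_ge g' Cphi phi1); rewrite lee_fin le_eqVlt.
have mp := C1c_derive_measurable Cphi.
rewrite (@ae_eq_Rintegral_on _ _ _ _ (fun x => g' x * derive1 phi x)) ?eqxx//.
- exact: measurable_funM.
- exact: measurable_funM.
- by apply: filterS fg => x ->.
Qed.

(** The functionals whose supremum is the total variation are L1 continuous;
    this is the source of lower semicontinuity. *)
Lemma test_Lipschitz (phi : R -> R) : C1c t0 tf phi ->
  exists2 K, 0 < K & forall f g, integrable f -> integrable g ->
  `|\int[mu]_x (f x * derive1 phi x) - \int[mu]_x (g x * derive1 phi x)|
    <= K * L1dist f g.
Proof.
move=> Cphi; have [K phiK] := C1c_derive_bounded Cphi.
exists (1 + `|K|); first by rewrite ltr_pwDl.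
move=> f g intf intg.
rewrite -RintegralB//; [|exact: integrable_mul_test..].
rewrite (_ : \int[mu]_x _ = \int[mu]_x ((f x - g x) * derive1 phi x)); last first.
  by apply: eq_Rintegral => x _; rewrite mulrBl.
have intfg := integrable_sub intf intg.
have intp := integrable_mul_test intfg Cphi.
apply: le_trans (le_normr_Rintegral _ intp) _ => //.
have intn := integrable_norm intfg.
rewrite /L1dist -RintegralZl//.
apply: le_Rintegral => //; first exact: (integrable_norm intp).
  exact: (integrableZl measurableT _ intn).
move=> x _; rewrite normrM mulrC ler_wpM2r// (le_trans (phiK x))//.
by rewrite (le_trans (ler_norm _))// lerDr.
Qed.

(** One test function almost attains the supremum for [f], and its pairing with
    [w n] converges. *)
Lemma TV_lsc (w : nat -> R -> R) (f : R -> R) (r : R) :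
  (forall n, integrable (w n)) -> integrable f -> cvgL1 t0 tf w f ->
  (r%:E < TV f)%E -> exists N, forall n, (N <= n)%N -> (r%:E < TV (w n))%E.
Proof.
move=> intw intf /cvgL1P -/(_ intw intf) wf.
move=> /ereal_sup_gt[_ /= [phi [Cphi phi1] <-]]; rewrite lte_fin => rlt.
have [K K0 hK] := test_Lipschitz Cphi.
set I := \int[mu]_x (f x * _) in rlt.
have /wf[N hN] : 0 < (I - r) / K by rewrite divr_gt0// subr_gt0.
exists N => n /hN; rewrite ltr_pdivlMr// mulrC => hn.
apply: lt_le_trans (TV_ge (w n) Cphi phi1); rewrite lte_fin.
have := hK _ _ (intw n) intf; rewrite -/I => h.
have := le_lt_trans h hn; rewrite ltr_norml => /andP[h1 _].
by move: h1; rewrite ltrBrDl opprB addrCA subrr addr0.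
Qed.

(** A step function described by its jumps [d i] at [t i].  The [t i] need be
    neither sorted nor distinct, which makes this form stable under moving a
    jump and under limits of the jump positions. *)
Definition jump_function (K : nat) (c : R) (t d : nat -> R) (x : R) : R :=
  c + \sum_(i < K) d i * step_at (t i) x.

Lemma measurable_jump_function K c t d :
  measurable_fun setT (jump_function K c t d).
Proof.
apply: measurable_funD => //; apply: measurable_sum => i.
by apply: measurable_funM => //; exact: measurable_step_at.
Qed.

Lemma jump_function_bounded K c t d : bounded_on_line (jump_function K c t d).
Proof.
exists (`|c| + \sum_(i < K) `|d i|) => x.
rewrite (le_trans (ler_normD _ _))// lerD2l (le_trans (ler_norm_sum _ _ _))//.
apply: ler_sum => i _; rewrite normrM ler_piMr// /step_at.
by case: (t i <= x); rewrite /= ?normr1 ?normr0 ?ler01.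
Qed.

Lemma integrable_jump_function K c t d : integrable (jump_function K c t d).
Proof.
by apply: bounded_integrable; [exact: measurable_jump_function|
  exact: jump_function_bounded].
Qed.

Lemma integral_jump_function_derive (K : nat) (c : R) (t d : nat -> R)
    (phi : R -> R) : (forall i, (i < K)%N -> t0 <= t i <= tf) ->
  C1c t0 tf phi ->
  \int[mu]_x (jump_function K c t d x * derive1 phi x) =
    - \sum_(i < K) d i * phi (t i).
Proof.
move=> tO Cphi; elim: K tO => [|K IH] tO.
  under eq_Rintegral do rewrite /jump_function big_ord0 addr0.
  have intphi : integrable (derive1 phi).
    have mp : measurable_fun setT (derive1 phi) by exact: (C1c_derive_measurable Cphi).
    by apply: bounded_integrable => //; exact: (C1c_derive_bounded Cphi).
  by rewrite big_ord0 oppr0 RintegralZl// (integral_derive0 t0tf)// mulr0.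
have is1 : integrable (fun x => step_at (t K) x * derive1 phi x).
  apply: integrable_mul_test => //; apply: bounded_integrable.
    exact: measurable_step_at.
  exact: step_at_bounded.
have -> : \int[mu]_x (jump_function K.+1 c t d x * derive1 phi x) =
    \int[mu]_x (jump_function K c t d x * derive1 phi x +
      d K * (step_at (t K) x * derive1 phi x)).
  apply: eq_Rintegral => x _.
  by rewrite /jump_function big_ord_recr/= addrA mulrDl mulrA.
rewrite RintegralD//; last 2 first.
- by apply: integrable_mul_test => //; exact: integrable_jump_function.
- exact: (integrableZl measurableT _ is1).
rewrite RintegralZl// integral_step_at_derive//; last exact: tO.
rewrite IH; last by move=> i iK; apply: tO; rewrite ltnS ltnW.
by rewrite big_ord_recr/= opprD mulrN.
Qed.

(** Holds for any positions of the jumps: coinciding jumps can only cancel. *)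
Lemma TV_jump_function_le (K : nat) (c : R) (t d : nat -> R) :
  (forall i, (i < K)%N -> t0 <= t i <= tf) ->
  (TV (jump_function K c t d) <= (\sum_(i < K) `|d i|)%:E)%E.
Proof.
move=> tO; apply: TV_le => phi Cphi phi1; rewrite lee_fin.
rewrite integral_jump_function_derive// (le_trans (ler_norm _))// normrN.
rewrite (le_trans (ler_norm_sum _ _ _))//; apply: ler_sum => i _.
by rewrite normrM ler_piMr.
Qed.

End total_variation.

Section step_functions.
Context {R : realType}.

Lemma indic_itv_step (a b x : R) : a <= b ->
  \1_(`[a, b[%classic) x = step_at a x - step_at b x :> R.
Proof.
move=> ab; rewrite indicE /step_at.
have -> : (x \in (`[a, b[%classic : set R)) = (a <= x < b).
  by apply/idP/idP; rewrite inE/= in_itv.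
have [ax|xa] := leP a x; have [bx|xb] := leP b x; rewrite ?subrr ?subr0//.
by move: (le_lt_trans ab (le_lt_trans bx xa)); rewrite ltxx.
Qed.

(** Abel summation: the indicator of each interval is a difference of two unit
    steps. *)
Lemma step_function_jump (m : nat) (t : nat -> R) (a : nat -> int) (x : R) :
  (0 < m)%N -> (forall i, (i < m)%N -> t i < t i.+1) -> t 0%N < x < t m ->
  step_function m t a x =
  jump_function m.-1 (a 1%N)%:~R (fun i => t i.+1)
    (fun i => (a i.+2)%:~R - (a i.+1)%:~R) x.
Proof.
move=> m0 tm /andP[t0x xm].
have first_itv : \1_(`]t 0%N, t 1%N[%classic) x = 1 - step_at (t 1%N) x :> R.
  rewrite indicE /step_at.
  have -> : (x \in (`]t 0%N, t 1%N[%classic : set R)) = (x < t 1%N).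
    by apply/idP/idP; rewrite inE/= in_itv/= t0x.
  by case: ltP; rewrite /= ?subr0 ?subrr.
suff h k : (0 < k <= m)%N -> step_function k t a x =
    jump_function k.-1 (a 1%N)%:~R (fun i => t i.+1)
    (fun i => (a i.+2)%:~R - (a i.+1)%:~R) x - (a k)%:~R * step_at (t k) x.
  rewrite h ?m0 ?leqnn// [X in _ * X](_ : _ = 0) ?mulr0 ?subr0//.
  by rewrite /step_at leNgt xm.
elim: k => // -[_ _|k IH kn].
  rewrite /step_function /jump_function big_geq// big_ord0 first_itv.
  by rewrite !addr0 mulrBl mul1r mulrC.
have {}IH := IH (ltnW kn).
rewrite /step_function big_nat_recr//= addrA -/(step_function k.+1 t a x) IH.
rewrite indic_itv_step; last by rewrite ltW// tm.
rewrite /jump_function big_ord_recr/=; ring.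
Qed.

End step_functions.

(** * A smooth step *)

Section smooth_step.
Context {R : realType}.

Definition ramp (u : R) : R := Num.max 0 u.

(** An expansion with quadratic error that is valid across the kink of the ramp,
    so that differentiating the squared ramp needs no case distinction. *)
Lemma ramp_square_expansion (u h : R) :
  `|ramp (h + u) ^+ 2 - ramp u ^+ 2 - 2 * ramp u * h| <= h ^+ 2.
Proof.
rewrite /ramp ler_norml.
have [uh|uh] := leP 0 (h + u); have [u0|u0] := leP 0 u; nra.
Qed.

Lemma is_derive_ramp_square (u : R) :
  is_derive u 1 (fun v => ramp v ^+ 2) (2 * ramp u).
Proof.
have cvgq : h^-1 *: (ramp (h *: (1 : R) + u) ^+ 2 - ramp u ^+ 2) @[h --> 0^'] -->
    2 * ramp u.
  apply/cvgrPdist_le => e e0; near=> h.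
  have h0 : h != 0 by near: h; exact: nbhs_dnbhs_neq.
  rewrite /GRing.scale/= mulr1 distrC.
  rewrite -[X in _ - X](mulKf h0) -mulrBr (mulrC h) normrM normfV.
  rewrite ler_pdivrMl ?normr_gt0//.
  rewrite (le_trans (ramp_square_expansion _ _))// -real_normK ?num_real// expr2.
  by rewrite ler_wpM2l//; near: h; exact: dnbhs0_le.
by apply: DeriveDef; [apply/cvg_ex; exists (2 * ramp u)|exact/cvg_lim].
Unshelve. all: by end_near. Qed.

(** The tent of height 2 on the unit interval.  Written as a second difference of
    ramps, it has the second difference of squared ramps as a primitive. *)
Definition kernel (u : R) : R := 4 * (ramp u - 2 * ramp (u - 2^-1) + ramp (u - 1)).

Definition smooth_step (u : R) : R :=
  2 * (ramp u ^+ 2 - 2 * ramp (u - 2^-1) ^+ 2 + ramp (u - 1) ^+ 2).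

Lemma is_derive_smooth_step (x e u : R) :
  is_derive u 1 (fun v => smooth_step ((v - x) / e)) (kernel ((u - x) / e) / e).
Proof.
have aff (c : R) : is_derive u 1 (fun v => (v - x) / e - c) e^-1.
  rewrite (_ : (fun v => _) = (e^-1 \*: (id - cst x) - cst c)); last first.
    by apply/funext => v /=; rewrite /GRing.scale/= mulrC.
  by apply: is_derive_eq; rewrite /GRing.scale/=; ring.
have sq c : is_derive u 1 (fun v => ramp ((v - x) / e - c) ^+ 2)
    (2 * ramp ((u - x) / e - c) * e^-1).
  exact: (is_derive1_comp (is_derive_ramp_square _) (aff c)).
have d := is_deriveZ 2 (is_deriveD
  (is_deriveB (sq 0) (is_deriveZ 2 (sq 2^-1))) (sq 1)).
rewrite (_ : (fun v => _) = 2 \*: ((fun v : R => ramp ((v - x) / e - 0) ^+ 2)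
   - (2 : R) \*: (fun v : R => ramp ((v - x) / e - 2^-1) ^+ 2)
   + (fun v : R => ramp ((v - x) / e - 1) ^+ 2))); last first.
  by apply/funext => v; rewrite /smooth_step -{1}[(v - x) / e]subr0.
apply: (is_derive_eq d); rewrite /GRing.scale/= /kernel subr0; ring.
Qed.

Lemma kernel_continuous : continuous kernel.
Proof.
have rc (c : R) : continuous (fun u : R => ramp (u - c)).
  move=> u; apply: (@continuous_max _ _ (cst 0) (fun u : R => u - c)).
    exact: cst_continuous.
  by apply: cvgB; [exact: cvg_id|exact: cvg_cst].
move=> u; apply: cvgMr; apply: cvgD; last exact: rc.
apply: cvgB; last by apply: cvgMr; exact: rc.
by have := rc 0 u; rewrite /continuous_at; under eq_fun do rewrite subr0; rewrite subr0.
Qed.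

Lemma kernel_bounds u : 0 <= kernel u <= 2.
Proof.
rewrite /kernel /ramp; have [h1|h1] := leP 0 u;
 have [h2|h2] := leP 0 (u - 2^-1); have [h3|h3] := leP 0 (u - 1); lra.
Qed.

Lemma kernel_out u : (u <= 0) || (1 <= u) -> kernel u = 0.
Proof.
rewrite /kernel /ramp => /orP[]h; have [h1|h1] := leP 0 u;
 have [h2|h2] := leP 0 (u - 2^-1); have [h3|h3] := leP 0 (u - 1); lra.
Qed.

Lemma smooth_step0 u : u <= 0 -> smooth_step u = 0.
Proof.
rewrite /smooth_step /ramp => h; rewrite !max_l; first by ring.
all: lra.
Qed.

Lemma smooth_step1 u : 1 <= u -> smooth_step u = 1.
Proof.
rewrite /smooth_step /ramp => h; rewrite !max_r; first by field.
all: lra.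
Qed.

Lemma smooth_step_nondecreasing (x e : R) : 0 < e ->
  {homo (fun v => smooth_step ((v - x) / e)) : u v / u <= v}.
Proof.
move=> e0 u v uv.
have d := is_derive_smooth_step x e.
have cS : {within `[u, v], continuous (fun v => smooth_step ((v - x) / e))}.
  by apply: derivable_within_continuous => y _; apply: ex_derive; exact: d.
have [c _] := MVT_segment uv (fun y _ => d y) cS.
move=> /eqP; rewrite subr_eq => /eqP ->; rewrite lerDr mulr_ge0 ?subr_ge0//.
by rewrite divr_ge0 ?(ltW e0)//; have /andP[] := kernel_bounds ((c - x) / e).
Qed.

Lemma smooth_step_itv (x e u : R) : 0 < e ->
  0 <= smooth_step ((u - x) / e) <= 1.
Proof.
move=> e0; apply/andP; split.
  have [ux|/ltW xu] := leP u x.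
    by rewrite smooth_step0// pmulr_lle0 ?invr_gt0// subr_le0.
  have := smooth_step_nondecreasing x e0 xu.
  by rewrite subrr mul0r smooth_step0.
have [ux|/ltW xu] := leP (x + e) u.
  by rewrite (smooth_step1 (u := (u - x) / e))// ler_pdivlMr// mul1r lerBrDl.
have := smooth_step_nondecreasing x e0 xu.
by rewrite addrAC subrr add0r divff ?gt_eqF// (smooth_step1 (lexx 1)).
Qed.

End smooth_step.

(** * Variation along a chain of points *)

Lemma cvg_sum_ord {R : realType} {T : Type} (F : set_system T) {FF : Filter F}
    (k : nat) (f : 'I_k -> T -> R) (l : 'I_k -> R) :
  (forall i, f i x @[x --> F] --> l i) ->
  \sum_(i < k) f i x @[x --> F] --> \sum_(i < k) l i.
Proof.
move=> fl.
rewrite (_ : (fun x => \sum_(i < k) f i x) = \sum_(i < k) f i); last first.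
  by apply/funext => x; rewrite fct_sumE.
elim/big_ind2: _ => [|f1 l1 f2 l2 h1 h2|i _]; last exact: fl.
  exact: cvg_cst.
exact: cvgD h1 h2.
Qed.

Section chain_variation.
Context {R : realType} (t0 tf : R).
Hypothesis t0tf : t0 < tf.
Local Notation mu := (lebesgue_on t0 tf).
Local Notation leb := (@lebesgue_measure R).
Local Notation TV := (TV t0 tf).
Local Notation integrable f := (mu.-integrable setT (EFin \o f)).

(** The tent rescaled to [[x, x + e]], with integral 1. *)
Definition hat (x e u : R) : R := kernel ((u - x) / e) / e.

(** [y] is the limit of averages of [f] immediately to the right of [x]. *)
Definition right_value (f : R -> R) (x y : R) : Prop :=
  \int[mu]_u (f u * hat x e u) @[e --> 0^'+] --> y.

Lemma hat_continuous x e : continuous (hat x e).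
Proof.
move=> u; apply: cvgMl; apply: (@continuous_comp _ _ _ (fun u => (u - x) / e)).
  by apply: cvgMl; apply: cvgB; [exact: cvg_id|exact: cvg_cst].
exact: kernel_continuous.
Qed.

Lemma hat_bounds x e u : 0 < e -> 0 <= hat x e u <= 2 / e.
Proof.
move=> e0; have /andP[k0 k2] := kernel_bounds ((u - x) / e).
by rewrite /hat divr_ge0 ?(ltW e0)//= ler_pM2r// invr_gt0.
Qed.

Lemma hat_out x e u : 0 < e -> (u <= x) || (x + e <= u) -> hat x e u = 0.
Proof.
move=> e0 h; rewrite /hat kernel_out ?mul0r//.
by rewrite pmulr_lle0 ?invr_gt0// subr_le0 ler_pdivlMr// mul1r lerBrDl.
Qed.

Lemma hat_bounded x e : 0 < e -> bounded_on_line (hat x e).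
Proof.
move=> e0; exists (2 / e) => u; have /andP[h0 h2] := hat_bounds x u e0.
by rewrite ger0_norm.
Qed.

Lemma integrable_mul_hat (f : R -> R) x e : 0 < e -> integrable f ->
  integrable (fun u => f u * hat x e u).
Proof.
move=> e0 intf; apply: integrable_mul_bounded => //.
  exact: continuous_measurable_fun (@hat_continuous x e).
exact: hat_bounded.
Qed.

(** Up to transitions of width [e], the i-th summand is [s i] between [x i] and
    [x i.+1] and zero elsewhere; pairing [f] with its derivative
    compares averages of [f] at these two points. *)
Definition chain_test (k : nat) (s x : nat -> R) (e u : R) : R :=
  \sum_(i < k) s i *
    (smooth_step ((u - x i) / e) - smooth_step ((u - x i.+1) / e)).

Lemma is_derive_chain_test k s x e (u : R) :
  is_derive u 1 (chain_test k s x e)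
    (\sum_(i < k) s i * (hat (x i) e u - hat (x i.+1) e u)).
Proof.
rewrite (_ : chain_test k s x e = \sum_(i < k) s i \*:
    ((fun v => smooth_step ((v - x i) / e)) -
     (fun v => smooth_step ((v - x i.+1) / e)))); last first.
  by apply/funext => v; rewrite /chain_test fct_sumE.
apply: is_derive_sum => i; apply: is_deriveZ; apply: is_deriveB;
  exact: is_derive_smooth_step.
Qed.

Lemma chain_test_derive k s x e :
  derive1 (chain_test k s x e) =
  (fun u => \sum_(i < k) s i * (hat (x i) e u - hat (x i.+1) e u)).
Proof.
apply/funext => u; rewrite derive1E.
by apply: derive_val; exact: is_derive_chain_test.
Qed.

Lemma chain_le (x : nat -> R) k : (forall i, (i < k)%N -> x i < x i.+1) ->
  forall i j, (i <= j <= k)%N -> x i <= x j.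
Proof.
move=> xS i j /andP[ij jk]; elim: j ij jk => [|j IH].
  by rewrite leqn0 => /eqP ->.
rewrite leq_eqVlt ltnS => /predU1P[->//|ij jk].
by rewrite (le_trans (IH ij (ltnW jk)))// ltW// xS.
Qed.

Lemma chain_test_C1c k s x (e : R) : 0 < e -> (forall i, (i < k)%N -> x i < x i.+1) ->
  t0 < x 0%N -> x k + e < tf -> C1c t0 tf (chain_test k s x e).
Proof.
move=> e0 xS t0x xtf; split.
- by move=> u; apply: ex_derive; exact: is_derive_chain_test.
- rewrite chain_test_derive => u; apply: cvg_sum_ord => i; apply: cvgMr.
  by apply: cvgB; exact: hat_continuous.
- exists (x 0%N), (x k + e); split => // u.
  rewrite in_itv/= negb_and -!ltNge => h; apply: big1 => i _.
  have x0i : x 0%N <= x i by apply: (chain_le xS); rewrite leq0n/= ltnW.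
  have xiS := xS i (ltn_ord i).
  have xSk : x i.+1 <= x k by apply: (chain_le xS); rewrite leqnn ltn_ord.
  case/orP: h => h.
    rewrite !(@smooth_step0 _ (_ / _)) ?subrr ?mulr0// pmulr_lle0 ?invr_gt0//; lra.
  rewrite !(@smooth_step1 _ (_ / _)) ?subrr ?mulr0// ler_pdivlMr//; lra.
Qed.

(** The smooth step at [x i.+1] lies below the one at [x i], so the absolute
    values telescope to a difference of two smooth steps, even where the
    transitions overlap. *)
Lemma chain_test_le1 k s x (e u : R) : 0 < e ->
  (forall i, (i < k)%N -> x i < x i.+1) -> (forall i, `|s i| <= 1) ->
  `|chain_test k s x e u| <= 1.
Proof.
move=> e0 xS s1; rewrite (le_trans (ler_norm_sum _ _ _))//.
pose S i := smooth_step ((u - x i) / e).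
have SS i : (i < k)%N -> S i.+1 <= S i.
  move=> ik; rewrite /S.
  have -> : (u - x i) / e = ((u + (x i.+1 - x i)) - x i.+1) / e.
    by congr (_ / _); ring.
  by apply: smooth_step_nondecreasing => //; rewrite lerDl subr_ge0 ltW// xS.
apply: (@le_trans _ _ (\sum_(i < k) (S i - S i.+1))).
  apply: ler_sum => i _; rewrite normrM.
  have h : 0 <= S i - S i.+1 by rewrite subr_ge0 SS.
  by rewrite -/(S i) -/(S i.+1) (ger0_norm h) ler_piMl.
have -> : \sum_(i < k) (S i - S i.+1) = S 0%N - S k.
  elim: (k) => [|n IH]; first by rewrite big_ord0 subrr.
  by rewrite big_ord_recr/= IH addrA subrK.
have /andP[S0 _] := smooth_step_itv (x k) u e0.
have /andP[_ S1] := smooth_step_itv (x 0%N) u e0.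
by rewrite lerBlDr (le_trans S1)// lerDl.
Qed.

(** Test with [chain_test], the signs being opposite to those of the increments.
    As the width tends to zero the pairing tends to the sum of the absolute
    increments. *)
Lemma chain_variation_le (f : R -> R) (k : nat) (x y : nat -> R) :
  integrable f -> (forall i, (i < k)%N -> x i < x i.+1) ->
  t0 < x 0%N -> x k < tf ->
  (forall i, (i <= k)%N -> right_value f (x i) (y i)) ->
  ((\sum_(i < k) `|y i.+1 - y i|)%:E <= TV f)%E.
Proof.
move=> intf xS t0x xtf fxy.
pose s i := - Num.sg (y i.+1 - y i).
have s1 i : `|s i| <= 1.
  by rewrite /s normrN normr_sg lern1; case: (_ != _).
pose V e := \sum_(i < k) s i *
  (\int[mu]_u (f u * hat (x i) e u) - \int[mu]_u (f u * hat (x i.+1) e u)).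
have VTV e : 0 < e -> x k + e < tf -> ((V e)%:E <= TV f)%E.
  move=> e0 xe; have Cp := chain_test_C1c s e0 xS t0x xe.
  have := TV_ge f Cp (fun u => chain_test_le1 u e0 xS s1).
  rewrite chain_test_derive; congr (_%:E <= _)%E.
  rewrite /V; elim: (k) => [|n IH].
    rewrite big_ord0 -[RHS](mul0r (fine (mu setT))) -Rintegral_cst_on.
    by apply: eq_Rintegral => u _; rewrite big_ord0 mulr0.
  rewrite big_ord_recr/= -IH.
  have int_i i : integrable (fun u => s i * (f u * hat (x i) e u - f u * hat (x i.+1) e u)).
    have intB : integrable (fun u => f u * hat (x i) e u - f u * hat (x i.+1) e u).
      by apply: integrable_sub; exact: integrable_mul_hat.
    exact: (integrableZl measurableT _ intB).
  rewrite -RintegralB; [|exact: measurableT|exact: integrable_mul_hat..].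
  rewrite -RintegralZl; [|exact: measurableT|]; last first.
    by apply: integrable_sub; exact: integrable_mul_hat.
  rewrite -RintegralD; [|exact: measurableT| |exact: int_i]; last first.
    elim: (n) => [|p IHp].
      rewrite (_ : _ \o _ = EFin \o (cst 0 : R -> R)); first exact: integrable0.
      by apply/funext => u /=; rewrite big_ord0 mulr0.
    rewrite (_ : _ \o _ = EFin \o (fun u => f u * (\sum_(i < p) s i *
       (hat (x i) e u - hat (x i.+1) e u)) +
       s p * (f u * hat (x p) e u - f u * hat (x p.+1) e u))); last first.
      by apply/funext => u /=; rewrite big_ord_recr/=; congr EFin; ring.
    by apply: integrable_add => //; exact: int_i.
  by apply: eq_Rintegral => u _; rewrite big_ord_recr/=; ring.
have Vcvg : V e @[e --> 0^'+] --> \sum_(i < k) `|y i.+1 - y i|.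
  have -> : \sum_(i < k) `|y i.+1 - y i| = \sum_(i < k) s i * (y i - y i.+1).
    apply: eq_bigr => i _; rewrite /s mulNr -mulrN opprB.
    by rewrite normrEsg.
  apply: cvg_sum_ord => i; apply: cvgMr; apply: cvgB.
    by apply: fxy; rewrite ltnW.
  exact: fxy.
case ETV : (TV f) VTV => [T| |] VTV; last 2 first.
- by rewrite leey.
- by move: (TV_ge0 t0tf f); rewrite ETV.
rewrite lee_fin -(cvg_lim (@Rhausdorff R) Vcvg).
apply: limr_le; first by apply/cvg_ex; eexists; exact: Vcvg.
near=> e; rewrite -lee_fin; apply: VTV.
  by near: e; exact: nbhs_right_gt.
by rewrite -ltrBrDl; near: e; apply: nbhs_right_lt; rewrite subr_gt0.
Unshelve. all: by end_near. Qed.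

End chain_variation.

(** * Lebesgue points *)

Section lebesgue_points.
Context {R : realType} (t0 tf : R).
Hypothesis t0tf : t0 < tf.
Local Notation mu := (lebesgue_on t0 tf).
Local Notation leb := (@lebesgue_measure R).
Local Notation Om := [set` `]t0, tf[].
Local Notation integrable f := (mu.-integrable setT (EFin \o f)).

Lemma ae_lebesgue_on (P : R -> Prop) :
  {ae leb, forall x, t0 < x < tf -> P x} -> {ae mu, forall x, P x}.
Proof.
move=> [N [mN N0 PN]].
have mO : measurable (Om : set (measurableTypeR R)) by exact: measurable_itv.
exists (N `|` ~` Om); split.
- by apply: measurableU => //; exact: measurableC.
- apply/eqP; rewrite -measure_le0/= /mrestr setIUl setICl setU0.
  by rewrite -N0; apply: le_measure; rewrite ?inE//; exact: measurableI.
- move=> x /= nP; have [xO|xO] := boolP (x \in `]t0, tf[); last first.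
    by right; apply/negP.
  by left; apply: PN => /= h; apply: nP; apply: h; move: xO; rewrite in_itv.
Qed.

(** A Lebesgue point in the strong sense.  The mean of [`|f u - f x|], and not
    just that of [f u - f x], has to be small, because the one-sided statement
    of [lebesgue_value_near] fails for mere averages: at a jump from 0 to 2 the
    averages converge to 1. *)
Definition lebesgue_value (f : R -> R) (x : R) : Prop :=
  forall e : R, 0 < e -> exists2 d : R, 0 < d & forall r : R, 0 < r < d ->
    (\int[mu]_(u in ball x r) `|f u - f x|%:E <= (e * r)%:E)%E.

(** Lebesgue's differentiation theorem for the extension of [f] by zero. *)
Lemma ae_lebesgue_value (f : R -> R) : integrable f ->
  {ae mu, forall x, lebesgue_value f x}.
Proof.
move=> intf; have mf := integrable_measurable intf.
have mO : measurable (Om : set (measurableTypeR R)) by exact: measurable_itv.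
have intO : leb.-integrable Om (EFin \o f).
  apply/integrableP; split.
    by apply/measurable_EFinP; exact: measurable_funS mf.
  case/integrableP : intf => m; rewrite integral_lebesgue_on ?setTI//.
  exact: measurableT_comp.
have := lebesgue_differentiation (integrable_locally mO intO).
have FF : Filter (almost_everywhere leb) by exact: ae_filter_ringOfSetsType.
move=> lpt; apply: ae_lebesgue_on; apply: filterS lpt => x lpt xO e e0.
have : \forall r \near (0 : R)^'+, (davg (f \_ Om) x r <= (e / 2)%:E)%E.
  move/fine_cvgP : lpt => [fin /cvgrPdist_le lpt].
  have e2 : 0 < e / 2 by rewrite divr_gt0.
  near=> r; rewrite -[X in (X <= _)%E]fineK; last by near: r; exact: fin.
  rewrite lee_fin (le_trans (ler_norm _))//.
  by rewrite -normrN -sub0r; near: r; exact: lpt.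
move=> [d /= d0 hd]; exists d => // r /andP[r0 rd].
have {hd} := hd r; rewrite /ball_/= sub0r normrN gtr0_norm//.
move=> /(_ rd r0); rewrite /davg /iavg (lebesgue_measure_ball _ (ltW r0)).
rewrite inver mulrn_eq0/= gt_eqF// lee_pdivrMl; last by rewrite mulrn_wgt0.
rewrite -EFinM; have -> : (r *+ 2) * (e / 2) = e * r by rewrite mulr2n; field.
apply: le_trans; rewrite integral_lebesgue_on; last 2 first.
- exact: measurable_ball.
- apply/measurable_EFinP; apply: measurableT_comp => //.
  by apply: measurable_funB => //; exact: measurable_funS mf.
rewrite integral_mkcondr; apply: ge0_le_integral.
- exact: measurable_ball.
- by move=> u _; rewrite patchE; case: ifP.
- apply/(measurable_restrict _ mO (measurable_ball _ _)).
  apply/measurable_EFinP; apply: measurableT_comp => //.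
  by apply: measurable_funB => //; apply: measurable_funS mf.
- apply/measurable_EFinP; apply: measurableT_comp => //=.
  apply: measurable_funB => //; apply/measurable_funTS.
  by apply/(measurable_restrictT _ mO); apply: measurable_funS mf.
- have xO' : x \in (Om : set R) by rewrite inE/= in_itv.
  move=> u _; rewrite patchE; case: ifPn => uO; last by rewrite lee_fin normr_ge0.
  by rewrite /= !patchE uO xO'.
Unshelve. all: by end_near. Qed.

Lemma integral_hat (x e : R) : 0 < e -> t0 <= x -> x + e <= tf ->
  \int[mu]_u hat x e u = 1.
Proof.
move=> e0 t0x xtf.
have mh : measurable_fun setT (hat x e).
  exact: continuous_measurable_fun (@hat_continuous _ x e).
rewrite Rintegral_lebesgue_on// setTI /Rintegral.
rewrite integral_itv_obnd_cbnd; last first.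
  by apply/measurable_EFinP; exact: measurable_funS mh.
rewrite integral_itv_bndo_bndc; last first.
  by apply/measurable_EFinP; exact: measurable_funS mh.
have dS := is_derive_smooth_step x e.
have cS : continuous (fun u => smooth_step ((u - x) / e)).
  move=> u; apply: differentiable_continuous; apply/derivable1_diffP.
  by apply: ex_derive; exact: dS.
rewrite (@continuous_FTC2 _ (hat x e) (fun u => smooth_step ((u - x) / e)))//=.
- rewrite smooth_step1 ?smooth_step0 ?subr0//.
    by rewrite pmulr_lle0 ?invr_gt0// subr_le0.
  by rewrite ler_pdivlMr// mul1r lerBrDl.
- by apply: continuous_subspaceT; exact: hat_continuous.
- split; first by move=> u _; apply: ex_derive; exact: dS.
  + by apply: cvg_at_right_filter; exact: cS.
  + by apply: cvg_at_left_filter; exact: cS.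
- move=> u _; rewrite derive1E; apply: derive_val; exact: dS.
Qed.

(** The tent is at most [2 / r] and lives on half of the ball of radius [r], so
    the error is controlled by the mean oscillation at [x]. *)
Lemma lebesgue_value_right_value (f : R -> R) (x : R) : integrable f ->
  t0 < x < tf -> lebesgue_value f x -> right_value t0 tf f x (f x).
Proof.
move=> intf /andP[t0x xtf] fx; apply/cvgrPdist_le => e e0.
have e2 : 0 < e / 2 by rewrite divr_gt0.
have [d d0 hd] := fx _ e2; near=> r.
have r0 : 0 < r by near: r; exact: nbhs_right_gt.
have rd : r < d by near: r; exact: nbhs_right_lt.
have xr : x + r <= tf.
  by rewrite -lerBrDl; near: r; apply: nbhs_right_le; rewrite subr_gt0.
have mf := integrable_measurable intf.
have inth : integrable (hat x r).
  apply: bounded_integrable; last exact: hat_bounded.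
  exact: continuous_measurable_fun (@hat_continuous _ x r).
have intc : integrable (fun u => f u - f x).
  apply: integrable_sub => //; apply: bounded_integrable => //.
  by exists `|f x|.
have -> : f x = \int[mu]_u (f x * hat x r u).
  by rewrite RintegralZl// integral_hat ?mulr1// ltW.
rewrite distrC -RintegralB//; last 2 first.
- exact: integrable_mul_hat.
- exact: (integrableZl measurableT _ inth).
have intch := integrable_mul_hat x r0 intc.
rewrite (_ : \int[mu]_u _ = \int[mu]_u ((f u - f x) * hat x r u)); last first.
  by apply: eq_Rintegral => u _; rewrite mulrBl.
apply: le_trans (le_normr_Rintegral _ intch) _ => //.
have mB : measurable (ball x r : set (measurableTypeR R)).
  exact: measurable_ball.
have intB : mu.-integrable (ball x r) (EFin \o (fun u => `|f u - f x|)).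
  by apply: integrableS (integrable_norm intc).
apply: (@le_trans _ _ (2 / r * \int[mu]_(u in ball x r) `|f u - f x|)).
  rewrite -RintegralZl// [leRHS]Rintegral_mkcond; apply: le_Rintegral => //.
  - exact: integrable_norm intch.
  - have := integrableZl mB (2 / r) intB.
    by move=> /(integrable_mkcond _ mB) /=; rewrite -restrict_EFin.
  - move=> u _; rewrite patchE normrM.
    have /andP[h0 h2] := hat_bounds x u r0; rewrite (ger0_norm h0).
    case: ifPn => [_|uB]; first by rewrite mulrC ler_wpM2r.
    rewrite hat_out ?mulr0//; apply: contraR uB.
    rewrite negb_or -!ltNge => /andP[xu ur]; rewrite inE /ball/= ltr_norml.
    by apply/andP; split; lra.
have := hd r; rewrite r0 rd => /(_ isT).
rewrite -[X in (X <= _)%E]fineK ?lee_fin; last exact: integrable_fin_num intB.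
rewrite -/(Rintegral mu (ball x r) (fun u => `|f u - f x|)) => hI.
rewrite mulrC mulrA ler_pdivrMr// (le_trans (ler_wpM2r _ hI))//.
by rewrite -mulrA mulrACA -[in X in _ <= X](mulr1 e); lra.
Unshelve. all: by end_near. Qed.

(** If the value [f x] were not taken on one side of [x], then [`|f u - f x|]
    would be at least 1 on half of each small ball around [x], and its mean at
    least one half. *)
Lemma lebesgue_value_near (f : R -> R) (G : set R) (x d : R) (left : bool) :
  measurable_fun setT f -> t0 < x < tf -> lebesgue_value f x ->
  {ae mu, forall y, t0 < y < tf -> G y} ->
  (forall y, G y -> f y != f x -> 1 <= `|f y - f x|) -> 0 < d ->
  exists y, [/\ G y, (if left then x - d < y < x else x < y < x + d) & f y = f x].
Proof.
move=> mf /andP[t0x xtf] fx aeG far d0; apply: contrapT => none.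
have [e e0 he] : exists2 e, 0 < e & t0 <= x - e /\ x + e <= tf /\ e <= d.
  exists (Num.min d (Num.min (x - t0) (tf - x))).
    by rewrite !lt_min d0 !subr_gt0 t0x.
  set a := Num.min _ _.
  have : (a <= d) && ((a <= x - t0) && (a <= tf - x)).
    by rewrite -!le_min lexx.
  by move=> /and3P[]; lra.
have [d' d'0 hd'] := fx (1/2) ltac:(lra).
(* halved, to make the inequalities [r < e] and [r < d'] strict *)
pose r := Num.min e d' / 2.
have [r0 re rd] : [/\ 0 < r, r < e & r < d'].
  have m0 : 0 < Num.min e d' by rewrite lt_min e0.
  have : (Num.min e d' <= e) && (Num.min e d' <= d') by rewrite -le_min.
  by rewrite /r => /andP[]; split; lra.
have := hd' r; rewrite r0 rd => /(_ isT); apply/negP; rewrite -ltNge.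
pose I : set R := [set` if left then `]x - r, x[ else `]x, x + r[].
have mI : measurable (I : set (measurableTypeR R)).
  by rewrite /I; case: (left); exact: measurable_itv.
have IO : I `<=` Om.
  by rewrite /I => y; case: (left); rewrite /= !in_itv/= => /andP[]; lra.
have IB : I `<=` ball x r.
  move=> y; rewrite /I /ball/= ltr_norml.
  by case: (left); rewrite /= !in_itv/= => /andP[]; lra.
have mn : measurable_fun setT (fun u => `|(f u - f x)%:E|%E).
  by apply: measurableT_comp => //; apply/measurable_EFinP; exact: measurable_funB.
apply: (@lt_le_trans _ _ (\int[mu]_(u in I) `|(f u - f x)%:E|)%E); last first.
  apply: ge0_subset_integral => //; first exact: measurable_ball.
  exact: measurable_funS mn.
apply: (@lt_le_trans _ _ (\int[mu]_(u in I) 1)%E).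
  rewrite integral_cst// mul1e /lebesgue_on/= /mrestr setIidl//.
  rewrite /I; case: (left); rewrite lebesgue_measure_itv/= lte_fin.
    by rewrite ltrBlDr ltrDl r0 -EFinB lte_fin; lra.
  by rewrite ltrDl r0 -EFinB lte_fin; lra.
apply: ae_ge0_le_integral => //; first exact: measurable_funS mn.
apply: filterS aeG => y Gy Iy; have := IO _ Iy; rewrite /= in_itv/= => yO.
rewrite lee_fin; apply: far; first exact: Gy.
apply/eqP => fyx; apply: none; exists y; split => //; first exact: Gy.
by move: Iy; rewrite /I; case: (left); rewrite /= in_itv/= => /andP[]; lra.
Qed.

End lebesgue_points.

(** * Longest alternating chains *)

Section alternating_chains.
Context {R : realType}.
Variables (t0 tf : R) (f : R -> R) (G : set R) (N : nat).
Hypothesis G_itv : forall y, G y -> t0 < y < tf.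
Hypothesis G_neq0 : exists y, G y.
Hypothesis G_left : forall x d, G x -> 0 < d ->
  exists y, [/\ G y, x - d < y < x & f y = f x].
Hypothesis G_right : forall x d, G x -> 0 < d ->
  exists y, [/\ G y, x < y < x + d & f y = f x].

Let r (u v : R) := (u < v) && (f v != f u).
Let chain (s : seq R) := sorted r s /\ (forall y, y \in s -> G y).
Hypothesis chain_size : forall s, chain s -> (size s <= N)%N.

Let longest_chain : exists s, [/\ chain s, (0 < size s)%N &
  forall s', chain s' -> (size s' <= size s)%N].
Proof.
have [y Gy] := G_neq0.
pose P n := `[< exists2 s, chain s & size s = n >].
have P1 : exists n, P n.
  exists 1%N; apply/asboolP; exists [:: y] => //; split => // z.
  by rewrite inE => /eqP ->.
have PN n : P n -> (n <= N)%N by move=> /asboolP[s /chain_size ? <-].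
case: (ex_maxnP P1 PN) => n /asboolP[s sc <-] smax.
have smax' s' : chain s' -> (size s' <= size s)%N.
  by move=> s'c; apply: smax; apply/asboolP; exists s'.
exists s; split => //; apply: leq_trans (smax' [:: y] _) => //.
by split => // z; rewrite inE => /eqP ->.
Qed.

Let s : seq R := projT1 (cid longest_chain).

Let s_chain : chain s. Proof. by rewrite /s; case: cid => ? []. Qed.
Let s_gt0 : (0 < size s)%N. Proof. by rewrite /s; case: cid => ? []. Qed.
Let s_max s' : chain s' -> (size s' <= size s)%N.
Proof. by rewrite /s; case: cid => ? /= [_ _]; exact. Qed.

Let x i := nth 0 s i.

Let xG i : (i < size s)%N -> G (x i).
Proof. by move=> si; case: s_chain => _; apply; exact: mem_nth. Qed.

Let xr i : (i.+1 < size s)%N -> r (x i) (x i.+1).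
Proof. by case: s_chain => /(sortedP 0) h _; exact: h. Qed.

Let no_insertion i l : (i.+1 < size s)%N -> (forall y, y \in l -> G y) ->
  path r (x i) (rcons l (x i.+1)) -> l = [::].
Proof.
move=> si lG lp; have si' := ltnW si.
(* the two consecutive entries of the chain between which [l] is inserted *)
have Es : s = rcons (take i s) (x i) ++ x i.+1 :: drop i.+2 s.
  by rewrite -take_nth// -drop_nth// cat_take_drop.
suff /s_max : chain (rcons (take i s) (x i) ++ l ++ x i.+1 :: drop i.+2 s).
  have := congr1 size Es; rewrite !size_cat => sE sl.
  apply: size0nil; move: sE sl => /=.
  move: (size s) (size (rcons _ _)) (size (drop _ _)) (size l) => a b c e -> h.
  lia.
split.
  have sc : sorted r (rcons (take i s) (x i) ++ x i.+1 :: drop i.+2 s).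
    by rewrite -Es; case: s_chain.
  move: sc lp; case: (take i s) => [|c a] /=.
    by rewrite rcons_path cat_path /= => /andP[_ ->] /andP[-> ->].
  rewrite !cat_path/= !last_rcons => /and3P[-> _ ->].
  by rewrite rcons_path => /andP[-> ->].
move=> y; rewrite mem_cat mem_cat => /or3P[ys|/lG//|ys];
  case: s_chain => _; apply; rewrite Es mem_cat ?ys ?orbT//.
Qed.

Let no_cons y : G y -> y < x 0%N -> f y = f (x 0%N).
Proof.
move=> Gy yx; apply/eqP; apply/negPn/negP => fy.
have /s_max : chain (y :: s); last by rewrite /= ltnn.
case: s_chain s_gt0 @x => sc sG s0 x' in yx fy *; split.
  move: sc s0 yx fy; rewrite /x'; case: (s) => //= c a -> _ yx fy.
  by rewrite /r yx eq_sym fy.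
by move=> z; rewrite inE => /predU1P[->//|]; exact: sG.
Qed.

Let no_rcons y : G y -> x (size s).-1 < y -> f y = f (x (size s).-1).
Proof.
move=> Gy yx; apply/eqP; apply/negPn/negP => fy.
have /s_max : chain (rcons s y); last by rewrite size_rcons ltnn.
case: s_chain s_gt0 => sc sG s0; split.
  move: sc s0 yx fy; rewrite /x nth_last; case: (s) => //= c a sc _ yx fy.
  by rewrite rcons_path sc /r yx fy.
by move=> z; rewrite mem_rcons inE => /predU1P[->//|]; exact: sG.
Qed.

Let two_values i y : (i.+1 < size s)%N -> G y -> x i < y < x i.+1 ->
  f y = f (x i) \/ f y = f (x i.+1).
Proof.
move=> si Gy /andP[xy yx]; apply: contrapT => /not_orP[/eqP n1 /eqP n2].
have // : [:: y] = [::].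
apply: (no_insertion si); first by move=> z; rewrite inE => /eqP ->.
by rewrite /= /r xy yx n1 (eq_sym _ (f y)) n2.
Qed.

Let no_return i y z : (i.+1 < size s)%N -> G y -> G z ->
  x i < y -> y < z -> z < x i.+1 -> f y = f (x i.+1) -> f z = f (x i.+1).
Proof.
move=> si Gy Gz xy yz zx fy.
have /andP[_ fx] := xr si.
have [|fz|//] := two_values si Gz; first by rewrite (lt_trans xy).
have // : [:: y; z] = [::].
apply: (no_insertion si); first by move=> w; rewrite !inE => /orP[]/eqP ->.
by rewrite /= /r xy yz zx fy fz fx/= eq_sym fx.
Qed.

Let A i := [set y | [/\ G y, x i <= y < x i.+1 & f y = f (x i)]].

Let A_sup i : (i.+1 < size s)%N -> has_sup (A i).
Proof.
move=> si; have /andP[xx _] := xr si; split; last first.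
  by exists (x i.+1) => y [_ /andP[_ /ltW]].
by exists (x i); split; rewrite ?lexx//; apply: xG; exact: ltnW.
Qed.

Let sup_gt i : (i.+1 < size s)%N -> x i < sup (A i).
Proof.
move=> si; have /andP[xx _] := xr si.
have [||y [Gy /andP[xy yx] fy]] := @G_right (x i) (x i.+1 - x i).
- by apply: xG; exact: ltnW.
- by rewrite subr_gt0.
apply: (lt_le_trans xy); apply: ub_le_sup; first by case: (A_sup si).
by split => //; rewrite (ltW xy)/=; move: yx; rewrite addrC subrK.
Qed.

Let sup_lt i : (i.+1 < size s)%N -> sup (A i) < x i.+1.
Proof.
move=> si; have /andP[xx fx] := xr si.
have [||z [Gz /andP[xz zx] fz]] := @G_left (x i.+1) (x i.+1 - x i).
- exact: xG.
- by rewrite subr_gt0.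
apply: (le_lt_trans _ zx); apply: ge_sup; first by case: (A_sup si).
move: xz; rewrite opprB addrC subrK => xz.
move=> y [Gy /andP[xy yx] fy]; rewrite leNgt; apply/negP => zy.
have := no_return si Gz Gy xz zy yx fz.
by move/eqP; rewrite fy eq_sym (negbTE fx).
Qed.

Let left_of_sup i y : (i.+1 < size s)%N -> G y -> x i < y -> y < sup (A i) ->
  f y = f (x i).
Proof.
move=> si Gy xy ys; have /andP[xx fx] := xr si.
have yx : y < x i.+1 := lt_trans ys (sup_lt si).
have [|//|fy] := two_values si Gy; first by rewrite xy.
have sy : 0 < sup (A i) - y by rewrite subr_gt0.
have [z [Gz /andP[xz zx] fz]] := sup_adherent sy (A_sup si).
rewrite subKr => yz.
by have := no_return si Gy Gz xy yz zx fy => /eqP; rewrite fz eq_sym (negbTE fx).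
Qed.

Let right_of_sup i y : (i.+1 < size s)%N -> G y -> sup (A i) < y -> y < x i.+1 ->
  f y = f (x i.+1).
Proof.
move=> si Gy ys yx; have xy : x i < y := lt_trans (sup_gt si) ys.
have [|fy|//] := two_values si Gy; first by rewrite xy.
suff : y <= sup (A i) by rewrite leNgt ys.
apply: ub_le_sup; first by case: (A_sup si).
by split => //; rewrite (ltW xy).
Qed.

(** Between two consecutive points of a longest chain, [f] takes only the two
    values at these points, and cannot return from the second to the first: any
    other pattern could be inserted to give a longer chain.  Hence [f] switches
    exactly once, at the supremum of the points carrying the first value.  The
    one-sided hypotheses place this supremum strictly between the two points. *)
Lemma alternating_structure : exists (m : nat) (t y : nat -> R),
  [/\ t 0%N = t0, t m.+1 = tf,
      forall i, (i <= m)%N -> [/\ G (y i), t i < y i & y i < t i.+1],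
      forall i, (i < m)%N -> f (y i.+1) != f (y i) &
      forall i z, (i <= m)%N -> G z -> t i < z < t i.+1 -> f z = f (y i)].
Proof.
have [m Em] : exists m, size s = m.+1 by case: (size s) s_gt0 => // n _; exists n.
pose t i := if i is j.+1 then (if (j < m)%N then sup (A j) else tf) else t0.
have tl i : (i <= m)%N -> t i < x i.
  case: i => [_|i im] /=; first by have /andP[] := G_itv (xG s_gt0).
  by rewrite im; apply: sup_lt; rewrite Em.
have tr i : (i <= m)%N -> x i < t i.+1.
  move=> im /=; case: ifP => h; first by apply: sup_gt; rewrite Em ltnS.
  have si : (i < size s)%N by rewrite Em ltnS.
  by have /andP[] := G_itv (xG si).
exists m, t, x; split => //.
- by rewrite /= ltnn.
- by move=> i im; split; [apply: xG; rewrite Em ltnS|exact: tl|exact: tr].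
- by move=> i im; have /andP[] : r (x i) (x i.+1) by apply: xr; rewrite Em ltnS.
- move=> i z im Gz /andP[tz zt].
  have [zx|xz|->//] := ltgtP z (x i).
    case: i im tz zt zx => [_ _ _ zx|i im tz _ zx]; first exact: no_cons.
    by move: tz; rewrite /= im => tz; apply: right_of_sup => //; rewrite Em ltnS.
  move: zt; rewrite /=; case: ifP => [im' zs|/negbT].
    by apply: left_of_sup => //; rewrite Em ltnS.
  rewrite -leqNgt => mi _; have Ei : i = (size s).-1.
    by rewrite Em/=; apply/eqP; rewrite eqn_leq im.
  by rewrite Ei; apply: no_rcons => //; rewrite -Ei.
Qed.

End alternating_chains.

(** * Integer-valued functions of bounded variation *)

Section L2_functions.
Context {R : realType} (t0 tf : R).
Hypothesis t0tf : t0 < tf.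
Local Notation mu := (lebesgue_on t0 tf).
Local Notation leb := (@lebesgue_measure R).
Local Notation Om := [set` `]t0, tf[].
Local Notation integrable f := (mu.-integrable setT (EFin \o f)).
Local Notation L2 := (L2 t0 tf).

Lemma L2_integrable (v : L2) : integrable v.
Proof.
apply/Lfun1_integrable; apply: Lfun_subset12; last exact: LfunP.
by rewrite ge0_fin_numE ?lebesgue_on_setT_lty.
Qed.

Lemma L2_measurable (v : L2) : measurable_fun setT v.
Proof. exact: integrable_measurable (L2_integrable v). Qed.

Lemma ae_avoid_countable (t : nat -> R) :
  {ae mu, forall x, forall i, x != t i}.
Proof.
apply: ae_lebesgue_on.
have ct : countable (range t).
  by apply: (card_le_trans (card_image_le t setT)); exact: card_lexx.
have c0 : leb (range t) = 0%E by exact: countable_lebesgue_measure0.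
exists (range t); split => //.
  by exact: countable_measurable.
move=> x /= h; apply: contrapT => nx; apply: h => _ i; apply/eqP => xti.
by apply: nx; exists i.
Qed.

Lemma ae_lebesgue_on_ex (P : R -> Prop) :
  {ae mu, forall x, P x} -> exists2 x, t0 < x < tf & P x.
Proof.
move=> [N [mN N0 PN]]; apply: contrapT => none.
have : (leb Om <= 0)%E.
  rewrite -N0 /lebesgue_on/= /mrestr; apply: le_measure; rewrite ?inE.
  - exact: measurable_itv.
  - by apply: measurableI => //; exact: measurable_itv.
  - move=> x xO; split => //; apply: PN => /= Px; apply: none; exists x => //.
rewrite lebesgue_measure_itv/= lte_fin t0tf -EFinB lee_fin; apply/negP.
by rewrite -ltNge subr_gt0.
Qed.

End L2_functions.

Section step_structure.
Context {R : realType}.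

Lemma mono_steps (t : nat -> R) n : (forall i, (i < n)%N -> t i < t i.+1) ->
  forall i j, (i < j <= n)%N -> t i < t j.
Proof.
move=> tS i j /andP[ij jn]; elim: j ij jn => // j IH.
rewrite ltnS leq_eqVlt => /predU1P[->|ij] jn; first exact: tS.
by rewrite (lt_trans (IH ij (ltnW jn)))// tS.
Qed.

Lemma find_interval (t : nat -> R) n z : t 0%N < z -> z < t n ->
  (forall j, z != t j) -> exists2 i, (i < n)%N & t i < z < t i.+1.
Proof.
move=> t0z + zt; elim: n => [|n IH ztn]; first by move=> /(lt_trans t0z); rewrite ltxx.
have [zn|nz|zn] := ltgtP z (t n).
- by have [i i_n h] := IH zn; exists i => //; rewrite ltnS ltnW.
- by exists n => //; rewrite nz.
- by move: (zt n); rewrite zn eqxx.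
Qed.

Lemma step_function_in_interval (m : nat) (t : nat -> R) (a : nat -> int)
    (i : nat) (z : R) : (forall i, (i < m)%N -> t i < t i.+1) -> (i < m)%N ->
  t i < z < t i.+1 -> step_function m t a z = (a i.+1)%:~R.
Proof.
move=> tS im /andP[tz zt].
have t0z : t 0%N < z.
  case: i im tz {zt} => // i im; apply: lt_trans.
  by apply: (mono_steps tS); rewrite /= ltnW.
have ztm : z < t m.
  move: im; rewrite leq_eqVlt => /predU1P[<-//|im].
  by rewrite (lt_trans zt)// (mono_steps tS)// im leqnn.
rewrite step_function_jump ?t0z ?ztm//; last exact: leq_ltn_trans im.
rewrite /jump_function.
have -> : \sum_(k < m.-1) ((a k.+2)%:~R - (a k.+1)%:~R) * step_at (t k.+1) z =
    \sum_(k < m.-1) ((a k.+2)%:~R - (a k.+1)%:~R) * (k < i)%N%:R :> R.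
  apply: eq_bigr => k _; congr (_ * _); rewrite /step_at; congr (nat_of_bool _)%:R.
  have km : (k.+1 < m)%N by have := ltn_ord k; rewrite ltn_predRL.
  have [ki|ik] := ltnP k i.
    rewrite (le_trans _ (ltW tz))//; move: ki; rewrite leq_eqVlt.
    by move=> /predU1P[<-//|ki]; rewrite ltW// (mono_steps tS)// ki ltnW.
  apply/negbTE; rewrite -ltNge (lt_le_trans zt)//; move: ik.
  rewrite leq_eqVlt => /predU1P[<-//|ik].
  by rewrite ltW// (mono_steps tS)// ltnS ik ltnW.
suff -> n : \sum_(k < n) ((a k.+2)%:~R - (a k.+1)%:~R) * (k < i)%N%:R =
    (a (minn i n).+1)%:~R - (a 1%N)%:~R :> R.
  have -> : minn i m.-1 = i by apply/minn_idPl; move: im; case: (m).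
  by rewrite addrC subrK.
elim: n => [|n IH]; first by rewrite big_ord0 minn0 subrr.
rewrite big_ord_recr/= IH; have [ni|i_n] := ltnP n i.
  rewrite mulr1 (minn_idPr ni); ring.
by rewrite mulr0 addr0 (minn_idPl (leqW i_n)).
Qed.

End step_structure.

Section FP_structure.
Context {R : realType} (t0 tf : R).
Hypothesis t0tf : t0 < tf.
Context (M : nat) (nu : 'I_M -> int).
Local Notation mu := (lebesgue_on t0 tf).
Local Notation TV := (TV t0 tf).
Local Notation L2 := (L2 t0 tf).

(** On the Lebesgue points with an admissible value, a chain of [k] changes costs
    at least [k] in variation, which bounds the length of alternating chains.
    The points of a longest chain also witness the lower bound on the
    variation. *)
Lemma FP_structure (v : L2) : FP nu v -> (TV v < +oo)%E ->
  exists m t a, step_representation nu v m t a /\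
    ((\sum_(i < m.-1) `|(a i.+2)%:~R - (a i.+1)%:~R|)%:E <= TV v)%E.
Proof.
move=> vFP TVv; have intv := L2_integrable v; have mv := L2_measurable v.
pose G := [set y | [/\ t0 < y < tf, lebesgue_value t0 tf v y &
  exists i, v y = (nu i)%:~R]].
have aeG : {ae mu, forall y, t0 < y < tf -> G y}.
  by move: (ae_lebesgue_value intv) vFP; apply: filterS2 => y h1 h2 h3.
have far x y : G x -> G y -> v y != v x -> 1 <= `|v y - v x|.
  move=> [_ _ [i ->]] [_ _ [j ->]]; rewrite eqr_int => ij.
  rewrite -intrB -intr_norm ler1z -gtz0_ge1 normr_gt0 subr_eq0 //.
have Gchain k (x : nat -> R) : (forall i, (i <= k)%N -> G (x i)) ->
    (forall i, (i < k)%N -> x i < x i.+1) ->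
    ((\sum_(i < k) `|v (x i.+1) - v (x i)|)%:E <= TV v)%E.
  move=> xG xS.
  have [/andP[t0x _] _ _] := xG 0%N isT; have [/andP[_ xtf] _ _] := xG k (leqnn k).
  apply: (chain_variation_le t0tf (y := fun i => v (x i)) intv xS t0x xtf).
  by move=> i ik; have [xO xl _] := xG i ik; exact: lebesgue_value_right_value.
have [T TVT] : exists T, TV v = T%:E.
  by exists (fine (TV v)); rewrite fineK// ge0_fin_numE// TV_ge0.
have T0 : 0 <= T by rewrite -lee_fin -TVT TV_ge0.
have [] := @alternating_structure R t0 tf v G (Num.Def.archi_bound T).+1.
- by move=> y [].
- have [y yO Gy] := ae_lebesgue_on_ex t0tf aeG.
  by exists y; exact: Gy.
- move=> x d Gx d0; have [xO xl _] := Gx.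
  by have := lebesgue_value_near true mv xO xl aeG (fun y => far x y Gx) d0.
- move=> x d Gx d0; have [xO xl _] := Gx.
  by have := lebesgue_value_near false mv xO xl aeG (fun y => far x y Gx) d0.
- move=> s [/(sortedP 0) sr sG].
  have [//|s0] := posnP (size s); first by move=> ->.
  rewrite -(prednK s0) ltnS -(ler_nat R) ltW//.
  apply: le_lt_trans (Num.Theory.archi_boundP T0).
  have xG i : (i <= (size s).-1)%N -> G (nth 0 s i).
    by move=> si; apply: sG; apply: mem_nth; rewrite -(prednK s0) ltnS.
  have := @Gchain (size s).-1 (fun i => nth 0 s i) xG.
  have xr i : (i < (size s).-1)%N ->
      (nth 0 s i < nth 0 s i.+1) && (v (nth 0 s i.+1) != v (nth 0 s i)).
    by move=> si; apply: sr; rewrite -(prednK s0) ltnS.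
  rewrite TVT lee_fin => /(_ (fun i h => proj1 (andP (xr i h)))).
  apply: le_trans; rewrite -[X in X%:R]card_ord -sum1_card natr_sum.
  apply: ler_sum => i _; apply: far; first by apply: xG; exact: ltnW.
    exact: xG.
  by have /andP[] := xr i (ltn_ord i).
move=> m [t [y [t0E tfE ty vne vE]]].
pose a i := if i is j.+1 then Num.floor (v (y j)) else 0.
have aE i : (i <= m)%N -> (a i.+1)%:~R = v (y i) /\ exists j, a i.+1 = nu j.
  move=> im; have [[_ _ [j vj]] _ _] := ty i im.
  by rewrite /a vj intrKfloor; split => //; exists j.
have tS i : (i < m.+1)%N -> t i < t i.+1.
  by rewrite ltnS => /ty[_]; exact: lt_trans.
exists m.+1, t, a; split; last first.
  have := @Gchain m y; rewrite /= => h.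
  have E : \sum_(i < m) `|(a i.+2)%:~R - (a i.+1)%:~R| =
      \sum_(i < m) `|v (y i.+1) - v (y i)| :> R.
    apply: eq_bigr => i _; have [-> _] := aE i (ltnW (ltn_ord i)).
    by have [-> _] := aE i.+1 (ltn_ord i).
  rewrite E; apply: h => i im; first by have [] := ty i im.
  have [_ _ h1] := ty i (ltnW im); have [_ h2 _] := ty i.+1 im.
  exact: lt_trans h2.
split => //.
- split.
    case=> // i /andP[_ im]; exact: (aE i im).2.
  case=> // i /andP[_]; rewrite ltnS => im.
  have [aE1 _] := aE i (ltnW im); have [aE2 _] := aE i.+1 im.
  by rewrite -(eqr_int R) aE1 aE2 eq_sym; exact: vne.
- have aeO : {ae mu, forall y, t0 < y < tf}.
    by apply: ae_lebesgue_on; apply: aeW.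
  have aet := @ae_avoid_countable _ t0 tf t.
  have aeGO : {ae mu, forall y, G y} by apply: filterS2 aeG aeO => z; exact.
  apply: filterS2 aeGO aet => z Gz zt.
  have [/andP[t0z ztf] _ _] := Gz.
  have [||//|i im tz] := @find_interval _ t m.+1 z; rewrite ?t0E ?tfE//.
  rewrite (step_function_in_interval _ tS im tz) (aE i im).1.
  exact: vE.
Qed.

End FP_structure.

(** * Moving a jump, and L-stationarity *)

Section stationarity.
Context {R : realType} (t0 tf : R).
Hypothesis t0tf : t0 < tf.
Context (M : nat) (nu : 'I_M -> int).
Local Notation mu := (lebesgue_on t0 tf).
Local Notation leb := (@lebesgue_measure R).
Local Notation Om := [set` `]t0, tf[].
Local Notation TV := (TV t0 tf).
Local Notation L2 := (L2 t0 tf).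
Local Notation integrable f := (mu.-integrable setT (EFin \o f)).

Lemma bounded_L2 (f : R -> R) : measurable_fun setT f -> bounded_on_line f ->
  exists u : L2, (u : R -> R) = f.
Proof.
move=> mf [K fK]; suff fL : f \in Lfun mu 2%:E by exists (Lfun_Sub (lee1n 2) fL).
rewrite inE; apply/andP; split; rewrite inE//=.
rewrite /finite_norm unlock /Lnorm poweR_lty//.
have mf2 : measurable_fun setT (fun x => `|f x| `^ 2).
  apply: (measurableT_comp (measurable_powR _)) => //.
  exact: measurableT_comp.
have bf2 : bounded_on_line (fun x => `|f x| `^ 2).
  exists (`|K| `^ 2) => x; rewrite ger0_norm ?powR_ge0// ge0_ler_powR ?nnegrE//.
  by rewrite (le_trans (fK x))// ler_norm.
exact: (integrable_lty measurableT (bounded_integrable t0 tf mf2 bf2)).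
Qed.

Lemma integrable_step_at t : integrable (step_at t).
Proof.
by apply: bounded_integrable;
  [exact: measurable_step_at|exact: step_at_bounded].
Qed.

Lemma L1dist_step_at_le (s t : R) : L1dist t0 tf (step_at s) (step_at t) <= `|s - t|.
Proof.
wlog st : s t / s <= t => [wl|].
  have [st|/ltW ts] := leP s t; first exact: wl.
  by rewrite L1distC distrC; exact: wl.
have mI : measurable (`[s, t[ : set (measurableTypeR R)) by exact: measurable_itv.
rewrite /L1dist (_ : \int[mu]_x _ = \int[mu]_(x in `[s, t[) 1); last first.
  rewrite [RHS]Rintegral_mkcond; apply: eq_Rintegral => x _.
  rewrite -indic_itv_step// indicE patchE; case: (_ \in _) => /=.
    by rewrite normr1.
  by rewrite normr0.
rewrite Rintegral_cst// mul1r.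
apply: (@le_trans _ _ (fine (leb `[s, t[))); last first.
  rewrite lebesgue_measure_itv/= lte_fin; case: ltP => h /=.
    by rewrite distrC ler_norm.
  exact: normr_ge0.
have lf : (leb `[s, t[ < +oo)%E.
  by rewrite lebesgue_measure_itv/=; case: ifP => _; rewrite -?EFinB ltry.
have mO : measurable (Om : set (measurableTypeR R)) by exact: measurable_itv.
rewrite /lebesgue_on/= /mrestr.
have le1 : (leb (`[s, t[ `&` Om) <= leb `[s, t[)%E.
  by apply: le_measure; rewrite ?inE//; exact: measurableI.
apply: fine_le => //; rewrite ge0_fin_numE//.
exact: le_lt_trans lf.
Qed.

Lemma Rintegral_step_at_diff (g : R -> R) (a b : R) : integrable g -> a <= b ->
  \int[mu]_x (g x * (step_at a x - step_at b x)) = \int[mu]_(x in `[a, b]) g x.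
Proof.
move=> intg ab; have mg := integrable_measurable intg.
have mI : measurable (`[a, b] : set (measurableTypeR R)) by exact: measurable_itv.
rewrite [RHS]Rintegral_mkcond; apply: ae_eq_Rintegral_on.
- by apply: measurable_funM => //; apply: measurable_funB; exact: measurable_step_at.
- by apply/(measurable_restrictT _ mI); exact: measurable_funS mg.
have := @ae_avoid_countable _ t0 tf (fun=> b); apply: filterS => x /(_ 0%N) xb.
rewrite patchE /step_at.
have -> : (x \in (`[a, b]%classic : set R)) = (a <= x <= b).
  by apply/idP/idP; rewrite inE/= in_itv.
case: (ltgtP x b) xb => // xb _; last by rewrite andbF (le_trans ab (ltW xb)) subrr mulr0.
by rewrite andbT; case: leP => _; rewrite ?subr0 ?mulr1 ?mulr0.
Qed.

Lemma limf_einf_gt0 (f : R -> R) :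
  (0 < limf_einf (fun h => (f h)%:E) (0 : R)^'+)%E ->
  exists2 c, 0 < c & exists2 h0, 0 < h0 & forall h, 0 < h < h0 -> c <= f h.
Proof.
rewrite limf_einfE => /ereal_sup_gt[_ /= [V FV <-] Vgt].
have [c c0 cV] : exists2 c, 0 < c & (c%:E <= ereal_inf [set (f h)%:E | h in V])%E.
  case: (ereal_inf _) Vgt => [r||//] r0; last by exists 1; rewrite ?leey.
  by exists r.
exists c => //; move: FV => [d /= d0 dV]; exists d => // h /andP[h0 hd].
rewrite -lee_fin (le_trans cV)//; apply: ereal_inf_lbound; exists h => //.
by apply: dV => //=; rewrite sub0r normrN gtr0_norm.
Qed.

Lemma limf_esup_lt0 (f : R -> R) :
  (limf_esup (fun h => (f h)%:E) (0 : R)^'+ < 0)%E ->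
  exists2 c, 0 < c & exists2 h0, 0 < h0 & forall h, 0 < h < h0 -> c <= - f h.
Proof.
move=> h; apply: limf_einf_gt0.
rewrite (_ : (fun h => _) = (\- (fun h => (f h)%:E))%E).
  by rewrite limf_einfN -oppe0 lteN2.
by apply/funext => x.
Qed.

(** The new position stays between the two neighbouring jumps, so no value
    outside the set is created.  The sum of jump sizes is unchanged; it bounds
    the variation of the new function from above and that of [v] from below. *)
Lemma move_jump (v : L2) m t a i (s : R) : step_representation nu v m t a ->
  ((\sum_(i < m.-1) `|(a i.+2)%:~R - (a i.+1)%:~R|)%:E <= TV v)%E ->
  (i.+1 < m)%N -> t i < s < t i.+2 ->
  let d : R := (a i.+2)%:~R - (a i.+1)%:~R in
  exists w : L2, [/\ FP nu w, (TV w <= TV v)%E,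
    (normL1 t0 tf (w - v)%R <= (`|d| * `|s - t i.+1|)%:E)%E &
    forall g : L2, innerL2 t0 tf g (w - v)%R =
      d * \int[mu]_x (g x * (step_at s x - step_at (t i.+1) x))].
Proof.
move=> [m0 [t0E tfE] tS [ain ane] vE] TVv im /andP[ts st] d.
have intv := L2_integrable v; have mv := L2_measurable v.
pose D x := d * (step_at s x - step_at (t i.+1) x).
have mD : measurable_fun setT D.
  apply: measurable_funM => //; apply: measurable_funB; exact: measurable_step_at.
have bD : bounded_on_line D.
  exists `|d| => x; rewrite normrM ler_piMr// /step_at.
  by do 2 case: (_ <= x); rewrite /= ?subrr ?subr0 ?sub0r ?normrN ?normr1 ?normr0 ?ler01.
have [u uD] := bounded_L2 mD bD.
have wv : (u + v - v)%R = u by rewrite addrK.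
have tO j : (j <= m)%N -> t0 <= t j <= tf.
  move=> jm; rewrite -t0E -tfE; apply/andP; split.
    case: j jm => // j jm; apply: ltW; apply: (mono_steps tS).
    by rewrite /= jm.
  move: jm; rewrite leq_eqVlt => /predU1P[->//|jm]; apply: ltW.
  by apply: (mono_steps tS); rewrite jm leqnn.
have aet := @ae_avoid_countable _ t0 tf t.
have aeO : {ae mu, forall y, t0 < y < tf} by apply: ae_lebesgue_on; apply: aeW.
have aeI : {ae mu, forall x, exists2 j, (j < m)%N & t j < x < t j.+1}.
  apply: filterS2 aet aeO => x xt /andP[t0x xtf].
  by apply: find_interval; rewrite ?t0E ?tfE.
have uvE x : (u + v)%R x = D x + v x by rewrite -uD.
exists (u + v)%R; rewrite wv; split.
- apply: filterS2 vE aeI => x vx [j jm tjx].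
  rewrite uvE vx (step_function_in_interval a tS jm tjx) /D /step_at.
  have /andP[tj xj] := tjx.
  have [ji|ij|jE] := ltngtP j i.
  + have xi : x < t i.
      move: ji; rewrite leq_eqVlt => /predU1P[<-//|ji].
      by rewrite (lt_trans xj)// (mono_steps tS)// ji ltnW// ltnW.
    have -> : (s <= x) = false by apply/negbTE; rewrite -ltNge (lt_trans xi).
    have -> : (t i.+1 <= x) = false.
      by apply/negbTE; rewrite -ltNge (lt_trans xi)// tS// ltnW.
    have [k ->] := ain j.+1 jm; exists k; rewrite /=; ring.
  + move: ij; rewrite leq_eqVlt => /predU1P[jE|ij].
      rewrite -jE in tj xj jm *; rewrite (ltW tj).
      case: (s <= x) => /=.
        have [k Ek] := ain i.+2 jm; exists k; rewrite Ek; ring.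
      have [k Ek] := ain i.+1 (ltnW jm); exists k; rewrite -Ek /d; ring.
    have xi : t i.+2 <= x.
      move: ij; rewrite leq_eqVlt => /predU1P[->|ij]; first exact: ltW.
      by rewrite (le_trans _ (ltW tj))// ltW// (mono_steps tS)// ij ltnW.
    rewrite (le_trans (ltW st))// (le_trans _ xi)/=; last by rewrite ltW// tS.
    have [k ->] := ain j.+1 jm; exists k; ring.
  + rewrite jE in tj xj jm *.
    have -> : (t i.+1 <= x) = false by apply/negbTE; rewrite -ltNge.
    case: (s <= x) => /=.
      have [k Ek] := ain i.+2 im; exists k; rewrite -Ek /d; ring.
    have [k ->] := ain i.+1 jm; exists k; ring.
- apply: le_trans TVv.
  pose t' j := if j == i then s else t j.+1.
  pose dd j : R := (a j.+2)%:~R - (a j.+1)%:~R.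
  have -> : TV (u + v)%R = TV (jump_function m.-1 (a 1%N)%:~R t' dd).
    apply: TV_ae; [exact: L2_measurable|exact: measurable_jump_function|].
    apply: filterS2 vE aeO => x vx xO; rewrite uvE vx step_function_jump ?t0E ?tfE//.
    rewrite /jump_function /D addrCA; congr (_ + _).
    have im1 : (i < m.-1)%N by rewrite ltn_predRL.
    rewrite (bigD1 (Ordinal im1))//= [RHS](bigD1 (Ordinal im1))//= addrA.
    congr (_ + _); first by rewrite /t' eqxx /d /dd; ring.
    apply: eq_bigr => j ji; rewrite /t'; case: eqP => // jE.
    by move: ji; rewrite -val_eqE/= jE eqxx.
  apply: TV_jump_function_le => // j jm; rewrite /t'.
  have jm' : (j.+1 < m)%N by rewrite -ltn_predRL.
  case: eqP => _; last by apply: tO; exact: ltnW.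
  have /andP[h1 _] := tO i (ltnW (ltnW im)); have /andP[_ h2] := tO i.+2 im.
  by rewrite (le_trans h1 (ltW ts)) (le_trans (ltW st) h2).
- rewrite uD normL1_integral; last exact: bounded_integrable.
  rewrite lee_fin; under eq_Rintegral do rewrite /D normrM.
  have intss : integrable (fun x => `|step_at s x - step_at (t i.+1) x|).
    by apply: integrable_norm; apply: integrable_sub; exact: integrable_step_at.
  by rewrite RintegralZl// ler_wpM2l//; exact: L1dist_step_at_le.
- move=> g; rewrite uD /innerL2 -RintegralZl//.
    by apply: eq_Rintegral => x _; rewrite /D; ring.
  apply: integrable_mul_bounded; first exact: L2_integrable.
    by apply: measurable_funB; exact: measurable_step_at.
  exists 1 => x; rewrite /step_at.
  by do 2 case: (_ <= x); rewrite /= ?subrr ?subr0 ?sub0r ?normrN ?normr1 ?normr0 ?ler01.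
Qed.

(** A decrease of the linear part at a rate proportional to the L1 distance
    beats the quadratic error of the model.  All small [h] are required because
    the trust-region radius is dictated by the algorithm. *)
Definition descent_direction (g v : L2) : Prop :=
  exists2 c : R, 0 < c & exists2 h0 : R, 0 < h0 & forall h : R, 0 < h < h0 ->
    exists w : L2, [/\ FP nu w, (TV w <= TV v)%E,
      (normL1 t0 tf (w - v)%R <= h%:E)%E &
      innerL2 t0 tf g (w - v)%R <= - (c * h)].

(** Each of the four inequalities, when violated, keeps the means of the gradient
    on one side of a jump away from zero, with the sign for which moving the
    jump to that side decreases the linear part. *)
Lemma L_stationary_of_no_descent (gradF : L2 -> L2) (v : L2) : FP nu v ->
  (TV v < +oo)%E -> ~ descent_direction (gradF v) v -> L_stationary nu gradF v.
Proof.
move=> vFP TVv nod; have [m [t [a [rep suma]]]] := FP_structure t0tf vFP TVv.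
exists m, t, a; split => // -[//|i] /andP[_ im].
set g := gradF v.
have [_ _ tS _ _] := rep.
have intg : integrable g := L2_integrable g.
have tS1 := tS i (ltnW im); have tS2 := tS i.+1 im.
pose d : R := (a i.+2)%:~R - (a i.+1)%:~R.
have right_descent c h0 : d != 0 -> 0 < c -> 0 < h0 ->
    (forall h, 0 < h < h0 ->
      c * h <= Num.sg d * \int[mu]_(x in `[t i.+1, t i.+1 + h]) g x) -> False.
  move=> d0 c0 h00 hc; apply: nod; exists c => //.
  have nd0 : 0 < `|d| by rewrite normr_gt0.
  exists (`|d| * Num.min h0 (t i.+2 - t i.+1)).
    by rewrite mulr_gt0// lt_min h00 subr_gt0.
  move=> h /andP[hgt]; rewrite mulrC -ltr_pdivrMr// lt_min => /andP[hd1 hd2].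
  have k0 : 0 < h / `|d| by rewrite divr_gt0.
  have [|w [wFP TVw nw iw]] := @move_jump v m t a i (t i.+1 + h / `|d|) rep suma im.
    by apply/andP; split; lra.
  exists w; split => //.
    apply: le_trans nw _; rewrite lee_fin addrAC subrr add0r (ger0_norm (ltW k0)).
    by rewrite mulrC divfK// gt_eqF.
  rewrite iw -/d.
  have -> : \int[mu]_x (g x * (step_at (t i.+1 + h / `|d|) x - step_at (t i.+1) x)) =
     - \int[mu]_(x in `[t i.+1, t i.+1 + h / `|d|]) g x.
    rewrite -Rintegral_step_at_diff//; last by rewrite lerDl ltW.
    rewrite -mulN1r -RintegralZl//.
      by apply: eq_Rintegral => x _; ring.
    apply: integrable_mul_bounded => //.
      by apply: measurable_funB; exact: measurable_step_at.
    exists 1 => x; rewrite /step_at.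
    by do 2 case: (_ <= x); rewrite /= ?subrr ?subr0 ?sub0r ?normrN ?normr1 ?normr0 ?ler01.
  rewrite mulrN lerN2; have := hc (h / `|d|); rewrite k0 hd1 => /(_ isT).
  move: (Rintegral _ _ _) => I; rewrite -(ler_pM2r nd0) mulrA divfK ?normr_eq0//.
  by rewrite [in leRHS]mulrAC -numEsg.
have left_descent c h0 : d != 0 -> 0 < c -> 0 < h0 ->
    (forall h, 0 < h < h0 ->
      c * h <= - Num.sg d * \int[mu]_(x in `[t i.+1 - h, t i.+1]) g x) -> False.
  move=> d0 c0 h00 hc; apply: nod; exists c => //.
  have nd0 : 0 < `|d| by rewrite normr_gt0.
  exists (`|d| * Num.min h0 (t i.+1 - t i)).
    by rewrite mulr_gt0// lt_min h00 subr_gt0.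
  move=> h /andP[hgt]; rewrite mulrC -ltr_pdivrMr// lt_min => /andP[hd1 hd2].
  have k0 : 0 < h / `|d| by rewrite divr_gt0.
  have [|w [wFP TVw nw iw]] := @move_jump v m t a i (t i.+1 - h / `|d|) rep suma im.
    by apply/andP; split; lra.
  exists w; split => //.
    apply: le_trans nw _; rewrite lee_fin addrAC subrr add0r normrN (ger0_norm (ltW k0)).
    by rewrite mulrC divfK// gt_eqF.
  rewrite iw -/d Rintegral_step_at_diff//; last by rewrite gerBl ltW.
  rewrite -lerN2 opprK; have := hc (h / `|d|); rewrite k0 hd1 => /(_ isT).
  move: (Rintegral _ _ _) => I; rewrite -(ler_pM2r nd0) mulrA divfK ?normr_eq0//.
  by rewrite [in leRHS]mulrAC mulNr -numEsg mulNr.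
have meanP (I : R -> R) c h0 : (forall h, 0 < h < h0 -> c <= h^-1 * I h) ->
    forall h, 0 < h < h0 -> c * h <= I h.
  by move=> H h hh; have /andP[h1 _] := hh; have := H h hh; rewrite ler_pdivlMl// mulrC.
split => aa.
  have d0 : 0 < d by rewrite subr_gt0 ltr_int.
  have nd0 : d != 0 by rewrite gt_eqF.
  split; rewrite leNgt; apply/negP.
    move=> /limf_einf_gt0[c c0 [h0 h00 /meanP hc]].
    by apply: (right_descent c h0) => // h hh; rewrite gtr0_sg// mul1r; exact: hc.
  move=> /limf_esup_lt0[c c0 [h0 h00]] hc.
  apply: (left_descent c h0) => // h hh; rewrite gtr0_sg// mulN1r.
  by apply: (meanP (fun h => - \int[mu]_(x in `[t i.+1 - h, t i.+1]) g x)
    c h0) hh => h' /hc; rewrite mulrN.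
have d0 : d < 0 by rewrite subr_lt0 ltr_int.
have nd0 : d != 0 by rewrite lt_eqF.
split; rewrite leNgt; apply/negP.
  move=> /limf_einf_gt0[c c0 [h0 h00 /meanP hc]].
  by apply: (left_descent c h0) => // h hh; rewrite ltr0_sg// opprK mul1r; exact: hc.
move=> /limf_esup_lt0[c c0 [h0 h00]] hc.
apply: (right_descent c h0) => // h hh; rewrite ltr0_sg// mulN1r.
by apply: (meanP (fun h => - \int[mu]_(x in `[t i.+1, t i.+1 + h]) g x)
    c h0) hh => h' /hc; rewrite mulrN.
Qed.

End stationarity.

(** * First-order expansions in the L1 norm *)

Section smoothness.
Context {R : realType} (t0 tf : R).
Local Notation mu := (lebesgue_on t0 tf).
Local Notation L2 := (L2 t0 tf).
Local Notation integrable f := (mu.-integrable setT (EFin \o f)).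

Definition norm1 (u : L2) : R := \int[mu]_x `|u x|.

Definition norm2 (u : L2) : R := fine (normL2 t0 tf u).

Lemma norm1E (u : L2) : normL1 t0 tf u = (norm1 u)%:E.
Proof. by rewrite normL1_integral//; exact: L2_integrable. Qed.

Lemma norm2E (u : L2) : normL2 t0 tf u = (norm2 u)%:E.
Proof. by rewrite /norm2 /normL2 -finite_norm_fine. Qed.

Lemma norm1_ge0 u : 0 <= norm1 u. Proof. exact: Rintegral_ge0. Qed.

Lemma norm2_ge0 u : 0 <= norm2 u.
Proof. by rewrite -lee_fin -norm2E; exact: Lnorm_ge0. Qed.

Lemma norm1B (u v : L2) : norm1 (u - v) = L1dist t0 tf u v.
Proof. by []. Qed.

Lemma norm1Z (a : R) (u : L2) : norm1 (a *: u) = `|a| * norm1 u.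
Proof.
rewrite /norm1 -RintegralZl//; last by apply: integrable_norm; exact: L2_integrable.
by apply: eq_Rintegral => x _; rewrite -normrM.
Qed.

Lemma norm2Z (a : R) (u : L2) : norm2 (a *: u) = `|a| * norm2 u.
Proof.
apply: EFin_inj; rewrite -norm2E EFinM -norm2E /normL2 -LnormZ.
by congr (Lnorm _ _ _).
Qed.

Lemma is_derive_from_expansion (f : R -> R) (s l : R) :
  (forall e, 0 < e -> exists2 d, 0 < d & forall h, `|h| < d ->
    `|f (s + h) - f s - h * l| <= e * `|h|) -> is_derive s 1 f l.
Proof.
move=> fs.
have cf : h^-1 *: (f (h *: (1 : R) + s) - f s) @[h --> 0^'] --> l.
  apply/cvgrPdist_le => e /fs[d d0 hd]; near=> h.
  have h0 : h != 0 by near: h; exact: nbhs_dnbhs_neq.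
  rewrite /GRing.scale/= mulr1 distrC -[X in _ - X](mulKf h0) -mulrBr normrM normfV.
  rewrite ler_pdivrMl ?normr_gt0// [leRHS]mulrC (addrC h s); apply: hd.
  by near: h; exact: dnbhs0_lt.
by apply: DeriveDef; [apply/cvg_ex; exists l|exact/cvg_lim].
Unshelve. all: by end_near. Qed.

Lemma mean_value_unit (f df : R -> R) : (forall s : R, is_derive s 1 f (df s)) ->
  exists2 c, 0 <= c <= 1 & f 1 - f 0 = df c.
Proof.
move=> fd; have cf : {within `[(0 : R), 1], continuous f}.
  by apply: derivable_within_continuous => y _; exact: ex_derive.
have [c + ->] := MVT_segment ler01 (fun y _ => fd y) cf.
by rewrite in_itv/= => c01; exists c => //; rewrite subr0 mulr1.
Qed.

Context (F : L2 -> R) (DF : L2 -> L2 -> R) (D2F : L2 -> L2 -> L2 -> R) (C : R).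
Hypothesis hF : twice_cont_frechet F DF D2F.
Hypothesis hC : forall xi u h : L2,
  (`|D2F xi u h|%:E <= C%:E * normL1 t0 tf u * normL1 t0 tf h)%E.

Lemma derivativeD u v w : DF u (v + w) = DF u v + DF u w.
Proof.
case: hF => _ /(_ u)[lin _ _] _ _.
by have := lin 1 v w; rewrite scale1r mul1r.
Qed.

Lemma derivativeN u v : DF u (- v) = - DF u v.
Proof.
case: hF => _ /(_ u)[lin _ _] _ _.
have D0 : DF u 0 = 0 by have := lin (-1) 0 0; rewrite scaler0 addr0 mulN1r addNr.
by have := lin (-1) v 0; rewrite scaleN1r addr0 D0 addr0 mulN1r.
Qed.

Lemma derivativeZ a u v : DF u (a *: v) = a * DF u v.
Proof.
case: hF => _ /(_ u)[lin _ _] _ _.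
have D0 : DF u 0 = 0 by have := lin (-1) 0 0; rewrite scaler0 addr0 mulN1r addNr.
by have := lin a v 0; rewrite addr0 D0 addr0.
Qed.

Lemma derivative_bounded v : exists2 K, 0 <= K &
  forall h, `|DF v h| <= K * norm2 h.
Proof.
case: hF => _ /(_ v)[_ [K hK] _] _ _; exists `|K| => // h.
have := hK h; rewrite norm2E -EFinM lee_fin => /le_trans; apply.
by rewrite ler_wpM2r ?norm2_ge0// ler_norm.
Qed.

Lemma second_derivative_le xi u h : `|D2F xi u h| <= C * norm1 u * norm1 h.
Proof. by have := hC xi u h; rewrite !norm1E -!EFinM lee_fin. Qed.

Lemma is_derive_derivative_line (v u w : L2) (s : R) :
  is_derive s 1 (fun s => DF (v + s *: u) w) (D2F (v + s *: u) u w).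
Proof.
apply: is_derive_from_expansion => e e0.
case: hF => _ _ /(_ (v + s *: u))[linu _ _ exp] _.
have p1 : 0 < 1 + norm2 u * norm2 w by rewrite ltr_pwDl// mulr_ge0// norm2_ge0.
have p2 : 0 < 1 + norm2 u by rewrite ltr_pwDl// norm2_ge0.
have [|d d0 hd] := exp (e / (1 + norm2 u * norm2 w)); first by rewrite divr_gt0.
exists (d / (1 + norm2 u)); first by rewrite divr_gt0.
move=> h; rewrite ltr_pdivlMr// => hh.
have := hd (h *: u) w; rewrite !norm2E norm2Z lte_fin -!EFinM lee_fin.
have D2Z : D2F (v + s *: u) (h *: u) w = h * D2F (v + s *: u) u w.
  have D0 : D2F (v + s *: u) 0 w = 0.
    by have := linu w (-1) 0 0; rewrite scaler0 addr0 mulN1r addNr.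
  by have := linu w h u 0; rewrite addr0 D0 addr0.
rewrite D2Z scalerDl addrA => h1; apply: le_trans (h1 _) _.
  by apply: le_lt_trans hh; rewrite ler_wpM2l// lerDr.
rewrite -!mulrA ler_wpM2l ?(ltW e0)// mulrCA ler_piMr//.
by rewrite mulrC ler_pdivrMr// mul1r lerDr.
Qed.

(** The mean value theorem on a segment, with the L1 bound on the second
    derivative. *)
Lemma derivative_Lipschitz (v u w : L2) :
  `|DF (v + u) w - DF v w| <= C * norm1 u * norm1 w.
Proof.
have [c _] := mean_value_unit (is_derive_derivative_line v u w).
rewrite scale1r scale0r addr0 => ->; exact: second_derivative_le.
Qed.

Lemma is_derive_line (v u : L2) (s : R) :
  is_derive s 1 (fun s => F (v + s *: u)) (DF (v + s *: u) u).
Proof.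
apply: is_derive_from_expansion => e e0.
case: hF => _ /(_ (v + s *: u))[_ _ exp] _ _.
have p2 : 0 < 1 + norm2 u by rewrite ltr_pwDl// norm2_ge0.
have [|d d0 hd] := exp (e / (1 + norm2 u)); first by rewrite divr_gt0.
exists (d / (1 + norm2 u)); first by rewrite divr_gt0.
move=> h; rewrite ltr_pdivlMr// => hh.
have := hd (h *: u); rewrite norm2E norm2Z lte_fin -EFinM lee_fin derivativeZ.
rewrite scalerDl addrA => h1; apply: le_trans (h1 _) _.
  by apply: le_lt_trans hh; rewrite ler_wpM2l// lerDr.
rewrite -!mulrA ler_wpM2l ?(ltW e0)// mulrCA ler_piMr//.
by rewrite mulrC ler_pdivrMr// mul1r lerDr.
Qed.

Hypothesis C0 : 0 < C.

(** The mean value theorem for [F], and [derivative_Lipschitz] between the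
    intermediate point and [v]. *)
Lemma Taylor_L1 (v u : L2) :
  `|F (v + u) - F v - DF v u| <= C * norm1 u ^+ 2.
Proof.
have [c /andP[c0 c1]] := mean_value_unit (is_derive_line v u).
rewrite scale1r scale0r addr0 => ->.
apply: le_trans (derivative_Lipschitz v (c *: u) u) _.
rewrite norm1Z ger0_norm// expr2 -!mulrA ler_wpM2l ?(ltW C0)//.
by rewrite ler_piMl// mulr_ge0// norm1_ge0.
Qed.

End smoothness.

(** * Functions with values in a finite set of integers *)

Section square_integral.
Context {R : realType} (t0 tf : R).
Local Notation mu := (lebesgue_on t0 tf).
Local Notation L2 := (L2 t0 tf).
Local Notation integrable f := (mu.-integrable setT (EFin \o f)).

Lemma integral_square_le (f : R -> R) (B : R) : 0 <= B -> integrable f ->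
  {ae mu, forall x, `|f x| <= B} ->
  (\int[mu]_x (`|f x| `^ 2)%:E <= (B * \int[mu]_x `|f x|)%:E)%E.
Proof.
move=> B0 intf fB; have iu := integrable_norm intf.
have mf := integrable_measurable intf.
have mnf : measurable_fun setT (fun x => `|f x|) by exact: measurableT_comp.
have -> : (B * \int[mu]_x `|f x|)%:E = (\int[mu]_x (B%:E * (`|f x|)%:E))%E.
  by rewrite EFinM integralZl// /Rintegral fineK//; exact: integrable_fin_num.
apply: ae_ge0_le_integral => //.
- apply/measurable_EFinP.
  by apply: (measurableT_comp (measurable_powR _)) => //; exact: mnf.
- by move=> x _; rewrite -EFinM lee_fin mulr_ge0.
- by apply/measurable_EFinP; exact: measurable_funM.
- apply: filterS fB => x xB _; rewrite -EFinM lee_fin.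
  by rewrite powR_mulrn// expr2 ler_wpM2r.
Qed.

(** Interpolation: on bounded functions, L1 convergence implies L2 convergence. *)
Lemma norm2_le (u : L2) (B e : R) : 0 <= B -> {ae mu, forall x, `|u x| <= B} ->
  0 <= e -> B * norm1 u <= e ^+ 2 -> norm2 u <= e.
Proof.
move=> B0 uB e0 Be; rewrite -lee_fin -norm2E /normL2 unlock /Lnorm.
have le2 := integral_square_le B0 (L2_integrable u) uB.
have -> : e%:E = ((e ^+ 2)%:E `^ 2^-1)%E.
  by rewrite poweR_EFin -powR_mulrn// -powRrM divff// powRr1.
apply: gt0_ler_poweR => //.
- by rewrite in_itv/= leey integral_ge0// => x _; rewrite lee_fin powR_ge0.
- by rewrite in_itv/= leey andbT lee_fin sqr_ge0.
- by apply: le_trans le2 _; rewrite lee_fin.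
Qed.

Lemma ae_bounded_L2 (f : R -> R) (B : R) : 0 <= B -> integrable f ->
  {ae mu, forall x, `|f x| <= B} -> exists u : L2, (u : R -> R) = f.
Proof.
move=> B0 intf fB; have mf := integrable_measurable intf.
suff fL : f \in Lfun mu 2%:E by exists (Lfun_Sub (lee1n 2) fL).
rewrite inE; apply/andP; split; rewrite inE//=.
rewrite /finite_norm unlock /Lnorm poweR_lty//.
exact: le_lt_trans (integral_square_le B0 intf fB) (ltry _).
Qed.

End square_integral.

Section FP_functions.
Context {R : realType} (t0 tf : R) (M : nat) (nu : 'I_M -> int).
Local Notation mu := (lebesgue_on t0 tf).
Local Notation L2 := (L2 t0 tf).
Local Notation integrable f := (mu.-integrable setT (EFin \o f)).

Definition FP_bound : R := \sum_(i < M) `|(nu i)%:~R|.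

Lemma FP_bound_ge0 : 0 <= FP_bound. Proof. exact: sumr_ge0. Qed.

Lemma value_le_FP_bound i : `|(nu i)%:~R| <= FP_bound.
Proof. by rewrite /FP_bound (bigD1 i)//= lerDl sumr_ge0. Qed.

Lemma FP_sub_bounded (v w : L2) : FP nu v -> FP nu w ->
  {ae mu, forall x, `|(v - w)%R x| <= FP_bound *+ 2}.
Proof.
apply: filterS2 => x [i vi] [j wj].
rewrite -[(v - w)%R x]/(v x - w x) vi wj (le_trans (ler_normB _ _))//.
by rewrite mulr2n lerD//; exact: value_le_FP_bound.
Qed.

Lemma FP_norm1_sub_le (v w : L2) : FP nu v -> FP nu w ->
  norm1 (v - w) <= FP_bound *+ 2 * fine (mu setT).
Proof.
move=> vFP wFP; rewrite -Rintegral_cst_on; apply: le_Rintegral_ae.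
- by apply: integrable_norm; exact: L2_integrable.
- by apply: bounded_integrable => //; exists `|FP_bound *+ 2|.
- exact: FP_sub_bounded.
Qed.

Lemma ae_eq0_of_integral_le (f : R -> R) : integrable f ->
  (forall x, 0 <= f x) -> (forall e, 0 < e -> \int[mu]_x f x <= e) ->
  {ae mu, forall x, f x = 0}.
Proof.
move=> intf f0 fe.
have I0 : \int[mu]_x f x = 0.
  apply/eqP; rewrite eq_le Rintegral_ge0// andbT.
  by apply/ler_addgt0Pr => e e0; rewrite add0r; exact: fe.
have mf : measurable_fun setT (EFin \o f) by exact: measurable_int intf.
have : (\int[mu]_x `|(EFin \o f) x| = 0)%E.
  under eq_integral do rewrite /= ger0_norm//.
  by rewrite -[LHS]fineK ?integrable_fin_num//; congr EFin.
move/(ae_eq_integral_abs mu measurableT mf); apply: filterS => x /(_ I).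
by case.
Qed.

(** The product of the distances to the values, each truncated at 1, is at most
    [`|f x - w x|] whenever [w x] is one of the values; its integral is
    therefore zero for an L1 limit, and one of its factors vanishes a.e. *)
Lemma FP_closed (w : nat -> L2) (f : R -> R) : (forall n, FP nu (w n)) ->
  integrable f -> cvgL1 t0 tf (fun n => w n) f ->
  {ae mu, forall x, exists i, f x = (nu i)%:~R}.
Proof.
move=> wFP intf /cvgL1P -/(_ (fun n => L2_integrable (w n)) intf) wf.
pose D x := \prod_(i < M) Num.min 1 `|f x - (nu i)%:~R|.
have mf := integrable_measurable intf.
have D0 x : 0 <= D x by apply: prodr_ge0 => i _; rewrite le_min ler01 normr_ge0.
have D1 x : D x <= 1.
  by apply: prodr_ile1 => i _; rewrite le_min ler01/= normr_ge0 ge_min lexx.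
have mD : measurable_fun setT D.
  apply: measurable_prod => i _.
  have mi : measurable_fun setT (fun x => `|f x - (nu i)%:~R|).
    by apply: measurableT_comp => //; exact: measurable_funB.
  have m1 : measurable_fun setT (cst 1 : R -> R) by [].
  by have := measurable_minr m1 mi.
have intD : integrable D.
  by apply: bounded_integrable => //; exists 1 => x; rewrite ger0_norm.
have DI n : \int[mu]_x D x <= L1dist t0 tf (w n) f.
  apply: le_Rintegral_ae => //.
    by apply: integrable_norm; apply: integrable_sub => //; exact: L2_integrable.
  apply: filterS (wFP n) => x [i ->]; rewrite /D (bigD1 i)//= [leRHS]distrC.
  apply: (@le_trans _ _ (Num.min 1 `|f x - (nu i)%:~R|)); last first.
    by rewrite ge_min lexx orbT.
  apply: ler_piMr; first by rewrite le_min ler01 normr_ge0.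
  by apply: prodr_ile1 => j _; rewrite le_min ler01/= normr_ge0 ge_min lexx.
have := ae_eq0_of_integral_le intD D0; have DI0 e : 0 < e -> \int[mu]_x D x <= e.
  by move=> /wf[N /(_ N (leqnn N)) /ltW]; exact: le_trans.
move=> /(_ DI0); apply: filterS => x /eqP /prodf_eq0[i _ /eqP].
rewrite /Order.min; case: ifP => _ /eqP; first by rewrite oner_eq0.
by rewrite normr_eq0 subr_eq0 => /eqP fi; exists i.
Qed.

End FP_functions.

Section derivative_continuity.
Context {R : realType} (t0 tf : R) (M : nat) (nu : 'I_M -> int).
Local Notation mu := (lebesgue_on t0 tf).
Local Notation L2 := (L2 t0 tf).
Context (F : L2 -> R) (DF : L2 -> L2 -> R) (D2F : L2 -> L2 -> L2 -> R) (C : R).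
Hypothesis hF : twice_cont_frechet F DF D2F.
Hypothesis hC : forall xi u h : L2,
  (`|D2F xi u h|%:E <= C%:E * normL1 t0 tf u * normL1 t0 tf h)%E.
Hypothesis C0 : 0 < C.

(** Uniform in the competitor [w].  The L1 bound controls the change of the
    derivative, and the remaining term [DF u (v - u)] is controlled in L2, where
    differences of functions in [FP] are small once they are small in L1. *)
Lemma derivative_L1_continuous (u : L2) (e : R) : FP nu u -> 0 < e ->
  exists2 eta, 0 < eta & forall v : L2, FP nu v -> norm1 (v - u) < eta ->
    forall w, FP nu w -> `|DF v (v - w) - DF u (u - w)| <= e.
Proof.
move=> uFP e0; have [K K0 hK] := derivative_bounded hF u.
pose B : R := FP_bound (R := R) nu *+ 2; have B0 : 0 <= B.
  by rewrite mulrn_wge0// FP_bound_ge0.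
pose L : R := C * (B * fine (mu setT)).
have L0 : 0 <= L.
  by rewrite !mulr_ge0// ?(ltW C0)// fine_ge0.
have e2 : 0 < e / 2 by rewrite divr_gt0.
pose e1 := e / 2 / (1 + K); have e10 : 0 < e1 by rewrite divr_gt0// ltr_pwDl.
(* the first bound handles the change of the derivative, the second makes the
   L2 norm of [v - u] at most [e1] *)
exists (Num.min (e / 2 / (1 + L)) (e1 ^+ 2 / (1 + B))).
  by rewrite lt_min !divr_gt0// ?ltr_pwDl// exprn_gt0.
move=> v vFP; rewrite lt_min => /andP[v1 v2] w wFP.
have -> : DF v (v - w) - DF u (u - w) =
    (DF (u + (v - u)) (v - w) - DF u (v - w)) + DF u (v - u).
  have -> : u + (v - u) = v by rewrite addrC subrK.
  have <- : (v - w) - (u - w) = v - u by rewrite opprB addrA subrK.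
  by rewrite (derivativeD hF u (v - w)) (derivativeN hF u (u - w)) addrA subrK.
rewrite (le_trans (ler_normD _ _))// [leRHS](splitr e) lerD//.
  apply: le_trans (derivative_Lipschitz hF hC _ _ _) _.
  have vw : norm1 (v - w) <= B * fine (mu setT) := FP_norm1_sub_le vFP wFP.
  rewrite -mulrA mulrC -mulrA [X in _ * X]mulrC.
  apply: (@le_trans _ _ (norm1 (v - u) * L)).
    by rewrite ler_wpM2l ?norm1_ge0// ler_wpM2l// ltW.
  have p : 0 < 1 + L by rewrite ltr_pwDl.
  apply: le_trans (ler_wpM2r L0 (ltW v1)) _.
  by rewrite -[leLHS]mulrA ler_piMr ?(ltW e2)// [leLHS]mulrC ler_pdivrMr// mul1r lerDr.
apply: le_trans (hK _) _.
have n2 : norm2 (v - u) <= e1.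
  apply: (norm2_le B0 (FP_sub_bounded vFP uFP) (ltW e10)).
  have p : 0 < 1 + B by rewrite ltr_pwDl.
  apply: le_trans (ler_wpM2l B0 (ltW v2)) _.
  by rewrite mulrCA ler_piMr ?sqr_ge0// ler_pdivrMr// mul1r lerDr.
apply: le_trans (ler_wpM2l K0 n2) _.
have p : 0 < 1 + K by rewrite ltr_pwDl.
by rewrite /e1 mulrCA ler_piMr ?(ltW e2)// ler_pdivrMr// mul1r lerDr.
Qed.

End derivative_continuity.

(** * Charges as differences of finite measures *)

Section charges.
Context {R : realType} (t0 tf : R).
Hypothesis t0tf : t0 < tf.
Local Notation RR := (measurableTypeR R).
Local Notation Om := ([set` `]t0, tf[] : set RR).
Implicit Types (m : {measure set RR -> \bar R}).

Lemma measurable_Om : measurable Om. Proof. exact: measurable_itv. Qed.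

Lemma C0_measurable (phi : R -> R) : C0 t0 tf phi -> measurable_fun setT phi.
Proof. by move=> [cphi _]; exact: continuous_measurable_fun. Qed.

Lemma C0_integrable m (phi : R -> R) : (m setT < +oo)%E -> C0 t0 tf phi ->
  m.-integrable Om (EFin \o phi).
Proof.
move=> mfin Cphi; apply: (integrableS measurableT measurable_Om (@subsetT _ _)).
apply: measurable_bounded_integrable => //; first exact: C0_measurable.
exact/bounded_on_lineE/(C0_bounded Cphi).
Qed.

Lemma Rintegral_measure_add m1 m2 (phi : R -> R) :
  (m1 setT < +oo)%E -> (m2 setT < +oo)%E -> C0 t0 tf phi ->
  \int[measure_add m1 m2]_(x in Om) phi x =
    \int[m1]_(x in Om) phi x + \int[m2]_(x in Om) phi x.
Proof.
move=> fin1 fin2 Cphi.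
have i1 := C0_integrable fin1 Cphi; have i2 := C0_integrable fin2 Cphi.
rewrite /Rintegral (integral_measure_add measurable_Om i1 i2).
by rewrite fineD//; apply: integrable_fin_num => //; exact: measurable_Om.
Qed.

Lemma Rintegral_mscale_dirac (r : {nonneg R}) (t : R) (phi : R -> R) :
  C0 t0 tf phi ->
  \int[mscale r (@dirac _ RR t R)]_(x in Om) phi x = r%:num * phi t.
Proof.
move=> Cphi; have mO := measurable_Om.
have mphi : measurable_fun Om (EFin \o phi).
  by apply/measurable_EFinP; apply: measurable_funTS; exact: C0_measurable.
have mp := measurable_funepos mphi; have mn := measurable_funeneg mphi.
rewrite /Rintegral integralE !ge0_integral_mscale//.
rewrite !integral_dirac// /dirac indicE.
have [tO|tO] := boolP (t \in Om); last first.
  case: Cphi => _ -> /=; last by apply: contra tO => h; rewrite inE.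
  by rewrite /= !mul0e !mule0 sube0 mulr0.
rewrite !funeposE !funenegE /= !mul1e -!EFin_max -!EFinM /=.
rewrite -mulrBr; congr (_ * _); rewrite /Order.max; case: ifPn; case: ifPn;
  rewrite -?leNgt => h1 h2; lra.
Qed.

(** The integral does not depend on the choice of a decomposition into finite
    measures: if [p - n = m1 - m2], then [p + m2] and [m1 + n] are the same
    measure. *)
Lemma charge_integral_diff (nu : {charge set RR -> \bar R}) m1 m2 (phi : R -> R) :
  (m1 setT < +oo)%E -> (m2 setT < +oo)%E -> C0 t0 tf phi ->
  (forall A, measurable A -> nu A = (m1 A - m2 A)%E) ->
  charge_integral t0 tf nu phi =
    \int[m1]_(x in Om) phi x - \int[m2]_(x in Om) phi x.
Proof.
move=> fin1 fin2 Cphi nuE; rewrite /charge_integral.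
pose nuPN := projT2 (cid (projT2 (cid (Hahn_decomposition nu)))).
set p : {measure set RR -> \bar R} := jordan_pos nuPN.
set n : {measure set RR -> \bar R} := jordan_neg nuPN.
have finp : (p setT < +oo)%E.
  by rewrite ltey_eq; apply/orP; left; apply: fin_num_measure.
have finn : (n setT < +oo)%E.
  by rewrite ltey_eq; apply/orP; left; apply: fin_num_measure.
suff : \int[measure_add p m2]_(x in Om) phi x =
    \int[measure_add m1 n]_(x in Om) phi x.
  rewrite !Rintegral_measure_add// => h; apply/eqP.
  rewrite subr_eq addrAC eq_sym subr_eq; apply/eqP; exact: esym h.
rewrite /Rintegral; congr fine; apply: eq_measure_integral => A mA _.
have finA (m : {measure set RR -> \bar R}) : (m setT < +oo)%E -> m A \is a fin_num.
  move=> fm; rewrite ge0_fin_numE//; apply: le_lt_trans fm.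
  by apply: le_measure; rewrite ?inE.
have := jordan_decomp nuPN mA; rewrite nuE// /cadd /= cscaleN1 => h.
rewrite [LHS]measure_addE [RHS]measure_addE.
have {}h : (m1 A - m2 A = p A - n A)%E by exact: h.
move: h (finA _ fin1) (finA _ fin2) (finA _ finp) (finA _ finn).
case: (m1 A) (m2 A) (p A) (n A) => [a| |] [b| |] [c| |] [e| |]// [h] _ _ _ _.
by rewrite -!EFinD; congr EFin; lra.
Qed.

End charges.

(** * Derivatives of jump functions, and subsequences *)

Section jump_charges.
Context {R : realType} (t0 tf : R).
Hypothesis t0tf : t0 < tf.
Local Notation RR := (measurableTypeR R).
Local Notation Om := ([set` `]t0, tf[] : set RR).

Definition dirac_charge (t : R) : {charge set RR -> \bar R} :=
  charge_of_finite_measure (@dirac _ RR t R).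

(** The distributional derivative of [jump_function]. *)
Fixpoint jump_charge (t d : nat -> R) (K : nat) : {charge set RR -> \bar R} :=
  if K is n.+1 then cadd (jump_charge t d n) (cscale (d n) (dirac_charge (t n)))
  else czero.

Lemma mscale_dirac_lty (r : {nonneg R}) (t : R) :
  (mscale r (@dirac _ RR t R) setT < +oo)%E.
Proof. by rewrite /mscale/= diracT mule1 ltry. Qed.

Lemma measure_add_lty (m1 m2 : {measure set RR -> \bar R}) :
  (m1 setT < +oo)%E -> (m2 setT < +oo)%E -> (measure_add m1 m2 setT < +oo)%E.
Proof. by move=> h1 h2; rewrite measure_addE lte_add_pinfty. Qed.

(** Positive and negative jumps are collected in two finite measures.  Dirac
    masses outside the open interval are invisible to functions that vanish
    there. *)
Lemma charge_integral_jump_charge (t d : nat -> R) (K : nat) (phi : R -> R) :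
  C0 t0 tf phi ->
  charge_integral t0 tf (jump_charge t d K) phi = \sum_(i < K) d i * phi (t i).
Proof.
move=> Cphi.
suff [m1 [m2 [fin1 fin2 nuE ->]]] : exists m1 m2 : {measure set RR -> \bar R},
    [/\ (m1 setT < +oo)%E, (m2 setT < +oo)%E,
      forall A, measurable A -> jump_charge t d K A = (m1 A - m2 A)%E &
      \sum_(i < K) d i * phi (t i) =
      \int[m1]_(x in Om) phi x - \int[m2]_(x in Om) phi x].
  exact: charge_integral_diff.
elim: K => [|K [m1 [m2 [fin1 fin2 nuE phiE]]]].
  have fin0 : ((mzero : {measure set RR -> \bar R}) setT < +oo)%E.
    by rewrite /mzero ltry.
  exists mzero, mzero; split => //= [A mA|].
    by rewrite /czero /mzero sube0.
  by rewrite big_ord0 subrr.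
have finA (m : {measure set RR -> \bar R}) A : (m setT < +oo)%E ->
    measurable A -> m A \is a fin_num.
  move=> fm mA; rewrite ge0_fin_numE//; apply: le_lt_trans fm.
  by apply: le_measure; rewrite ?inE.
have step_charge A : jump_charge t d K.+1 A =
    (jump_charge t d K A + (d K * (t K \in A)%:R)%:E)%E by [].
have [dK|dK] := leP 0 (d K).
  pose r : {nonneg R} := NngNum dK.
  have mE A : mscale r (@dirac _ RR (t K) R) A = (d K * (t K \in A)%:R)%:E by [].
  have finr := mscale_dirac_lty r (t K).
  exists (measure_add m1 (mscale r (@dirac _ RR (t K) R))), m2; split => //.
  - exact: measure_add_lty.
  - move=> A mA; rewrite step_charge nuE//.
    rewrite [X in (_ = X - _)%E]measure_addE.
    move: (finA _ _ fin1 mA) (finA _ _ fin2 mA).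
    case: (m1 A) (m2 A) => [a| |] [b| |]// _ _.
    by rewrite [X in (_ + X - _)%E]mE -!EFinD; congr EFin; rewrite /=; ring.
  - rewrite big_ord_recr/= phiE Rintegral_measure_add// Rintegral_mscale_dirac//=.
    by rewrite addrAC.
have dK' : 0 <= - d K by rewrite oppr_ge0 ltW.
pose r : {nonneg R} := NngNum dK'.
have mE A : mscale r (@dirac _ RR (t K) R) A = (- d K * (t K \in A)%:R)%:E by [].
have finr := mscale_dirac_lty r (t K).
exists m1, (measure_add m2 (mscale r (@dirac _ RR (t K) R))); split => //.
- exact: measure_add_lty.
- move=> A mA; rewrite step_charge nuE//.
  rewrite [X in (_ = _ - X)%E]measure_addE.
  move: (finA _ _ fin1 mA) (finA _ _ fin2 mA).
  case: (m1 A) (m2 A) => [a| |] [b| |]// _ _.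
  by rewrite [X in (_ - (_ + X))%E]mE -!EFinD; congr EFin; rewrite /=; ring.
- rewrite big_ord_recr/= phiE Rintegral_measure_add// Rintegral_mscale_dirac//=.
  by rewrite mulNr opprD opprK addrA.
Qed.

Lemma distributional_derivative_jump_function (K : nat) (c : R)
    (t d : nat -> R) (f : R -> R) :
  (forall i, (i < K)%N -> t0 <= t i <= tf) -> measurable_fun setT f ->
  {ae lebesgue_on t0 tf, forall x, f x = jump_function K c t d x} ->
  distributional_derivative t0 tf f (jump_charge t d K).
Proof.
move=> tO mf fE phi Cphi.
rewrite charge_integral_jump_charge; last exact: C1c_C0.
rewrite -(integral_jump_function_derive t0tf c d tO Cphi).
have mp := C1c_derive_measurable Cphi.
apply: ae_eq_Rintegral_on.
- exact: measurable_funM.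
- by apply: measurable_funM => //; exact: measurable_jump_function.
- by apply: filterS fE => x ->.
Qed.

End jump_charges.

Section subsequences.
Context {R : realType}.

Lemma subsequence_ge (s : nat -> nat) : subsequence_index s ->
  forall n, (n <= s n)%N.
Proof.
by move=> sS; elim=> // n IH; apply: leq_ltn_trans IH _; exact: sS.
Qed.

Lemma subsequence_comp (s1 s2 : nat -> nat) : subsequence_index s1 ->
  subsequence_index s2 -> subsequence_index (s1 \o s2).
Proof. by move=> h1 h2 m n /h2 /h1. Qed.

Lemma cvg_subsequence (u : nat -> R) (l : R) (s : nat -> nat) :
  subsequence_index s -> u n @[n --> \oo] --> l -> u (s n) @[n --> \oo] --> l.
Proof.
move=> sS /cvgrPdist_lt ul; apply/cvgrPdist_lt => e /ul[N _ hN].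
by exists N => // n /= Nn; apply: hN => /=; exact: leq_trans Nn (subsequence_ge sS n).
Qed.

(** A cluster point exists by compactness; the indices are then chosen one after
    the other. *)
Lemma Bolzano_Weierstrass (u : nat -> R) (B : R) : (forall n, `|u n| <= B) ->
  exists2 s, subsequence_index s & exists l : R, u (s n) @[n --> \oo] --> l.
Proof.
move=> uB.
have [l [_ lcl]] : ([set` `[- B, B]] : set R) `&` cluster (u @ \oo) !=set0.
  apply: (@segment_compact _ (- B) B); exists 0%N => // n _ /=.
  by rewrite in_itv/= -ler_norml.
have next N k : exists n, (N < n)%N && (`|l - u n| < k.+1%:R^-1).
  have [] := lcl [set u n | n in [set n | (N < n)%N]] (ball l k.+1%:R^-1).
  - by exists N.+1 => // n /= Nn; exists n.
  - by apply: nbhsx_ballx; rewrite invr_gt0 ltr0n.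
  - by move=> _ [[n /= Nn <-] h]; exists n; rewrite Nn.
pose nx N k := projT1 (cid (next N k)).
have nxP N k : (N < nx N k)%N /\ `|l - u (nx N k)| < k.+1%:R^-1.
  by apply/andP; rewrite /nx; case: cid.
pose s := fix s k := if k is j.+1 then nx (s j) j.+1 else nx 0%N 0%N.
have sS : subsequence_index s.
  by apply: homo_ltn => [a b c|k]; [exact: ltn_trans|exact: (nxP (s k) k.+1).1].
exists s => //; exists l; apply/cvgrPdist_lt => e e0.
have sl k : `|l - u (s k)| < k.+1%:R^-1.
  by case: k => [|k]; [exact: (nxP 0%N 0%N).2|exact: (nxP (s k) k.+1).2].
near=> n; apply: lt_trans (sl n) _.
by near: n; exact: (near_infty_natSinv_lt (PosNum e0)).
Unshelve. all: by end_near. Qed.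

Lemma Bolzano_Weierstrass_family (K : nat) (u : nat -> nat -> R) (B : R) :
  (forall i n, (i < K)%N -> `|u i n| <= B) ->
  exists2 s, subsequence_index s &
    forall i, (i < K)%N -> exists l : R, u i (s n) @[n --> \oo] --> l.
Proof.
elim: K => [|K IH] uB; first by exists id.
have [|s sS sl] := IH; first by move=> i n iK; apply: uB; exact: ltnW.
have [|s' s'S [l' s'l]] := @Bolzano_Weierstrass (u K \o s) B.
  by move=> n; exact: uB.
exists (s \o s'); first exact: subsequence_comp.
move=> i; rewrite ltnS leq_eqVlt => /predU1P[->|iK]; first by exists l'.
have [l il] := sl i iK; exists l.
exact: (cvg_subsequence s'S il).
Qed.

End subsequences.

(** * Weak-* compactness *)

Section jump_convergence.
Context {R : realType} (t0 tf : R).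
Hypothesis t0tf : t0 < tf.
Context (M : nat) (nu : 'I_M -> int).
Local Notation mu := (lebesgue_on t0 tf).
Local Notation TV := (TV t0 tf).
Local Notation L2 := (L2 t0 tf).
Local Notation integrable f := (mu.-integrable setT (EFin \o f)).

Lemma L1dist_jump_function_le (K : nat) (c c' : R) (t t' d d' : nat -> R) :
  L1dist t0 tf (jump_function K c t d) (jump_function K c' t' d') <=
  `|c - c'| * fine (mu setT) + \sum_(i < K)
    (`|d i - d' i| * fine (mu setT) + `|d' i| * `|t i - t' i|).
Proof.
elim: K => [|K IH].
  rewrite big_ord0 addr0 -Rintegral_cst_on /L1dist le_eqVlt; apply/orP; left.
  by apply/eqP/eq_Rintegral => x _; rewrite /jump_function !big_ord0 !addr0.
rewrite big_ord_recr/= addrA; apply: le_trans (lerD IH (lexx _)).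
have ij n e s p : integrable (jump_function n e s p) by exact: integrable_jump_function.
have id := integrable_norm (integrable_sub (ij K c t d) (ij K c' t' d')).
have is' : integrable (fun x => `|step_at (t K) x - step_at (t' K) x|).
  by apply: integrable_norm; apply: integrable_sub; exact: integrable_step_at.
have ics : integrable (cst `|d K - d' K| : R -> R).
  by apply: bounded_integrable => //; exists `|d K - d' K| => x; rewrite normr_id.
have izs := integrableZl measurableT `|d' K| is'.
have isum := integrable_add ics izs.
apply: (@le_trans _ _ (L1dist t0 tf (jump_function K c t d) (jump_function K c' t' d') +
   \int[mu]_x (`|d K - d' K| + `|d' K| * `|step_at (t K) x - step_at (t' K) x|))).
  rewrite /L1dist -RintegralD//; apply: le_Rintegral => //.
  - by apply: integrable_norm; apply: integrable_sub.
  - exact: (integrable_add id isum).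
  - move=> x _; rewrite /jump_function !big_ord_recr/=.
    set S := \sum_(_ < _) _; set S' := \sum_(_ < _) _.
    have -> : c + (S + d K * step_at (t K) x) - (c' + (S' + d' K * step_at (t' K) x)) =
      (c + S - (c' + S')) + ((d K - d' K) * step_at (t K) x +
        d' K * (step_at (t K) x - step_at (t' K) x)) by ring.
    apply: le_trans (ler_normD _ _) _; rewrite lerD2l.
    apply: le_trans (ler_normD _ _) _; rewrite !normrM lerD2r ler_piMr//.
    by rewrite /step_at; case: (t K <= x); rewrite /= ?normr1 ?normr0 ?ler01.
rewrite lerD2l RintegralD// Rintegral_cst_on lerD2l RintegralZl// ler_wpM2l//.
exact: L1dist_step_at_le.
Qed.

(** A number of jumps common to a whole sequence is obtained by padding with
    jumps of size zero. *)
Lemma FP_jump_function (v : L2) (K : nat) : FP nu v -> (TV v <= (K%:R)%:E)%E ->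
  exists c (t d : nat -> R), [/\ `|c| <= FP_bound nu,
    forall i, t0 <= t i <= tf, forall i, `|d i| <= FP_bound nu *+ 2 &
    {ae mu, forall x, v x = jump_function K c t d x}].
Proof.
move=> vFP TVK.
have TVv : (TV v < +oo)%E by exact: le_lt_trans TVK (ltry _).
have [m [t [a [[m0 [t0E tfE] tS [ain ane] vE] suma]]]] := FP_structure t0tf vFP TVv.
have aB i : (1 <= i <= m)%N -> `|(a i)%:~R : R| <= FP_bound nu.
  by move=> /ain[j ->]; exact: value_le_FP_bound.
have mK : (m.-1 <= K)%N.
  rewrite -(ler_nat R) -lee_fin; apply: le_trans TVK; apply: le_trans suma.
  rewrite lee_fin -[X in X%:R]card_ord -sum1_card natr_sum; apply: ler_sum => i _.
  have im : (i.+1 < m)%N by have := ltn_ord i; rewrite ltn_predRL.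
  rewrite -intrB -intr_norm ler1z -gtz0_ge1 normr_gt0 subr_eq0 eq_sym.
  exact: ane.
pose d i : R := if (i < m.-1)%N then (a i.+2)%:~R - (a i.+1)%:~R else 0.
pose t' i := if (i < m.-1)%N then t i.+1 else t0.
exists (a 1%N)%:~R, t', d; split.
- by apply: aB.
- move=> i; rewrite /t'; case: ifP => [|_]; last by rewrite lexx ltW.
  rewrite ltn_predRL => im; rewrite -[X in X <= _ <= _]t0E -[X in _ <= _ <= X]tfE.
  apply/andP; split; apply: ltW; apply: (mono_steps tS) => /=; first exact: ltnW.
  by rewrite im leqnn.
- move=> i; rewrite /d; case: ifP => [|_]; last first.
    by rewrite normr0 mulrn_wge0// FP_bound_ge0.
  rewrite ltn_predRL => im; rewrite mulr2n (le_trans (ler_normB _ _))// lerD//.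
    exact: aB.
  by apply: aB; rewrite /= ltnW.
- have aeO : {ae mu, forall y, t0 < y < tf} by apply: ae_lebesgue_on; apply: aeW.
  apply: filterS2 vE aeO => x -> xO; rewrite step_function_jump ?t0E ?tfE//.
  rewrite /jump_function; congr (_ + _).
  rewrite (big_ord_widen _
    (fun i => ((a i.+2)%:~R - (a i.+1)%:~R) * step_at (t i.+1) x) mK).
  rewrite big_mkcond/=; apply: eq_bigr => i _; rewrite /d /t'.
  by case: ifP => _; rewrite ?mul0r.
Qed.

Lemma L1dist_ae (f g h : R -> R) : measurable_fun setT f -> measurable_fun setT g ->
  measurable_fun setT h -> {ae mu, forall x, f x = g x} ->
  L1dist t0 tf f h = L1dist t0 tf g h.
Proof.
move=> mf mg mh fg; apply: ae_eq_Rintegral_on.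
- by apply: measurableT_comp => //; exact: measurable_funB.
- by apply: measurableT_comp => //; exact: measurable_funB.
- by apply: filterS fg => x ->.
Qed.

(** Constants, sizes and positions of [K] jumps are finitely many bounded real
    sequences, which converge along a common subsequence.  Jumps that merge or
    reach the boundary in the limit do no harm, since the pairing with a test
    function is continuous in the positions and vanishes at the boundary. *)
Lemma weakstar_compactness (v : nat -> L2) (K : nat) :
  (forall n, FP nu (v n)) -> (forall n, (TV (v n) <= (K%:R)%:E)%E) ->
  exists f, weakstar_accumulation t0 tf (fun n => v n) f.
Proof.
move=> vFP TVK.
have /choice[c hc] n := FP_jump_function (vFP n) (TVK n).
have /choice[t ht] := hc; have /choice[d hd] := ht.
have cB n : `|c n| <= FP_bound nu by have [] := hd n.
have tB n i : t0 <= t n i <= tf by have [_ h _ _] := hd n; exact: h.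
have dB n i : `|d n i| <= FP_bound nu *+ 2 by have [_ _ h _] := hd n; exact: h.
have vE n : {ae mu, forall x, v n x = jump_function K (c n) (t n) (d n) x}.
  by have [] := hd n.
have [s1 s1S [cl cvgc]] := Bolzano_Weierstrass cB.
have tB' n i : `|t n i| <= `|t0| + `|tf|.
  have /andP[h1 h2] := tB n i; rewrite ler_norml; apply/andP; split.
    rewrite (le_trans _ h1)// lerNl (le_trans (ler_norm _))// normrN lerDl//.
  by rewrite (le_trans h2)// (le_trans (ler_norm _))// lerDr.
have [|s2 s2S cvgt] := @Bolzano_Weierstrass_family R K (fun i n => t (s1 n) i)
  (`|t0| + `|tf|); first by move=> i n _; exact: tB'.
have [|s3 s3S cvgd] := @Bolzano_Weierstrass_family R K (fun i n => d (s1 (s2 n)) i)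
  (FP_bound nu *+ 2); first by move=> i n _; exact: dB.
pose s := s1 \o (s2 \o s3).
have sS : subsequence_index s.
  by apply: subsequence_comp => //; exact: subsequence_comp.
have /choice[tl htl] i : exists l : R, (i < K)%N -> t (s n) i @[n --> \oo] --> l.
  case: (ltnP i K) => [iK|_]; last by exists 0.
  by have [l hl] := cvgt i iK; exists l => _; exact: (cvg_subsequence s3S hl).
have /choice[dl hdl] i : exists l : R, (i < K)%N -> d (s n) i @[n --> \oo] --> l.
  case: (ltnP i K) => [iK|_]; last by exists 0.
  by have [l hl] := cvgd i iK; exists l => _; exact: hl.
have hcl : c (s n) @[n --> \oo] --> cl.
  exact: (cvg_subsequence (subsequence_comp s2S s3S) cvgc).
have tlO i : (i < K)%N -> t0 <= tl i <= tf.
  move=> iK; have h := htl i iK; rewrite -(cvg_lim (@Rhausdorff R) h).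
  have ch : cvgn (fun n => t (s n) i) by apply/cvg_ex; exists (tl i).
  apply/andP; split; [apply: limr_ge|apply: limr_le] => //; apply: nearW => n;
    by have /andP[] := tB (s n) i.
pose f := jump_function K cl tl dl.
have intf : integrable f := @integrable_jump_function _ _ _ K cl tl dl.
have mj n e p q : measurable_fun setT (@jump_function R n e p q).
  exact: measurable_jump_function.
have BVv n : BV t0 tf (v n).
  split; first exact/Lfun1_integrable/L2_integrable.
  exact: le_lt_trans (TVK n) (ltry _).
have BVf : BV t0 tf f.
  split; first exact/Lfun1_integrable.
  by apply: le_lt_trans (ltry _); apply: TV_jump_function_le.
exists f, s => //; split => //; first by move=> n; exact: BVv.
  apply/(cvgL1P (fun n => L2_integrable (v (s n))) intf) => e e0.
  pose D n := `|c (s n) - cl| * fine (mu setT) + \sum_(i < K)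
    (`|d (s n) i - dl i| * fine (mu setT) + `|dl i| * `|t (s n) i - tl i|).
  have D0 : D n @[n --> \oo] --> 0.
    have nl (u : nat -> R) l : u n @[n --> \oo] --> l -> `|u n - l| @[n --> \oo] --> 0.
      move=> ul; rewrite -(normr0 R); apply: cvg_norm; rewrite -(subrr l).
      by apply: cvgB => //; exact: cvg_cst.
    rewrite -[X in _ --> X](_ : 0 * fine (mu setT) +
      \sum_(i < K) (0 * fine (mu setT) + `|dl i| * 0) = 0); last first.
      by rewrite mul0r add0r big1// => i _; rewrite mulr0 addr0.
    apply: cvgD; first by apply: cvgMl; exact: nl.
    apply: cvg_sum_ord => i; apply: cvgD; first by apply: cvgMl; apply: nl; exact: hdl.
    by apply: cvgMr; apply: nl; exact: htl.
  move/cvgrPdist_lt : D0 => /(_ e e0)[N _ hN]; exists N => n Nn.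
  have -> : L1dist t0 tf (v (s n)) f =
      L1dist t0 tf (jump_function K (c (s n)) (t (s n)) (d (s n))) f.
    by apply: L1dist_ae; [exact: L2_measurable|exact: mj|exact: mj|exact: vE].
  apply: le_lt_trans (L1dist_jump_function_le _ _ _ _ _ _ _) _.
  have := hN n Nn; rewrite sub0r normrN => h; apply: le_lt_trans h; exact: ler_norm.
exists (fun n => jump_charge (t (s n)) (d (s n)) K), (jump_charge tl dl K); split.
- move=> n; apply: (distributional_derivative_jump_function t0tf (c := c (s n))).
  + by move=> i _; exact: tB.
  + exact: L2_measurable.
  + exact: vE.
- apply: (distributional_derivative_jump_function t0tf (c := cl)).
  + exact: tlO.
  + exact: mj.
  + by apply: filterE => x.
- move=> phi Cphi; rewrite charge_integral_jump_charge//.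
  under eq_fun do rewrite charge_integral_jump_charge//.
  apply: cvg_sum_ord => i; apply: cvgM; first exact: hdl.
  case: (Cphi) => cphi _.
  by apply: (cvg_comp _ _ (htl i (ltn_ord i))); exact: cphi.
Qed.

End jump_convergence.

(** * Predicted and actual reduction *)

Section reductions.
Context {R : realType} (t0 tf : R) (M : nat) (nu : 'I_M -> int) (alpha : R).
Context (F : L2 t0 tf -> R) (DF : L2 t0 tf -> L2 t0 tf -> R)
  (D2F : L2 t0 tf -> L2 t0 tf -> L2 t0 tf -> R)
  (gradF : L2 t0 tf -> L2 t0 tf) (C : R).
Hypothesis t0tf : t0 < tf.
Hypothesis alpha_gt0 : 0 < alpha.
Hypothesis hF : twice_cont_frechet F DF D2F.
Hypothesis riesz : riesz_gradient DF gradF.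
Hypothesis C_gt0 : 0 < C.
Hypothesis hC : forall xi u h : L2 t0 tf,
  (`|D2F xi u h|%:E <= C%:E * normL1 t0 tf u * normL1 t0 tf h)%E.
Local Notation TV := (TV t0 tf).
Local Notation L2 := (L2 t0 tf).
Implicit Types u v w : L2.

Definition tv (v : L2) : R := fine (TV v).

Definition admissible (v : L2) := FP nu v /\ (TV v < +oo)%E.

Lemma tvE v : (TV v < +oo)%E -> TV v = (tv v)%:E.
Proof. by move=> fv; rewrite fineK// ge0_fin_numE// TV_ge0. Qed.

Definition predR (v w : L2) : R := DF v (v - w) + alpha * tv v - alpha * tv w.

Definition aredR (v w : L2) : R := F v + alpha * tv v - F w - alpha * tv w.

Lemma predE v w : (TV v < +oo)%E -> (TV w < +oo)%E ->
  predicted_reduction alpha gradF v w = (predR v w)%:E.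
Proof. by move=> fv fw; rewrite /predicted_reduction (tvE fv) (tvE fw) -riesz. Qed.

Lemma aredE v w : (TV v < +oo)%E -> (TV w < +oo)%E ->
  actual_reduction alpha F v w = (aredR v w)%:E.
Proof. by move=> fv fw; rewrite /actual_reduction (tvE fv) (tvE fw). Qed.

Lemma TR_objectiveE v w : (TV v < +oo)%E -> (TV w < +oo)%E ->
  TR_objective alpha v (gradF v) w = (- predR v w)%:E.
Proof.
move=> fv fw; rewrite /TR_objective (tvE fv) (tvE fw) -riesz.
transitivity (DF v (w - v) + alpha * tv w - alpha * tv v)%:E; first by [].
by congr EFin; rewrite /predR -[w - v]opprB (derivativeN hF); ring.
Qed.

Lemma pred_refl v : predR v v = 0.
Proof. by rewrite /predR subrr -(subrr v) (derivativeD hF) (derivativeN hF); ring. Qed.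

(** The model error of [Taylor_L1]; the variation terms cancel exactly. *)
Lemma ared_ge v w : predR v w - C * norm1 (w - v) ^+ 2 <= aredR v w.
Proof.
have := Taylor_L1 hF hC C_gt0 v (w - v).
have -> : v + (w - v) = w by rewrite addrC subrK.
rewrite ler_norml => /andP[_]; rewrite /predR /aredR -[w - v]opprB (derivativeN hF).
by rewrite opprB; lra.
Qed.

(** A solution has finite variation because [v] itself is feasible with value
    zero. *)
Lemma TR_solutionP v w Delta : admissible v -> 0 <= Delta ->
  TR_solution nu alpha v (gradF v) Delta w ->
  [/\ admissible w, norm1 (w - v) <= Delta &
    forall w', admissible w' -> norm1 (w' - v) <= Delta ->
      predR v w' <= predR v w].
Proof.
move=> [vFP fv] D0 [[wFP wD] wmin].
have vfeas : TR_feasible nu v Delta v.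
  split => //; rewrite subrr norm1E lee_fin (_ : norm1 0 = 0)//.
  by rewrite -(scale0r (0 : L2)) norm1Z normr0 mul0r.
have fw : (TV w < +oo)%E.
  rewrite ltey; apply/eqP => TVw; have := wmin v vfeas.
  rewrite [leRHS](TR_objectiveE fv fv) /TR_objective TVw gt0_muley ?lte_fin// (tvE fv).
  by rewrite -EFinM.
split => //; first by move: wD; rewrite norm1E lee_fin.
move=> w' [w'FP fw'] w'D; have := wmin w'.
rewrite (TR_objectiveE fv fw) (TR_objectiveE fv fw') lee_fin lerN2; apply.
by split => //; rewrite norm1E lee_fin.
Qed.

Lemma TR_solution_self v Delta : admissible v -> 0 <= Delta ->
  (forall w, admissible w -> norm1 (w - v) <= Delta -> predR v w <= 0) ->
  TR_solution nu alpha v (gradF v) Delta v.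
Proof.
move=> [vFP fv] D0 h; split.
  split => //; rewrite subrr norm1E lee_fin (_ : norm1 0 = 0)//.
  by rewrite -(scale0r (0 : L2)) norm1Z normr0 mul0r.
move=> w [wFP wD]; rewrite (TR_objectiveE fv fv) pred_refl oppr0.
have [TVw|] := eqVneq (TV w) +oo%E.
  rewrite /TR_objective TVw gt0_muley ?lte_fin// (tvE fv) -EFinM.
  by rewrite addey// addye// leey.
rewrite -ltey => fw; rewrite (TR_objectiveE fv fw) lee_fin oppr_ge0; apply: h => //.
by move: wD; rewrite norm1E lee_fin.
Qed.

Lemma descent_direction_pred v : admissible v ->
  descent_direction nu (gradF v) v ->
  exists2 c : R, 0 < c & exists2 h0 : R, 0 < h0 & forall h : R, 0 < h < h0 ->
    exists w : L2, [/\ admissible w, norm1 (w - v) <= h & c * h <= predR v w].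
Proof.
move=> [vFP fv] [c c0 [h0 h00 H]]; exists c => //; exists h0 => // h /H.
move=> [w [wFP TVw nw iw]]; exists w.
have fw : (TV w < +oo)%E := le_lt_trans TVw fv.
split => //; first by move: nw; rewrite norm1E lee_fin.
move: iw TVw; rewrite -riesz (tvE fv) (tvE fw) lee_fin -[w - v]opprB (derivativeN hF).
rewrite lerN2 => iw; rewrite -(ler_pM2l alpha_gt0) /predR; lra.
Qed.

Lemma TR_solution_L_stationary v Delta : admissible v -> 0 < Delta ->
  TR_solution nu alpha v (gradF v) Delta v -> L_stationary nu gradF v.
Proof.
move=> av D0 /(TR_solutionP av (ltW D0))[_ _ vmin]; case: (av) => vFP fv.
apply: L_stationary_of_no_descent => // /(descent_direction_pred av).
move=> [c c0 [h0 h00 H]]; pose h := Num.min h0 Delta / 2.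
have m0 : 0 < Num.min h0 Delta by rewrite lt_min h00.
have : (Num.min h0 Delta <= h0) && (Num.min h0 Delta <= Delta) by rewrite -le_min.
move=> /andP[m1 m2]; have [|w [aw wh ph]] := H h.
  by rewrite /h; apply/andP; split; lra.
have := vmin w aw; rewrite pred_refl => /(_ _)/(le_trans ph).
have hD : h <= Delta by rewrite /h; lra.
by move=> /(_ (le_trans wh hD)); apply/negP; rewrite -ltNge mulr_gt0//= /h; lra.
Qed.

(** Uniform in the competitor [w], because [w] enters the difference only
    through a uniformly small change of the derivative.  Lower semicontinuity
    of the variation gives the other term. *)
Lemma pred_lsc (v : nat -> L2) (u : L2) (e : R) : (forall n, admissible (v n)) ->
  admissible u -> cvgL1 t0 tf (fun n => v n) u -> 0 < e ->
  exists N, forall n w, (N <= n)%N -> admissible w -> predR u w - e <= predR (v n) w.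
Proof.
move=> av [uFP fu] vu e0; have e2 : 0 < e / 2 by rewrite divr_gt0.
have [eta eta0 heta] := derivative_L1_continuous hF hC C_gt0 uFP e2.
have vu' := (cvgL1P (fun n => L2_integrable (v n)) (L2_integrable u)).1 vu.
have [N1 hN1] := vu' eta eta0.
have lt : ((tv u - e / 2 / alpha)%:E < TV u)%E.
  by rewrite (tvE fu) lte_fin ltrBlDr ltrDl divr_gt0.
have [N2 hN2] := TV_lsc (fun n => L2_integrable (v n)) (L2_integrable u) vu lt.
exists (maxn N1 N2) => n w; rewrite geq_max => /andP[n1 n2] [wFP fw].
have [vFP fv] := av n.
have := heta (v n) vFP (hN1 n n1) w wFP; rewrite ler_norml => /andP[h1 _].
have := hN2 n n2; rewrite (tvE fv) lte_fin => h2.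
have : alpha * (tv u - e / 2 / alpha) <= alpha * tv (v n).
  by rewrite ler_pM2l// ltW.
rewrite mulrBr [alpha * (_ / _)]mulrC divfK ?gt_eqF// => h3.
rewrite /predR; lra.
Qed.

Lemma pred_limit_ge (v : nat -> L2) (u : L2) (e : R) : (forall n, admissible (v n)) ->
  admissible u -> cvgL1 t0 tf (fun n => v n) u -> 0 < e ->
  exists N, forall n, (N <= n)%N ->
    alpha * (tv (v n) - tv u) - e <= predR (v n) u.
Proof.
move=> av [uFP fu] vu e0.
have [eta eta0 heta] := derivative_L1_continuous hF hC C_gt0 uFP e0.
have vu' := (cvgL1P (fun n => L2_integrable (v n)) (L2_integrable u)).1 vu.
have [N hN] := vu' eta eta0; exists N => n Nn; have [vFP fv] := av n.
have := heta (v n) vFP (hN n Nn) u uFP; rewrite ler_norml => /andP[h1 _].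
have : DF u (u - u) = 0 by have := pred_refl u; rewrite /predR; lra.
move=> h2; rewrite /predR mulrBr; lra.
Qed.

End reductions.

(** * The trust-region algorithm *)

Section algorithm.
Context {R : realType} (t0 tf : R) (M : nat) (nu : 'I_M -> int) (alpha : R).
Context (F : L2 t0 tf -> R) (DF : L2 t0 tf -> L2 t0 tf -> R)
  (D2F : L2 t0 tf -> L2 t0 tf -> L2 t0 tf -> R)
  (gradF : L2 t0 tf -> L2 t0 tf) (C c Delta0 sigma : R)
  (v0 : L2 t0 tf) (v : nat -> L2 t0 tf) (w : nat -> nat -> L2 t0 tf).
Hypothesis t0tf : t0 < tf.
Hypothesis alpha_gt0 : 0 < alpha.
Hypothesis F_ge : forall u, c <= F u.
Hypothesis hF : twice_cont_frechet F DF D2F.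
Hypothesis riesz : riesz_gradient DF gradF.
Hypothesis C_gt0 : 0 < C.
Hypothesis hC : forall xi u h : L2 t0 tf,
  (`|D2F xi u h|%:E <= C%:E * normL1 t0 tf u * normL1 t0 tf h)%E.
Hypothesis Delta0_gt0 : 0 < Delta0.
Hypothesis sigma_gt0 : 0 < sigma.
Hypothesis sigma_lt1 : sigma < 1.
Hypothesis v0FP : FP nu v0.
Hypothesis v0BV : BV t0 tf v0.
Hypothesis run : SLIP_run nu alpha F gradF Delta0 sigma v0 v w.
Local Notation TV := (TV t0 tf).
Local Notation L2 := (L2 t0 tf).
Local Notation executed := (executed alpha F gradF sigma v w).
Local Notation produced := (produced alpha F gradF sigma v w).
Local Notation admissible := (admissible nu).
Local Notation predv := (predR alpha DF).
Local Notation aredv := (aredR alpha F).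
Local Notation radius := (Defs.radius Delta0).

Lemma radius_gt0 k : 0 < radius k.
Proof. by rewrite divr_gt0// exprn_gt0. Qed.

Lemma radius_decreasing k l : (k <= l)%N -> radius l <= radius k.
Proof.
move=> kl; rewrite /Defs.radius ler_pM2l// lef_pV2 ?posrE ?exprn_gt0//.
by rewrite ler_eXn2l// ltr1n.
Qed.

Lemma radius_small e : 0 < e -> exists k, radius k < e.
Proof.
move=> e0; have De : 0 <= Delta0 / e by rewrite divr_ge0 ?ltW.
exists (Num.Def.archi_bound (Delta0 / e)).
rewrite /Defs.radius ltr_pdivrMr ?exprn_gt0// -ltr_pdivrMl// mulrC.
apply: lt_trans (Num.Theory.archi_boundP De) _.
by rewrite -natrX ltr_nat ltn_expl.
Qed.

Lemma executed_gt0 n k : executed n k -> (0 < n)%N.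
Proof. by elim. Qed.

(** By induction on the run: each accepted iterate solves a trust-region problem
    and hence has finite variation. *)
Lemma executed_admissible n k : executed n k ->
  admissible (v n.-1) /\
  [/\ admissible (w n k), norm1 (w n k - v n.-1) <= radius k &
    forall w', admissible w' -> norm1 (w' - v n.-1) <= radius k ->
      predv (v n.-1) w' <= predv (v n.-1) (w n k)].
Proof.
case: run => v0E sol acc ex.
suff av : admissible (v n.-1).
  split => //; apply: (TR_solutionP t0tf alpha_gt0 hF riesz av).
    exact/ltW/radius_gt0.
  exact: sol.
elim: ex => [|//|{}n {}k ex av p0 pa] /=.
  by rewrite v0E; split => //; case: v0BV.
rewrite (acc _ _ ex p0 pa).
have := sol _ _ ex; case: (n) (executed_gt0 ex) av => // m _ /= av.
by move=> /(TR_solutionP t0tf alpha_gt0 hF riesz av (ltW (radius_gt0 k)))[].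
Qed.

Lemma executed_predE n k : executed n k ->
  predicted_reduction alpha gradF (v n.-1) (w n k) = (predv (v n.-1) (w n k))%:E.
Proof.
by move=> /executed_admissible[[_ fv] [[_ fw] _ _]]; apply: predE.
Qed.

Lemma executed_aredE n k : executed n k ->
  actual_reduction alpha F (v n.-1) (w n k) = (aredv (v n.-1) (w n k))%:E.
Proof.
by move=> /executed_admissible[[_ fv] [[_ fw] _ _]]; apply: aredE.
Qed.

Lemma executed_rejected n k : executed n k.+1 ->
  [/\ executed n k, 0 < predv (v n.-1) (w n k) &
    aredv (v n.-1) (w n k) < sigma * predv (v n.-1) (w n k)].
Proof.
move En : n => n'; move Ek : k.+1 => k' ex.
case: ex En Ek => [//|m l ex p0 pa En [Ek]|//]; subst m l; split => //.
  by move: p0; rewrite executed_predE// lte_fin.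
by move: pa; rewrite executed_predE// executed_aredE// -EFinM lte_fin.
Qed.

Lemma executed_le n k l : (k <= l)%N -> executed n l -> executed n k.
Proof.
move=> kl; rewrite -(subnK kl); elim: (l - k)%N => // m IH.
by rewrite addSn => /executed_rejected[/IH].
Qed.

Lemma produced_accepted n : produced n.+1 -> exists k,
  [/\ executed n.+1 k, v n.+1 = w n.+1 k, 0 < predv (v n) (w n.+1 k) &
    sigma * predv (v n) (w n.+1 k) <= aredv (v n) (w n.+1 k)].
Proof.
rewrite /Defs.produced; move En : n.+2 => n'; move Ek : 0%N => k' ex.
case: ex En Ek => [//|//|m l ex p0 pa [Em] _]; subst m; exists l; split => //.
- by case: run => _ _; apply.
- by move: p0; rewrite executed_predE// lte_fin.
- by move: pa; rewrite executed_predE// executed_aredE// -EFinM lee_fin.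
Qed.

Lemma produced_pred n : produced n.+1 -> produced n.
Proof. by move=> /produced_accepted[k [ex _ _ _]]; exact: executed_le ex. Qed.

Lemma produced_le m n : (m <= n)%N -> produced n -> produced m.
Proof.
move=> mn; rewrite -(subnK mn); elim: (n - m)%N => // k IH.
by rewrite addSn => /produced_pred /IH.
Qed.

Lemma produced_admissible n : produced n -> admissible (v n).
Proof. by move=> /executed_admissible[]. Qed.

Definition Jr (n : nat) : R := F (v n) + alpha * tv (v n).

Lemma J_Jr n : produced n -> J alpha F (v n) = (Jr n)%:E.
Proof. by move=> /produced_admissible[_ fv]; rewrite /J (tvE t0tf fv). Qed.

Lemma Jr_decrease n k : v n.+1 = w n.+1 k ->
  Jr n - Jr n.+1 = aredv (v n) (w n.+1 k).
Proof. by move=> <-; rewrite /Jr /aredR; ring. Qed.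

Lemma Jr_step n : produced n.+1 -> Jr n.+1 < Jr n.
Proof.
move=> /produced_accepted[k [ex vE p0 pa]].
rewrite -subr_gt0 (Jr_decrease vE); apply: lt_le_trans pa; exact: mulr_gt0.
Qed.

Lemma Jr_mono m n : (m < n)%N -> produced n -> Jr n < Jr m.
Proof.
elim: n => // n IH; rewrite ltnS leq_eqVlt => /predU1P[->|mn] pn.
  exact: Jr_step.
by apply: lt_trans (Jr_step pn) (IH mn (produced_pred pn)).
Qed.

Lemma Jr_mono_le m n : (m <= n)%N -> produced n -> Jr n <= Jr m.
Proof. by rewrite leq_eqVlt => /predU1P[->//|mn] /(Jr_mono mn)/ltW. Qed.

(** The step computed at radius [k] predicts at least [delta], and the quadratic
    error at this radius is too small for the actual reduction to fall below
    the fraction [sigma] of it. *)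
Lemma inner_loop_stops n k u delta : admissible u ->
  norm1 (u - v n) <= radius k -> delta <= predv (v n) u ->
  C * radius k ^+ 2 <= (1 - sigma) * delta -> ~ executed n.+1 k.+1.
Proof.
move=> au ur du Cr /executed_rejected[ex]; rewrite [n.+1.-1]/= => p0 pa.
have := executed_admissible ex; rewrite [n.+1.-1]/= => -[av [aw wr wmax]].
have up : delta <= predv (v n) (w n.+1 k) by rewrite (le_trans du)// wmax.
have := ared_ge alpha hF C_gt0 hC (v n) (w n.+1 k).
have : C * norm1 (w n.+1 k - v n) ^+ 2 <= C * radius k ^+ 2.
  by rewrite ler_pM2l// lerXn2r ?nnegrE ?norm1_ge0// ltW// radius_gt0.
have : (1 - sigma) * delta <= (1 - sigma) * predv (v n) (w n.+1 k).
  by rewrite ler_pM2l// subr_gt0.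
move: pa Cr {du ur up p0 wr wmax}.
move: (aredv _ _) (predv _ _) (C * norm1 _ ^+ 2) (C * radius k ^+ 2) => A P X Y.
lra.
Qed.

(** The step is accepted at radius [k] or at a larger one, where [u] is feasible
    as well. *)
Lemma sufficient_decrease n k u delta : produced n.+1 -> admissible u ->
  norm1 (u - v n) <= radius k -> delta <= predv (v n) u ->
  C * radius k ^+ 2 <= (1 - sigma) * delta -> sigma * delta <= Jr n - Jr n.+1.
Proof.
move=> /produced_accepted[l [ex vE p0 pa]] au ur du Cr.
have lk : (l <= k)%N.
  rewrite leqNgt; apply/negP => kl.
  exact: (inner_loop_stops au ur du Cr) (executed_le kl ex).
have := executed_admissible ex; rewrite [n.+1.-1]/= => -[_ [_ _ wmax]].
rewrite (Jr_decrease vE); apply: le_trans pa; rewrite ler_pM2l//.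
apply: le_trans du _; apply: wmax => //.
exact: le_trans ur (radius_decreasing lk).
Qed.

(** A descent direction has predicted reduction linear in the radius, while the
    model error is quadratic, so small radii would be accepted. *)
Lemma inner_loop_infinite_L_stationary n : (forall k, executed n.+1 k) ->
  L_stationary nu gradF (v n).
Proof.
move=> ex; have := executed_admissible (ex 0%N); rewrite [n.+1.-1]/= => -[av _].
case: (av) => vFP fv; apply: L_stationary_of_no_descent => //.
move=> /(descent_direction_pred t0tf alpha_gt0 hF riesz av)[e e0 [h0 h00 H]].
have se : 0 < (1 - sigma) * e by rewrite mulr_gt0// subr_gt0.
have [k kr] : exists k, radius k < Num.min h0 ((1 - sigma) * e / C).
  by apply: radius_small; rewrite lt_min h00 divr_gt0.
move: kr; rewrite lt_min => /andP[kh kC].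
have [|u [au ur up]] := H (radius k); first by rewrite radius_gt0.
apply: (inner_loop_stops au ur up) (ex k.+1).
have r0 := radius_gt0 k; move: (radius k) r0 kC => r r0; rewrite ltr_pdivlMr// => rC.
have : r * (r * C) <= r * ((1 - sigma) * e) by rewrite ler_pM2l// ltW.
rewrite expr2; lra.
Qed.

Lemma pred_le0_solution n k : executed n.+1 k ->
  (predicted_reduction alpha gradF (v n) (w n.+1 k) <= 0)%E ->
  TR_solution nu alpha (v n) (gradF (v n)) (radius k) (v n).
Proof.
move=> ex; have /= -> := executed_predE ex; rewrite lee_fin => p0.
have := executed_admissible ex; rewrite [n.+1.-1]/= => -[av [_ _ wmax]].
apply: (TR_solution_self t0tf alpha_gt0 hF riesz av); first exact/ltW/radius_gt0.
by move=> u au ur; apply: le_trans p0; exact: wmax.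
Qed.

(** At a radius below [Delta] the predicted reduction is nonpositive, so the
    step at that radius is not a rejected one. *)
Lemma solution_stops n Delta : 0 < Delta ->
  TR_solution nu alpha (v n) (gradF (v n)) Delta (v n) ->
  ~ (forall k, executed n.+1 k).
Proof.
move=> D0 vsol ex; have [k kD] := radius_small D0.
have := executed_rejected (ex k.+1); rewrite [n.+1.-1]/= => -[_ p0 _].
have := executed_admissible (ex k); rewrite [n.+1.-1]/= => -[av [aw wr _]].
have [_ _ vmax] := TR_solutionP t0tf alpha_gt0 hF riesz av (ltW D0) vsol.
have := vmax _ aw (le_trans wr (ltW kD)).
by rewrite (pred_refl alpha hF) leNgt p0.
Qed.

Section infinite_run.
Hypothesis all_produced : forall n, produced n.

Let av n : admissible (v n). Proof. exact: produced_admissible. Qed.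

(** The objective values decrease and are bounded below. *)
Lemma small_decrease e : 0 < e -> exists N, forall n, (N <= n)%N ->
  Jr n - Jr n.+1 < e.
Proof.
move=> e0; have hi : has_inf (range Jr).
  split; first by exists (Jr 0%N), 0%N.
  exists c => _ [n _ <-]; rewrite /Jr (le_trans (F_ge (v n)))// lerDl.
  by rewrite mulr_ge0 ?(ltW alpha_gt0)// fine_ge0// TV_ge0.
have [_ [N _ <-] JN] := inf_adherent e0 hi; exists N => n Nn.
have : inf (range Jr) <= Jr n.+1 by apply: ge_inf; [case: hi|exists n.+1].
have := Jr_mono_le Nn (all_produced n); lra.
Qed.

Lemma TV_bounded : exists K : nat, forall n, (TV (v n) <= (K%:R)%:E)%E.
Proof.
pose B := (Jr 0%N - c) / alpha.
exists (Num.Def.archi_bound B) => n; have [_ fv] := av n.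
rewrite (tvE t0tf fv) lee_fin.
have tB : tv (v n) <= B.
  rewrite ler_pdivlMr// mulrC; have := Jr_mono_le (leq0n n) (all_produced n).
  by have := F_ge (v n); rewrite /Jr; lra.
apply: (le_trans tB); apply: ltW; apply: Num.Theory.archi_boundP.
by apply: le_trans tB; rewrite fine_ge0// TV_ge0.
Qed.

Lemma exists_accumulation :
  exists f, weakstar_accumulation t0 tf (fun n => v n) f.
Proof.
have [K TVK] := TV_bounded.
by apply: (weakstar_compactness t0tf (nu := nu)) TVK => n; case: (av n).
Qed.

Lemma accumulation_admissible s f : subsequence_index s ->
  weakstar_cvg t0 tf (fun n => v (s n)) f ->
  exists2 u : L2, (u : R -> R) = f &
    admissible u /\ cvgL1 t0 tf (fun n => v (s n)) u.
Proof.
move=> sS [_ [fL1 TVf] vf _]; have intf := (Lfun1_integrable _ _).1 fL1.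
have sFP n : FP nu (v (s n)) by case: (av (s n)).
have fFP := FP_closed sFP intf vf.
have fB : {ae lebesgue_on t0 tf, forall x, `|f x| <= FP_bound nu}.
  by apply: filterS fFP => x [i ->]; exact: value_le_FP_bound.
have [u uE] := ae_bounded_L2 (FP_bound_ge0 nu) intf fB.
by exists u => //; split; [split; rewrite /FP uE|rewrite uE].
Qed.

Context (s : nat -> nat) (u : L2).
Hypothesis sS : subsequence_index s.
Hypothesis au : admissible u.
Hypothesis vu : cvgL1 t0 tf (fun n => v (s n)) u.

Let avs n : admissible (v (s n)). Proof. exact: av. Qed.

Let near_u e : 0 < e -> exists N, forall n, (N <= n)%N ->
  norm1 (u - v (s n)) < e.
Proof.
move=> e0; have := (cvgL1P (fun n => L2_integrable (v (s n))) (L2_integrable u)).1 vu.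
by move=> /(_ e e0)[N hN]; exists N => n /hN; rewrite norm1B L1distC.
Qed.

(** Otherwise [u] would be a competitor whose variation is smaller by [e], and
    the objective would drop by a fixed amount infinitely often. *)
Lemma TV_limsup e : 0 < e -> exists N, forall n, (N <= n)%N ->
  tv (v (s n)) <= tv u + e.
Proof.
move=> e0; have ae : 0 < alpha * e / 2 by rewrite divr_gt0// mulr_gt0.
have se : 0 < (1 - sigma) * (alpha * e / 2) by rewrite mulr_gt0// subr_gt0.
(* a radius below 1 dominates its own square *)
have [k kr] : exists k, radius k < Num.min 1 ((1 - sigma) * (alpha * e / 2) / C).
  by apply: radius_small; rewrite lt_min ltr01 divr_gt0.
move: kr; rewrite lt_min => /andP[k1 kC].
have [N1 hN1] := pred_limit_ge alpha hF C_gt0 hC avs au vu ae.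
have [N2 hN2] := near_u (radius_gt0 k).
have [N3 hN3] : exists N, forall n, (N <= n)%N -> Jr n - Jr n.+1 < sigma * (alpha * e / 2).
  by apply: small_decrease; exact: mulr_gt0.
exists (maxn N1 (maxn N2 N3)) => n; rewrite !geq_max => /and3P[n1 n2 n3].
rewrite leNgt; apply/negP => tve.
have := hN3 (s n) (leq_trans n3 (subsequence_ge sS n)); apply/negP; rewrite -leNgt.
apply: (sufficient_decrease (k := k) (all_produced _) au (ltW (hN2 n n2))).
  apply: le_trans (hN1 n n1).
  have : alpha * e <= alpha * (tv (v (s n)) - tv u).
    by rewrite ler_pM2l// lerBrDl ltW.
  by lra.
rewrite -ler_pdivlMl// mulrC; apply: le_trans (ltW kC).
by rewrite expr2 ler_piMr ?(ltW (radius_gt0 k))// ltW.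
Qed.

(** [TV_limsup] together with lower semicontinuity. *)
Lemma accumulation_strict : strict_cvg t0 tf (fun n => v (s n)) u.
Proof.
have BVa (x : L2) : admissible x -> BV t0 tf x.
  by case=> _ fx; split => //; exact/Lfun1_integrable/L2_integrable.
split => //; [by move=> n; exact: BVa|exact: BVa|].
case: (au) => _ fu; rewrite (tvE t0tf fu).
have -> : (fun n => TV (v (s n))) = (fun n => (tv (v (s n)))%:E).
  by apply/funext => n; have [_ fv] := avs n; rewrite (tvE t0tf fv).
apply: cvg_EFin; first by apply: nearW.
apply/cvgrPdist_le => e e0; have [N1 hN1] := TV_limsup e0.
have lt : ((tv u - e)%:E < TV u)%E by rewrite (tvE t0tf fu) lte_fin ltrBlDr ltrDl.
have [N2 hN2] := TV_lsc (fun n => L2_integrable (v (s n))) (L2_integrable u) vu lt.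
exists (maxn N1 N2) => // n /=; rewrite geq_max => /andP[n1 n2].
have := hN2 n n2; have [_ fv] := avs n; rewrite (tvE t0tf fv) lte_fin => h2.
have h1 := hN1 n n1; rewrite ler_norml; apply/andP; split; lra.
Qed.

(** A descent direction at [u] yields one competitor that is feasible at the
    iterates close to [u] and forces a fixed drop of the objective there. *)
Lemma accumulation_L_stationary : L_stationary nu gradF u.
Proof.
case: (au) => uFP fu; apply: L_stationary_of_no_descent => //.
move=> /(descent_direction_pred t0tf alpha_gt0 hF riesz au)[e e0 [h0 h00 H]].
have se : 0 < (1 - sigma) * e by rewrite mulr_gt0// subr_gt0.
have [k kr] : exists k, radius k < Num.min h0 ((1 - sigma) * e / 4 / C).
  by apply: radius_small; rewrite lt_min h00 !divr_gt0.
move: kr; rewrite lt_min => /andP[kh kC]; have r0 := radius_gt0 k.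
(* the competitor uses up one half of the radius, and the other half is left
   for the distance of the iterate to [u] *)
have [|x [ax xr xp]] := H (radius k / 2); first by apply/andP; split; lra.
have er : 0 < e * radius k / 4 by rewrite divr_gt0// mulr_gt0.
have r2 : 0 < radius k / 2 by rewrite divr_gt0.
have [N1 hN1] := pred_lsc t0tf alpha_gt0 hF C_gt0 hC avs au vu er.
have [N2 hN2] := near_u r2.
have [N3 hN3] : exists N, forall n, (N <= n)%N ->
    Jr n - Jr n.+1 < sigma * (e * radius k / 4).
  by apply: small_decrease; exact: mulr_gt0.
pose n := maxn N1 (maxn N2 N3).
have n1 : (N1 <= n)%N by rewrite leq_maxl.
have n2 : (N2 <= n)%N by rewrite leq_max leq_maxl orbT.
have n3 : (N3 <= n)%N by rewrite !leq_max leqnn !orbT.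
have := hN3 (s n) (leq_trans n3 (subsequence_ge sS n)); apply/negP; rewrite -leNgt.
have xn : norm1 (x - v (s n)) <= radius k.
  have := L1dist_triangle (L2_integrable x) (L2_integrable u) (L2_integrable (v (s n))).
  by have := hN2 n n2; move: xr; rewrite !norm1B; lra.
apply: (sufficient_decrease (all_produced _) ax xn).
  apply: le_trans (hN1 n x n1 ax); move: xp; lra.
move: kC; rewrite ltr_pdivlMr// => kC.
have : radius k * (radius k * C) <= radius k * ((1 - sigma) * e / 4).
  by rewrite ler_pM2l// ltW.
rewrite expr2; lra.
Qed.

(** Accepted steps have radius at least [r], so every point within [r / 2] of
    [u] is eventually a competitor for them; a better one would force a fixed
    drop of the objective infinitely often. *)
Lemma radii_bounded_solution (r : R) : 0 < r ->
  (exists N, forall n, (N <= n)%N -> forall k, executed (s n).+1 k -> r <= radius k) ->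
  TR_solution nu alpha u (gradF u) (r / 2) u.
Proof.
move=> r0 [N0 hN0]; have r2 : 0 < r / 2 by rewrite divr_gt0.
apply: (TR_solution_self t0tf alpha_gt0 hF riesz au); first exact: ltW.
move=> x ax xr; rewrite leNgt; apply/negP => p0.
have p2 : 0 < predv u x / 2 by rewrite divr_gt0.
have [N1 hN1] := pred_lsc t0tf alpha_gt0 hF C_gt0 hC avs au vu p2.
have [N2 hN2] := near_u r2.
have [N3 hN3] : exists N, forall n, (N <= n)%N ->
    Jr n - Jr n.+1 < sigma * (predv u x / 2).
  by apply: small_decrease; exact: mulr_gt0.
pose n := maxn N0 (maxn N1 (maxn N2 N3)).
have n0 : (N0 <= n)%N by rewrite leq_maxl.
have n1 : (N1 <= n)%N by rewrite !leq_max leqnn !orbT.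
have n2 : (N2 <= n)%N by rewrite !leq_max leqnn !orbT.
have n3 : (N3 <= n)%N by rewrite !leq_max leqnn !orbT.
have := hN3 (s n) (leq_trans n3 (subsequence_ge sS n)); apply/negP; rewrite -leNgt.
have [k [ex vE q0 qa]] := produced_accepted (all_produced (s n).+1).
have := executed_admissible ex; rewrite [(s n).+1.-1]/= => -[_ [_ _ wmax]].
rewrite (Jr_decrease vE); apply: le_trans qa; rewrite ler_pM2l//.
apply: (@le_trans _ _ (predv (v (s n)) x)).
  by apply: le_trans (hN1 n x n1 ax); lra.
apply: wmax => //; apply: le_trans (hN0 n n0 k ex) => /=.
have := L1dist_triangle (L2_integrable x) (L2_integrable u) (L2_integrable (v (s n))).
by have := hN2 n n2; move: xr; rewrite !norm1B; lra.
Qed.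

End infinite_run.

End algorithm.

(** * The three outcomes *)

Section outcomes.
Context {R : realType}.

Lemma limn_einf_gt0 (x : nat -> \bar R) : (0 < limn_einf x)%E ->
  exists2 r : R, 0 < r & exists N, forall n, (N <= n)%N -> (r%:E <= x n)%E.
Proof.
rewrite -[limn_einf x]/(limf_einf x \oo) limf_einfE.
move=> /ereal_sup_gt[_ /= [V [N _ NV] <-] Vgt].
have [r r0 rV] : exists2 r, 0 < r & (r%:E <= ereal_inf [set x n | n in V])%E.
  case: (ereal_inf _) Vgt => [r||//] r0; last by exists 1; rewrite ?leey.
  by exists r.
exists r => //; exists N => n Nn; apply: le_trans rV _.
by apply: ereal_inf_lbound; exists n => //; exact: NV.
Qed.

Lemma first_failure (P : nat -> Prop) : P 0%N -> ~ (forall n, P n) ->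
  exists n, P n /\ ~ P n.+1.
Proof.
move=> P0 nP; apply: contrapT => h; apply: nP; elim=> // n Pn.
by apply: contrapT => nPn; apply: h; exists n.
Qed.

End outcomes.

Theorem theorem4p23 (R : realType) (t0 tf : R) (M : nat) (nu : 'I_M -> int)
    (alpha : R) (F : L2 t0 tf -> R) (DF : L2 t0 tf -> L2 t0 tf -> R)
    (D2F : L2 t0 tf -> L2 t0 tf -> L2 t0 tf -> R)
    (gradF : L2 t0 tf -> L2 t0 tf)
    (Delta0 sigma : R) (v0 : L2 t0 tf)
    (v : nat -> L2 t0 tf) (w : nat -> nat -> L2 t0 tf) :
  t0 < tf -> (0 < M)%N ->
  (forall i j : 'I_M, (i < j)%N -> nu i < nu j) ->
  0 < alpha ->
  (exists c : R, forall u, c <= F u) ->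
  twice_cont_frechet F DF D2F ->
  riesz_gradient DF gradF ->
  (exists2 C : R, 0 < C & forall xi u h : L2 t0 tf,
    (`|D2F xi u h|%:E <= C%:E * normL1 t0 tf u * normL1 t0 tf h)%E) ->
  0 < Delta0 -> 0 < sigma -> sigma < 1 ->
  FP nu v0 -> BV t0 tf v0 ->
  SLIP_run nu alpha F gradF Delta0 sigma v0 v w ->
  let is_iterate := produced alpha F gradF sigma v w in
  let O1 := outcome1 nu alpha F gradF sigma v w in
  let O2 := outcome2 nu alpha F gradF sigma v w in
  let O3 := outcome3 nu alpha F gradF Delta0 sigma v w in
  [/\ forall n, is_iterate n -> FP nu (v n),
      forall m n, (m < n)%N -> is_iterate n ->
        (J alpha F (v n) < J alpha F (v m))%E,
      [\/ O1, O2 | O3] &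
      [/\ ~ (O1 /\ O2), ~ (O1 /\ O3) & ~ (O2 /\ O3)]].
Proof.
move=> t0tf _ _ alpha0 [c Fc] hF riesz [C C0 hC] D0 s0 s1 v0FP v0BV run.
move=> is_iterate O1 O2 O3.
have adm n : is_iterate n -> admissible nu (v n).
  exact: (produced_admissible t0tf alpha0 hF riesz D0 v0FP v0BV run).
have prod_le m n : (m <= n)%N -> is_iterate n -> is_iterate m.
  exact: (produced_le t0tf alpha0 hF riesz D0 v0FP v0BV run).
have final_uniq N N' : final_index alpha F gradF sigma v w N ->
    final_index alpha F gradF sigma v w N' -> N = N'.
  move=> [pN npN] [pN' npN']; apply/eqP; rewrite eqn_leq; apply/andP; split.
    by rewrite leqNgt; apply/negP => h; apply: npN'; exact: prod_le h pN.
  by rewrite leqNgt; apply/negP => h; apply: npN; exact: prod_le h pN'.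
split.
- by move=> n /adm[].
- move=> m n mn pn; have pm : is_iterate m := prod_le _ _ (ltnW mn) pn.
  rewrite (J_Jr t0tf alpha0 hF riesz D0 v0FP v0BV run pn).
  rewrite (J_Jr t0tf alpha0 hF riesz D0 v0FP v0BV run pm) lte_fin.
  exact: (Jr_mono t0tf alpha0 hF riesz D0 s0 v0FP v0BV run mn pn).
- have [all_prod|nall] := pselect (forall n, is_iterate n).
    apply: Or33; split => //.
    + exact: (exists_accumulation t0tf alpha0 Fc hF riesz D0 s0 v0FP v0BV run all_prod).
    + move=> f [s sS sf].
      have [u uE [au vu]] := accumulation_admissible
        t0tf alpha0 hF riesz D0 v0FP v0BV run all_prod sS sf.
      split.
        exists u => //; split; first by case: au.
        exact: (accumulation_L_stationary t0tf alpha0 Fc hF riesz C0 hC D0 s0 s1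
          v0FP v0BV run all_prod sS au vu).
      exists s => //; rewrite -uE.
      exact: (accumulation_strict t0tf alpha0 Fc hF riesz C0 hC D0 s0 s1
          v0FP v0BV run all_prod sS au vu).
    + move=> s sS /limn_einf_gt0[r r0 [N hN]] f [s' s'S sf].
      have ssS := subsequence_comp sS s'S.
      have [u uE [au vu]] := accumulation_admissible
        t0tf alpha0 hF riesz D0 v0FP v0BV run all_prod ssS sf.
      exists u => //; exists (r / 2); first by rewrite divr_gt0.
      apply: (radii_bounded_solution t0tf alpha0 Fc hF riesz C0 hC D0 s0
          v0FP v0BV run all_prod ssS au vu r0).
      exists N => n Nn k ex; rewrite -lee_fin.
      apply: le_trans (hN (s' n) (leq_trans Nn (subsequence_ge s'S n))) _.
      by apply: ereal_inf_lbound; exists k.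
  have p0 : is_iterate 0%N by exact: executed_start.
  have [N [pN npN]] := first_failure p0 nall.
  have [all_ex|nex] := pselect (forall k, executed alpha F gradF sigma v w N.+1 k).
    apply: Or32; exists N; split => //.
    exact: (inner_loop_infinite_L_stationary t0tf alpha0 hF riesz C0 hC D0 s1
      v0FP v0BV run all_ex).
  have [k [ek nek]] := first_failure pN nex.
  have [ple|pgt] := leP (predicted_reduction alpha gradF (v N) (w N.+1 k)) 0.
    have sol := pred_le0_solution t0tf alpha0 hF riesz D0 v0FP v0BV run ek ple.
    apply: Or31; exists N; split => //.
      by exists (Defs.radius Delta0 k) => //; exact: radius_gt0.
    exact: (TR_solution_L_stationary t0tf alpha0 hF riesz (adm N pN) (radius_gt0 D0 k) sol).
  exfalso; have [al|ar] := leP (sigma%:E * predicted_reduction alpha gradF (v N) (w N.+1 k))%E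
      (actual_reduction alpha F (v N) (w N.+1 k)).
    by apply: npN; exact: (executed_accept ek).
  by apply: nek; exact: (executed_reject ek).
- split.
  + move=> [[N [fN [Delta Delta0' sol] _]] [N' [fN' ex _]]].
    rewrite -(final_uniq _ _ fN fN') in ex.
    exact: (solution_stops t0tf alpha0 hF riesz D0 v0FP v0BV run Delta0' sol ex).
  + by move=> [[N [[_ npN] _ _]] [all_prod _ _ _]]; exact: npN (all_prod _).
  + by move=> [[N [[_ npN] _ _]] [all_prod _ _ _]]; exact: npN (all_prod _).
Qed.
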